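(* Let $A$ be a maximal dissipative operator on $H$ and put $R=\mathrm{Ran}\big((\Gamma(A+i)^{-1})^*\big)\cup\mathrm{Ran}\big((\Gamma_*(A^*-i)^{-1})^*\big)\subseteq H$, $$H_{cns}=\mathrm{clos}\Big[\mathrm{Span}_{\mu\in\mathbb C^-}\{(A-\mu)^{-1}R\}+\mathrm{Span}_{\lambda\in\mathbb C^+}\{(A^*-\lambda)^{-1}R\}\Big],$$ and $H_{sa}=H\ominus H_{cns}$. Then: (1) $H_{cns}$ is a reducing subspace for $A$. (2) $A_{sa}:=A\vert_{H_{sa}}$ is selfadjoint. (3) The operator $A_{cns}:=A\vert_{H_{cns}}$ is completely non-selfadjoint. (4) The subspace $\{0\}\oplus H_{sa}\oplus\{0\}$ is reducing for $\mathcal L$, and $\mathcal L$ restricted to $\{0\}\oplus H_{sa}\oplus\{0\}$ is given by $A_{sa}$. (5) $$\bigvee_{\lambda\notin\mathbb R}(\mathcal L-\lambda)^{-1}\big(L^2(\mathbb R^-,E_* )\oplus\{0\}\oplus L^2(\mathbb R^+,E)\big)=\mathcal H\ominus\big(\{0\}\oplus H_{sa}\oplus\{0\}\big)=L^2(\mathbb R^-,E_* )\oplus H_{cns}\oplus L^2(\mathbb R^+,E).$$ (6) $\mathcal L$ restricted to $L^2(\mathbb R^-,E_* )\oplus H_{cns}\oplus L^2(\mathbb R^+,E)$ is a minimal selfadjoint dilation of $A_{cns}$.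
   Context: Inner products are linear in the first argument. $\mathbb C^\pm=\{z:\pm\Im z>0\}$, $\mathbb R^-=(-\infty,0)$, $\mathbb R^+=(0,\infty)$. $\bigvee$ denotes closed linear span and $\mathrm{Span}$ linear span. A densely defined operator $A$ in a Hilbert space $H$ is dissipative if $\Im\langle Ah,h\rangle\ge 0$ for all $h\in D(A)$, and maximal dissipative if it is dissipative and has no non-trivial dissipative extension; then $\mathbb C^-\subseteq\rho(A)$ and $\mathbb C^+\subseteq\rho(A^* )$. $E,E_*$ are Hilbert spaces and $\Gamma:D(A)\to E$, $\Gamma_*:D(A^* )\to E_*$ are fixed linear operators, bounded in the graph norms of $A$ and $A^*$ respectively, with dense ranges, such that $\langle Au,v\rangle-\langle u,Av\rangle=i\langle\Gamma u,\Gamma v\rangle_E$ for all $u,v\in D(A)$ and $\langle A^*u,v\rangle-\langle u,A^*v\rangle=-i\langle\Gamma_*u,\Gamma_*v\rangle_{E_*}$ for all $u,v\in D(A^* )$. (Any such choice is allowed.) For $z\in\rho(A^* )$, $S(z):E\to E_*$ is the bounded operator determined by $S(z)\Gamma u=\Gamma_*(A^*-z)^{-1}(A-z)u$ for $u\in D(A)$ (extended from $\mathrm{Ran}\,\Gamma$ to $E$ by continuity); $S^*(z)$ denotes $(S(z))^*$. The operator $\mathcal L$ on $\mathcal H=L^2(\mathbb R^-,E_* )\oplus H\oplus L^2(\mathbb R^+,E)$: fix $\mu\in\mathbb C^-$ and $\lambda\in\mathbb C^+$ (the definition does not depend on this choice). $D(\mathcal L)$ is the set of all $U=(v_-,u,v_+)\in\mathcal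 H$ such that $u\in H$, $v_+\in H^1(\mathbb R^+,E)$, $v_-\in H^1(\mathbb R^-,E_* )$, $u+(\Gamma_*(A^*+\mu)^{-1})^*v_-(0)\in D(A)$, $u+(\Gamma(A+\lambda)^{-1})^*v_+(0)\in D(A^* )$, and (I) $v_+(0)=S^*(-\mu)v_-(0)+i\Gamma\big(u+(\Gamma_*(A^*+\mu)^{-1})^*v_-(0)\big)$, (II) $v_-(0)=S(-\bar\lambda)v_+(0)-i\Gamma_*\big(u+(\Gamma(A+\lambda)^{-1})^*v_+(0)\big)$. For $U\in D(\mathcal L)$, $\mathcal L U=(iv_-',\,TU,\,iv_+')$, where $$TU=A^*\big(u+(\Gamma(A+\lambda)^{-1})^*v_+(0)\big)+\bar\lambda(\Gamma(A+\lambda)^{-1})^*v_+(0).$$ A (closed) subspace $K$ is invariant for an operator $B$ if $P_KD(B)\subseteq D(B)$ and $BP_Kh\in K$ for all $h\in D(B)$ ($P_K$ the orthogonal projection), and reducing if both $K$ and its orthogonal complement are invariant. $B\vert_K$ has domain $D(B)\cap K$. A maximal dissipative operator $B$ is completely non-selfadjoint if there is no non-zero reducing subspace $K$ such that $B\vert_K$ is selfadjoint. A selfadjoint operator $\mathcal M$ on a Hilbert space $\mathcal K\supseteq K_0$ is a selfadjoint dilation of a maximal dissipative operator $B$ on $K_0$ if $(B-\lambda)^{-1}=P_{K_0}(\mathcal M-\lambda)^{-1}\vert_{K_0}$ for all $\lambda\in\mathbb C^-$; it is minimal if it contains no non-trivial reducing part which is itself a selfadjoint dilation of $B$, i.e.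 there is no reducing subspace $K$ of $\mathcal M$ with $K_0\subseteq K\subsetneq\mathcal K$ such that $\mathcal M\vert_K$ is a selfadjoint dilation of $B$. Here $H_{cns}$ is identified with $\{0\}\oplus H_{cns}\oplus\{0\}$. *)

(* Defs.v *)
From HB Require Import structures.
From mathcomp Require Import all_boot all_order all_algebra complex sesquilinear.
From mathcomp Require Import ring_quotient generic_quotient.
From mathcomp Require Import all_classical all_reals all_analysis measurable_realfun.
From mathcomp Require Import ring lra.
Set Implicit Arguments.
Unset Strict Implicit.
Unset Printing Implicit Defensive.
Import Order.TTheory GRing.Theory Num.Theory.
Import numFieldNormedType.Exports.

Local Open Scope classical_set_scope.
Local Open Scope complex_scope.
Local Open Scope ring_scope.

(* inner products are linear in the first argument *)
HB.mixin Record NormedModule_isPreHilbert (R : realType) H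
    & NormedModule R[i] H := {
  inner : H -> H -> R[i] ;
  innerP : forall (a : R[i]) u v w,
    inner (a *: u + v) w = a * inner u w + inner v w ;
  innerC : forall u v, inner v u = (inner u v)^* ;
  inner_norm : forall u, inner u u = `|u| ^+ 2
}.

#[short(type="preHilbertType")]
HB.structure Definition PreHilbert (R : realType) :=
  {H of NormedModule R[i] H & NormedModule_isPreHilbert R H}.

#[short(type="hilbertType")]
HB.structure Definition Hilbert (R : realType) :=
  {H of PreHilbert R H & Complete H}.

Notation "'[ u , v ]" := (inner u v) : ring_scope.

Section form_norm.
Context (R : realType) (V : lmodType R[i]) (form : V -> V -> R[i]).
Context (formP : forall (a : R[i]) u v w,
  form (a *: u + v) w = a * form u w + form v w).
Context (formC : forall u v, form v u = (form u v)^*).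
Context (form_ge0 : forall u, 0 <= form u u).
Context (form_eq0 : forall u, form u u = 0 -> u = 0).

Definition form_norm u := sqrtC (form u u).

Let formDl u v w : form (u + v) w = form u w + form v w.
Proof. by rewrite -[u]scale1r formP mul1r scale1r. Qed.
Let form0l w : form 0 w = 0.
Proof. by apply: (addrI (form 0 w)); rewrite -formDl !addr0. Qed.
Let formZl a u w : form (a *: u) w = a * form u w.
Proof. by rewrite -[a *: u]addr0 formP form0l addr0. Qed.
Let formDr u v w : form w (u + v) = form w u + form w v.
Proof. by rewrite formC formDl rmorphD/= -!formC. Qed.
Let formZr a u w : form w (a *: u) = a^* * form w u.
Proof. by rewrite formC formZl rmorphM/= -!formC. Qed.

Lemma form_normZ a u : form_norm (a *: u) = `|a| * form_norm u.
Proof.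
rewrite /form_norm formZl formZr mulrA -normCK sqrtCM ?nnegrE ?exprn_ge0//.
by rewrite sqrCK.
Qed.

Lemma form_norm0 u : form_norm u = 0 -> u = 0.
Proof. by move=> /eqP; rewrite sqrtC_eq0 => /eqP/form_eq0. Qed.

Lemma form_CS u v : `|form u v| ^+ 2 <= form u u * form v v.
Proof.
have [->|v0] := eqVneq v 0.
  by rewrite !form0l mulr0 formC form0l conjC0 normr0 expr0n.
have vv0 : 0 < form v v.
  by rewrite lt_def form_ge0 andbT; apply: contra v0 => /eqP/form_eq0 ->.
pose a := - (form u v / form v v).
have := form_ge0 (a *: v + u).
rewrite formDl !formDr !formZl !formZr /a.
rewrite rmorphN rmorphM/= fmorphV/= -(formC v v) -(formC u v).
rewrite [form v u]formC normCK.
set x := form u v; set y := form v v; move: vv0; rewrite -/y => y0.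
have yn : y != 0 by rewrite gt_eqF.
rewrite (_ : _ + _ = form u u - x * x^* / y); last by field.
by rewrite subr_ge0 ler_pdivrMr.
Qed.

Lemma form_normD u v : form_norm (u + v) <= form_norm u + form_norm v.
Proof.
rewrite -ler_sqr ?nnegrE ?addr_ge0 ?sqrtC_ge0//.
rewrite sqrrD !sqrtCK formDl !formDr [form v u]formC.
have key : form u v + (form u v)^* <= form_norm u * form_norm v *+ 2.
  have -> : form u v + (form u v)^* = 'Re (form u v) *+ 2.
    by rewrite ReE -mulr_natr divfK// pnatr_eq0.
  rewrite lerMn2r /=.
  apply: le_trans (_ : `|form u v| <= _).
    by have [] := leif_Re_Creal (form u v).
  rewrite -ler_sqr ?nnegrE ?mulr_ge0 ?sqrtC_ge0// exprMn !sqrtCK.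
  exact: form_CS.
rewrite -addrA [form u v + _]addrA addrA; set x := form u v in key *.
by rewrite -!addrA lerD2l !addrA lerD2r.
Qed.

End form_norm.

HB.factory Record Lmodule_isPreHilbert (R : realType) V & GRing.Lmodule R[i] V := {
  form : V -> V -> R[i] ;
  formP : forall (a : R[i]) u v w,
    form (a *: u + v) w = a * form u w + form v w ;
  formC : forall u v, form v u = (form u v)^* ;
  form_ge0 : forall u, 0 <= form u u ;
  form_eq0 : forall u, form u u = 0 -> u = 0
}.

HB.builders Context R V & Lmodule_isPreHilbert R V.

HB.instance Definition _ := @Lmodule_isNormed.Build R[i] V (form_norm form)
  (form_normD formP formC form_ge0 form_eq0) (form_normZ formP formC form_ge0)
  (form_norm0 form_eq0).

Let inner_norm u : form u u = `|u| ^+ 2.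
Proof. by rewrite /Num.norm/= /form_norm sqrtCK. Qed.

HB.instance Definition _ :=
  NormedModule_isPreHilbert.Build R V formP formC inner_norm.

HB.end.

(* over [R[i]] the library norm [`|u|] takes values in [R[i]]; this is the same
   norm, valued in [R] *)
Definition nrm (R : realType) (H : normedModType R[i]) (u : H) : R :=
  complex.Re `|u|.

Section inner_theory.
Context (R : realType) (H : preHilbertType R).
Implicit Types (u v w : H) (a : R[i]).

Lemma innerDl u v w : '[u + v, w] = '[u, w] + '[v, w].
Proof. by rewrite -[u]scale1r innerP mul1r scale1r. Qed.
Lemma inner0l w : '[0, w] = 0.
Proof. by apply: (addrI '[0, w]); rewrite -innerDl !addr0. Qed.
Lemma innerZl a u w : '[a *: u, w] = a * '[u, w].
Proof. by rewrite -[a *: u]addr0 innerP inner0l addr0. Qed.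
Lemma innerDr u v w : '[w, u + v] = '[w, u] + '[w, v].
Proof. by rewrite innerC innerDl rmorphD/= -!innerC. Qed.
Lemma innerZr a u w : '[w, a *: u] = a^* * '[w, u].
Proof. by rewrite innerC innerZl rmorphM/= -!innerC. Qed.

Let inner_bilinear : bilinear_for
  (GRing.Scale.Law.clone _ _ *%R _)
  (GRing.Scale.Law.clone _ _ (Num.conj \; *%R) _) (@inner R H).
Proof.
by split=> [u'|u] a x y /=; [rewrite innerP | rewrite innerDr innerZr].
Qed.

HB.instance Definition _ :=
  bilinear_isBilinear.Build R[i] H H R[i] _ _ (@inner R H) inner_bilinear.

Let inner_herm u v : '[u, v] = (-1) ^+ false * Num.conj '[v, u].
Proof. by rewrite expr0 mul1r innerC. Qed.

HB.instance Definition _ :=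
  isHermitianSesquilinear.Build R[i] H false Num.conj (@inner R H) inner_herm.

Let inner_gt0 u : u != 0 -> 0 < '[u, u].
Proof. by move=> u0; rewrite inner_norm exprn_gt0// normr_gt0. Qed.

HB.instance Definition _ := isDotProduct.Build R[i] H (@inner R H) inner_gt0.

Lemma nrmE u : `|u| = (nrm u)%:C.
Proof.
have := normr_ge0 u; rewrite /nrm; case: `|u| => a b /=.
by rewrite lecE/= => /andP[/eqP-> _].
Qed.

Lemma nrm_ge0 u : 0 <= nrm u.
Proof. by have := normr_ge0 u; rewrite nrmE lecR. Qed.

Lemma nrmD u v : nrm (u + v) <= nrm u + nrm v.
Proof. by rewrite -lecR rmorphD/= -!nrmE; exact: ler_normD. Qed.

Lemma nrmN u : nrm (- u) = nrm u.
Proof. by rewrite /nrm normrN. Qed.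

Lemma nrmB u v : nrm (u - v) = nrm (v - u).
Proof. by rewrite -opprB nrmN. Qed.

Lemma nrm0 : nrm (0 : H) = 0.
Proof. by rewrite /nrm normr0. Qed.

Lemma nrm0_eq0 u : nrm u = 0 -> u = 0.
Proof. by move=> u0; apply/normr0_eq0; rewrite nrmE u0. Qed.

Lemma inner_nrm u : '[u, u] = (nrm u ^+ 2)%:C.
Proof. by rewrite inner_norm nrmE -rmorphXn. Qed.

End inner_theory.

Section complete_seq.
Context (R : realType) (H : preHilbertType R).

Definition seq_complete := forall u : nat -> H,
  (forall e : R, 0 < e -> exists N, forall m n, (N <= m)%N -> (N <= n)%N ->
     nrm (u m - u n) < e) ->
  exists l, forall e : R, 0 < e -> exists N, forall n, (N <= n)%N ->
     nrm (u n - l) < e.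

Lemma posC_gt0 (e : R[i]) : 0 < e -> exists2 d : R, 0 < d & e = d%:C.
Proof.
case: e => a b; rewrite ltcE/= => /andP[/eqP-> a0].
by exists a.
Qed.

Lemma ball_nrm (x y : H) (e : R) : ball x e%:C y <-> nrm (x - y) < e.
Proof. by rewrite -ball_normE/= /ball_/= nrmE ltcR. Qed.

Lemma seq_complete_cvg (hc : seq_complete) (F : set_system H) :
  ProperFilter F -> cauchy F -> cvg F.
Proof.
move=> PF /cauchyP Fc.
have ex n : {x | F (ball x (n.+1%:R^-1 : R)%:C)}.
  by apply/cid/Fc; rewrite ltcR invr_gt0.
pose u n := sval (ex n); have uP n : F (ball (u n) (n.+1%:R^-1 : R)%:C).
  exact: (svalP (ex n)).
have small (e : R) : 0 < e -> exists N, forall n, (N <= n)%N ->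
    n.+1%:R^-1 < e :> R.
  move=> e0; have [N _ NP] := near_infty_natSinv_lt (PosNum e0).
  by exists N => n Nn; exact: NP.
have [|l lP] := hc u.
  move=> e e0; have [N NP] := small (e / 2) ltac:(by rewrite divr_gt0).
  exists N => m n Nm Nn.
  have [z [/ball_nrm zm /ball_nrm zn]] := filter_ex (filterI (uP m) (uP n)).
  rewrite (_ : u m - u n = (u m - z) + (z - u n)); last by rewrite addrA subrK.
  apply: le_lt_trans (nrmD _ _) _; rewrite [nrm (z - _)]nrmB.
  by rewrite (splitr e) ltrD// ?(lt_trans zm (NP _ Nm)) ?(lt_trans zn (NP _ Nn)).
apply/cvg_ex; exists l; apply/cvg_ballP => e /posC_gt0[{}e e0 ->].
have e20 : 0 < e / 2 by rewrite divr_gt0.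
have [N1 N1P] := small _ e20; have [N2 N2P] := lP _ e20.
pose n := maxn N1 N2.
apply: filterS (uP n) => z /ball_nrm unz; apply/ball_nrm.
rewrite (_ : l - z = (l - u n) + (u n - z)); last by rewrite addrA subrK.
apply: le_lt_trans (nrmD _ _) _; rewrite [nrm (l - _)]nrmB (splitr e) ltrD//.
  by apply: N2P; rewrite leq_maxr.
by apply: lt_trans unz (N1P _ _); rewrite leq_maxl.
Qed.

End complete_seq.

Lemma hilbert_seq_complete (R : realType) (H : hilbertType R) : seq_complete H.
Proof.
move=> u uc.
have /cauchy_cvg /cvg_ex[l ul] : cauchy (u @ \oo).
  apply/cauchyP => e /posC_gt0[{}e e0 ->]; have [N NP] := uc _ e0.
  exists (u N); exists N => // n /= Nn; apply/ball_nrm.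
  exact: NP.
exists l => e e0.
have /cvg_ballP /(_ e%:C) := ul; rewrite ltcR => /(_ e0) [N _ NP].
exists N => n Nn; rewrite nrmB; apply/ball_nrm; exact: NP.
Qed.

(* orthogonal sum; an alias of the product, which carries the sup norm *)
Definition hsum (U V : Type) : Type := (U * V)%type.
Notation "U ⊕ V" := (hsum U V) (at level 50, left associativity) : type_scope.

Section hsum.
Context (R : realType) (U V : preHilbertType R).

HB.instance Definition _ := GRing.Lmodule.copy (U ⊕ V) (U * V)%type.

Definition hsum_form (x y : U ⊕ V) := '[x.1, y.1] + '[x.2, y.2].

Let hsum_formP (a : R[i]) u v w :
  hsum_form (a *: u + v) w = a * hsum_form u w + hsum_form v w.
Proof. by rewrite /hsum_form !innerP mulrDr addrACA. Qed.

Let hsum_formC u v : hsum_form v u = (hsum_form u v)^*.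
Proof. by rewrite /hsum_form rmorphD/= -!innerC. Qed.

Let hsum_form_ge0 u : 0 <= hsum_form u u.
Proof. by rewrite addr_ge0// inner_norm exprn_ge0. Qed.

Let hsum_form_eq0 u : hsum_form u u = 0 -> u = 0.
Proof.
case: u => a b /eqP; rewrite /hsum_form !inner_norm paddr_eq0 ?exprn_ge0//.
by rewrite !sqrf_eq0 !normr_eq0/= => /andP[/eqP -> /eqP ->].
Qed.

HB.instance Definition _ := Lmodule_isPreHilbert.Build R (U ⊕ V)
  hsum_formP hsum_formC hsum_form_ge0 hsum_form_eq0.

Lemma hsum_innerE (x y : U ⊕ V) : '[x, y] = '[x.1, y.1] + '[x.2, y.2].
Proof. by []. Qed.

Lemma hsum_nrm2 (x : U ⊕ V) : nrm x ^+ 2 = nrm x.1 ^+ 2 + nrm x.2 ^+ 2.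
Proof. by apply: complexI; rewrite rmorphD/= -!inner_nrm. Qed.

End hsum.

Section hsum_complete.
Context (R : realType) (U V : hilbertType R).

Lemma hsum_seq_complete : seq_complete (U ⊕ V).
Proof.
move=> u uc.
have le1 (x : U ⊕ V) : nrm x.1 <= nrm x.
  by rewrite -ler_sqr ?nnegrE ?nrm_ge0// hsum_nrm2 lerDl sqr_ge0.
have le2 (x : U ⊕ V) : nrm x.2 <= nrm x.
  by rewrite -ler_sqr ?nnegrE ?nrm_ge0// hsum_nrm2 lerDr sqr_ge0.
have [|l1 l1P] := hilbert_seq_complete (u := fun n => (u n).1).
  move=> e /uc[N NP]; exists N => m n Nm Nn.
  exact: le_lt_trans (le1 _) (NP _ _ Nm Nn).
have [|l2 l2P] := hilbert_seq_complete (u := fun n => (u n).2).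
  move=> e /uc[N NP]; exists N => m n Nm Nn.
  exact: le_lt_trans (le2 _) (NP _ _ Nm Nn).
exists (l1, l2) => e e0; have e20 : 0 < e / 2 by rewrite divr_gt0.
have [N1 N1P] := l1P _ e20; have [N2 N2P] := l2P _ e20.
exists (maxn N1 N2) => n; rewrite geq_max => /andP[Nn1 Nn2].
rewrite -ltr_sqr ?nnegrE ?nrm_ge0 ?ltW// hsum_nrm2/=.
move: (N1P _ Nn1) (N2P _ Nn2); have := nrm_ge0 ((u n).1 - l1).
have := nrm_ge0 ((u n).2 - l2); set a := nrm _; set b := nrm _; nra.
Qed.

HB.instance Definition _ := Uniform_isComplete.Build (U ⊕ V)
  (seq_complete_cvg hsum_seq_complete).

End hsum_complete.

Section nrm_cvg.
Context (R : realType) (H : preHilbertType R).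

Lemma cvg_nrmP (u : nat -> H) (l : H) :
  u @ \oo --> l <-> forall e : R, 0 < e ->
    exists N, forall n, (N <= n)%N -> nrm (u n - l) < e.
Proof.
split=> [/cvg_ballP ul e e0|ul].
  have := ul e%:C; rewrite ltcR => /(_ e0) [N _ NP].
  by exists N => n Nn; rewrite nrmB; apply/ball_nrm; exact: NP.
apply/cvg_ballP => e /posC_gt0[{}e e0 ->]; have [N NP] := ul _ e0.
exists N => // n /= Nn; apply/ball_nrm; rewrite nrmB; exact: NP.
Qed.

Lemma nrm_dist (u v : H) : `|nrm u - nrm v| <= nrm (u - v).
Proof.
rewrite ler_norml; apply/andP; split.
  rewrite lerNl opprB lerBlDr nrmB.
  by apply: le_trans (nrmD _ _); rewrite subrK.
by rewrite lerBlDr; apply: le_trans (nrmD _ _); rewrite subrK.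
Qed.

Lemma cvg_nrm (u : nat -> H) (l : H) :
  u @ \oo --> l -> (fun n => nrm (u n)) @ \oo --> nrm l.
Proof.
move=> /cvg_nrmP ul; apply/cvgrPdist_lt => e /ul[N NP].
exists N => // n /= /NP; apply: le_lt_trans.
by rewrite nrmB; exact: nrm_dist.
Qed.

End nrm_cvg.

Section strongly_measurable.
Context d (T : measurableType d) (R : realType).

Definition simple_fun (F : Type) (s : T -> F) :=
  finite_set (range s) /\ forall x, measurable (s @^-1` [set x]).

(* Bochner measurability. The simple functions converge everywhere, not only
   almost everywhere, so that representatives are measurable for the given
   sigma-algebra even if the measure is not complete; a class modulo null sets
   always has such a representative *)
Definition strongly_measurable (E : hilbertType R) (f : T -> E) :=
  exists2 s : nat -> T -> E, (forall n, simple_fun (s n)) &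
    forall t, (fun n => s n t) @ \oo --> f t.

Lemma simple_cst (F : Type) (x : F) : simple_fun (fun=> x).
Proof.
split; first by apply: sub_finite_set (finite_set1 x) => _ [t _ <-].
by move=> y; rewrite preimage_cst; case: ifP => _; [exact: measurableT|exact: measurable0].
Qed.

Lemma simple_comp (F G : Type) (g : F -> G) (s : T -> F) :
  simple_fun s -> simple_fun (g \o s).
Proof.
move=> [fs ms]; split.
  by rewrite -(image_comp s g setT); exact: finite_image.
move=> y; rewrite (_ : _ @^-1` _ =
    \bigcup_(x in range s `&` [set x | g x = y]) (s @^-1` [set x])); last first.
  apply/seteqP; split=> t /=.
    by move=> gy; exists (s t) => //; split => //; exists t.
  by move=> [x [_ <-] ->].
apply: fin_bigcup_measurable => //.
by apply: finite_setIl.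
Qed.

Lemma simple_pair (F G : Type) (s : T -> F) (s' : T -> G) :
  simple_fun s -> simple_fun s' -> simple_fun (fun t => (s t, s' t)).
Proof.
move=> [fs ms] [fs' ms']; split.
  apply: (@sub_finite_set _ _ (range s `*` range s')).
    by move=> _ [t _ <-]; split; exists t.
  exact: finite_setX.
move=> [x y]; rewrite (_ : _ @^-1` _ = s @^-1` [set x] `&` s' @^-1` [set y]).
  exact: measurableI.
by apply/seteqP; split=> t /= [-> ->].
Qed.

Lemma simple_measurable (s : T -> R) : simple_fun s -> measurable_fun setT s.
Proof.
move=> [fs ms] _ Y mY; rewrite setTI (_ : _ @^-1` _ =
    \bigcup_(x in range s `&` Y) (s @^-1` [set x])).
  by apply: fin_bigcup_measurable => //; exact: finite_setIl.
apply/seteqP; split=> t /=.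
  by move=> Yt; exists (s t) => //; split => //; exists t.
by move=> [x [_ Yx] ->].
Qed.

Context (E : hilbertType R).
Implicit Types (f g : T -> E).

Lemma simple_strongly_measurable f : simple_fun f -> strongly_measurable f.
Proof. by move=> sf; exists (fun=> f) => // t; exact: cvg_cst. Qed.

Lemma strongly_measurableD f g : strongly_measurable f ->
  strongly_measurable g -> strongly_measurable (f + g).
Proof.
move=> [s ss sf] [s' ss' sg]; exists (fun n => s n + s' n).
  move=> n; exact: (simple_comp (fun x => x.1 + x.2)
                      (simple_pair (ss n) (ss' n))).
by move=> t; exact: cvgD.
Qed.

Lemma strongly_measurableZ (a : R[i]) f : strongly_measurable f ->
  strongly_measurable (a *: f).
Proof.
move=> [s ss sf]; exists (fun n => a *: s n).
  by move=> n; exact: (simple_comp (fun x => a *: x) (ss n)).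
by move=> t; apply: cvgZr; exact: sf.
Qed.

Lemma strongly_measurable_nrm f : strongly_measurable f ->
  measurable_fun setT (fun t => nrm (f t)).
Proof.
move=> [s ss sf]; apply: (measurable_fun_cvg (h := fun n t => nrm (s n t))).
  by move=> n; apply: simple_measurable; exact: simple_comp (ss n).
by move=> t _; exact/cvg_nrm/sf.
Qed.

Lemma strongly_measurable_nrmB f (x : E) : strongly_measurable f ->
  measurable_fun setT (fun t => nrm (f t - x)).
Proof.
move=> mf; have -> : (fun t => nrm (f t - x)) = fun t => nrm ((f + cst (- x)) t).
  by [].
apply: strongly_measurable_nrm; apply: strongly_measurableD => //.
exact/simple_strongly_measurable/simple_cst.
Qed.

(* a Pettis-type criterion *)
Lemma strongly_measurableP f : strongly_measurable f <->
  exists2 x : nat -> E,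
    (forall t (e : R), 0 < e -> exists n, nrm (f t - x n) < e) &
    (forall n, measurable_fun setT (fun t => nrm (f t - x n))).
Proof.
split=> [mf|[x xd xm]].
  have [s ss sf] := mf.
  have cs : countable (\bigcup_n (range (s n))).
    apply: bigcup_countable => // n _; exact/finite_set_countable/(ss n).1.
  have [g ginj] := countable_injP _ cs.
  pose x n := xget 0 [set y | (\bigcup_n range (s n)) y /\ g y = n].
  have x0 : \bigcup_n range (s n) `<=` range x.
    move=> y Sy; exists (g y) => //.
    have [Sxy /ginj xy] : [set z | (\bigcup_n range (s n)) z /\ g z = g y] (x (g y)).
      exact: (xgetPex 0 (ex_intro _ y (conj Sy erefl))).
    by apply: xy; rewrite inE.
  exists x => [t e e0|n]; last exact: strongly_measurable_nrmB.
  have /cvg_nrmP/(_ _ e0)[N NP] := sf t.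
  have [k _ xk] : range x (s N t) by apply: x0; exists N => //; exists t.
  by exists k; rewrite xk nrmB; exact: NP.
pose p := fix p n := if n is m.+1 then
    (fun t => if nrm (f t - x m.+1) < nrm (f t - p m t) then x m.+1 else p m t)
  else fun=> x 0.
have pm n : simple_fun (p n) /\ measurable_fun setT (fun t => nrm (f t - p n t)).
  elim: n => [|n [sp mp]].
    by split; [exact: simple_cst|exact: xm].
  have mlt : measurable_fun setT
      (fun t => nrm (f t - x n.+1) < nrm (f t - p n t)).
    exact: measurable_fun_ltr.
  have slt : simple_fun (fun t => nrm (f t - x n.+1) < nrm (f t - p n t)).
    split; first exact: finite_finset.
    by move=> b; rewrite -[X in measurable X]setTI; exact: mlt.
  split.
    exact: (simple_comp (fun z => if z.1 then x n.+1 else z.2)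
      (simple_pair slt sp)).
  rewrite (_ : (fun t => _) = fun t =>
      if nrm (f t - x n.+1) < nrm (f t - p n t)
      then nrm (f t - x n.+1) else nrm (f t - p n t)).
    exact: measurable_fun_ifT.
  by apply/funext => t /=; case: ifP.
have pS n t : nrm (f t - p n.+1 t) <= nrm (f t - p n t).
  by rewrite /=; case: ifP => // /ltW.
have pdecr n m t : (n <= m)%N -> nrm (f t - p m t) <= nrm (f t - x n).
  elim: m => [|m IH]; first by rewrite leqn0 => /eqP ->.
  rewrite leq_eqVlt => /predU1P[->|]; last first.
    by rewrite ltnS => /IH; exact: le_trans.
  by rewrite /=; case: ifPn => //; rewrite -leNgt.
exists p => [n|t]; first exact: (pm n).1.
apply/cvg_nrmP => e /(xd t)[N NP]; exists N => n Nn.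
by rewrite nrmB; exact: le_lt_trans (pdecr _ _ _ Nn) NP.
Qed.

End strongly_measurable.

Section polarization.
Context (R : realType) (H : preHilbertType R).
Implicit Types u v : H.

Lemma Re_inner u v : complex.Re '[u, v] =
  2^-1 * (nrm (u + v) ^+ 2 - nrm u ^+ 2 - nrm v ^+ 2).
Proof.
have := inner_nrm (u + v); rewrite innerDl !innerDr !inner_nrm (innerC u v).
case: '[u, v] => a b /= /(congr1 (@complex.Re R))/= <-; lra.
Qed.

Lemma Im_inner u v : complex.Im '[u, v] = complex.Re '[u, 'i%C *: v].
Proof. by rewrite innerZr; case: '[u, v] => a b /=; ring. Qed.

Lemma nrmZ (a : R[i]) u : nrm (a *: u) = complex.Re `|a| * nrm u.
Proof.
by rewrite /nrm normrZ [`|u|]nrmE; case: `|a| => x y /=; rewrite mulr0 subr0.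
Qed.

Lemma nrmD2_le u v : nrm (u + v) ^+ 2 <= 2 * nrm u ^+ 2 + 2 * nrm v ^+ 2.
Proof.
have : nrm (u + v) ^+ 2 <= (nrm u + nrm v) ^+ 2.
  by rewrite ler_sqr ?nnegrE ?addr_ge0 ?nrm_ge0// nrmD.
have := sqr_ge0 (nrm u - nrm v).
by set x := nrm (u + v); set y := nrm u; set z := nrm v; lra.
Qed.

End polarization.

Section L2fun.
Context d (T : measurableType d) (R : realType).
Context (mu : {measure set T -> \bar R}) (E : hilbertType R).

Definition L2fun_pred : {pred T -> E} := [pred f | `[< strongly_measurable f /\
  (\int[mu]_t ((nrm (f t)) ^+ 2)%:E < +oo)%E >]].

Lemma L2funP f : reflect (strongly_measurable f /\
  mu.-integrable setT (fun t => ((nrm (f t)) ^+ 2)%:E)) (f \in L2fun_pred).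
Proof.
apply: (iffP (asboolP _)) => -[mf fi]; split=> //.
  apply/integrableP; split.
    apply/measurable_EFinP; apply: measurable_funX.
    exact: strongly_measurable_nrm.
  under eq_integral do rewrite gee0_abs ?lee_fin ?sqr_ge0//.
  exact: fi.
have /integrableP[_] := fi.
by under eq_integral do rewrite gee0_abs ?lee_fin ?sqr_ge0//.
Qed.

Lemma integrable_EFinD (f g : T -> R) : mu.-integrable setT (EFin \o f) ->
  mu.-integrable setT (EFin \o g) ->
  mu.-integrable setT (EFin \o (fun t => f t + g t)).
Proof. by move=> fi gi; exact: (integrableD measurableT fi gi). Qed.

Lemma integrable_EFinZ k (f : T -> R) : mu.-integrable setT (EFin \o f) ->
  mu.-integrable setT (EFin \o (fun t => k * f t)).
Proof. by move=> fi; exact: (integrableZl measurableT k fi). Qed.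

Lemma L2fun_submod_closed : submod_closed L2fun_pred.
Proof.
split=> [|a f g /L2funP[mf fi] /L2funP[mg gi]].
  apply/L2funP; split; first exact/simple_strongly_measurable/simple_cst.
  rewrite (_ : (fun t => _) = cst 0%E); first exact: integrable0.
  by apply/funext => t /=; rewrite nrm0 expr0n.
have mfg : strongly_measurable (a *: f + g).
  by apply: strongly_measurableD => //; exact: strongly_measurableZ.
apply/L2funP; split=> //.
pose k := 2 * (complex.Re `|a|) ^+ 2.
apply: (le_integrable measurableT (g :=
    EFin \o (fun t => k * nrm (f t) ^+ 2 + 2 * nrm (g t) ^+ 2))).
- apply/measurable_EFinP; apply: measurable_funX.
  exact: strongly_measurable_nrm.
- move=> t _ /=; rewrite lee_fin ger0_norm ?sqr_ge0//.
  apply: le_trans (ler_norm _).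
  by rewrite (le_trans (nrmD2_le _ _))// nrmZ exprMn mulrA.
- by apply: integrable_EFinD; exact: integrable_EFinZ.
Qed.

HB.instance Definition _ :=
  GRing.isSubmodClosed.Build R[i] (T -> E) L2fun_pred L2fun_submod_closed.

Record L2fun := MkL2fun { L2val :> T -> E ; _ : L2val \in L2fun_pred }.

HB.instance Definition _ := [isSub for L2val].
HB.instance Definition _ := [Choice of L2fun by <:].
HB.instance Definition _ := [SubChoice_isSubLmodule of L2fun by <:].

Implicit Types f g h : L2fun.

Lemma L2fun_meas f : strongly_measurable f.
Proof. by have /L2funP[] := valP f. Qed.

Lemma L2fun_int f : mu.-integrable setT (EFin \o (fun t => nrm (f t) ^+ 2)).
Proof. by have /L2funP[] := valP f. Qed.

Lemma integrable_Re f g :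
  mu.-integrable setT (EFin \o (fun t => complex.Re '[f t, g t])).
Proof.
rewrite (_ : (fun t => _) = fun t => 2^-1 * ((nrm ((f + g) t) ^+ 2 +
    (-1) * nrm (f t) ^+ 2) + (-1) * nrm (g t) ^+ 2)).
  apply: integrable_EFinZ; apply: integrable_EFinD.
    by apply: integrable_EFinD; [exact: L2fun_int|exact/integrable_EFinZ/L2fun_int].
  exact/integrable_EFinZ/L2fun_int.
by apply/funext => t; rewrite Re_inner !mulN1r.
Qed.

Lemma integrable_Im f g :
  mu.-integrable setT (EFin \o (fun t => complex.Im '[f t, g t])).
Proof.
rewrite (_ : (fun t => _) = fun t => complex.Re '[f t, ('i%C *: g) t]).
  exact: integrable_Re.
by apply/funext => t; rewrite Im_inner.
Qed.

Definition Cintegral (D : set T) (F : T -> R[i]) : R[i] :=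
  (\int[mu]_(t in D) complex.Re (F t)) +i*
  (\int[mu]_(t in D) complex.Im (F t)).

Definition L2form f g : R[i] := Cintegral setT (fun t => '[f t, g t]).

Lemma L2formP (a : R[i]) f g h :
  L2form (a *: f + g) h = a * L2form f h + L2form g h.
Proof.
rewrite /L2form /Cintegral; case: a => x y.
have mT : measurable [set: T] by [].
have iR := integrable_Re; have iI := integrable_Im.
apply/eqP; rewrite eq_complex/=; apply/andP; split; apply/eqP.
  under eq_Rintegral => t _.
    rewrite [X in complex.Re X](_ : _ = (x +i* y) * '[f t, h t] + '[g t, h t]); last first.
      by rewrite -innerP.
    rewrite (_ : complex.Re _ = (x * complex.Re '[f t, h t] +
      (- y) * complex.Im '[f t, h t]) + complex.Re '[g t, h t]); last first.
      by case: '[f t, h t] => ? ?; case: '[g t, h t] => ? ? /=; rewrite mulNr.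
    over.
  rewrite RintegralD//=; last by apply: integrable_EFinD; exact: integrable_EFinZ.
  rewrite RintegralD//=; try exact: integrable_EFinZ.
  by rewrite !RintegralZl// mulNr.
under eq_Rintegral => t _.
  rewrite [X in complex.Im X](_ : _ = (x +i* y) * '[f t, h t] + '[g t, h t]); last first.
    by rewrite -innerP.
  rewrite (_ : complex.Im _ = (x * complex.Im '[f t, h t] +
    y * complex.Re '[f t, h t]) + complex.Im '[g t, h t]); last first.
    by case: '[f t, h t] => ? ?; case: '[g t, h t] => ? ? /=.
  over.
rewrite RintegralD//=; last by apply: integrable_EFinD; exact: integrable_EFinZ.
rewrite RintegralD//=; try exact: integrable_EFinZ.
by rewrite !RintegralZl.
Qed.

Lemma L2formC f g : L2form g f = (L2form f g)^*.
Proof.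
apply/eqP; rewrite eq_complex/=; apply/andP; split; apply/eqP.
  by apply: eq_Rintegral => t _; rewrite innerC; case: '[f t, g t].
rewrite -mulN1r -RintegralZl//; last exact: integrable_Im.
by apply: eq_Rintegral => t _; rewrite innerC mulN1r; case: '[f t, g t].
Qed.

Lemma L2form_nrm f : L2form f f = (\int[mu]_t (nrm (f t) ^+ 2))%:C.
Proof.
apply/eqP; rewrite eq_complex/=; apply/andP; split; apply/eqP.
  by apply: eq_Rintegral => t _; rewrite inner_nrm.
rewrite (_ : (fun _ => _) = cst 0); last by apply/funext => t; rewrite inner_nrm.
by rewrite Rintegral_cst//= mul0r.
Qed.

Lemma L2form_ge0 f : 0 <= L2form f f.
Proof. by rewrite L2form_nrm lecR Rintegral_ge0// => t _; rewrite sqr_ge0. Qed.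

Definition L2null : {pred L2fun} :=
  [pred f : L2fun | `[< {ae mu, forall t, f t = 0} >]].

Lemma L2null_zmod_closed : zmod_closed L2null.
Proof.
split=> [|f g /asboolP f0 /asboolP g0]; apply/asboolP.
  by apply: nearW => t.
by apply: filterS2 f0 g0 => t /= ft gt; rewrite [LHS](_ : _ = f t - g t)// ft gt subr0.
Qed.

HB.instance Definition _ :=
  GRing.isZmodClosed.Build L2fun L2null L2null_zmod_closed.

Lemma L2nullZ a f : f \in L2null -> a *: f \in L2null.
Proof.
move=> /asboolP f0; apply/asboolP; apply: filterS f0 => t ft.
by rewrite [LHS](_ : _ = a *: f t)// ft scaler0.
Qed.

Lemma L2nullP f : L2form f f = 0 <-> f \in L2null.
Proof.
split.
  rewrite L2form_nrm => /(congr1 (@complex.Re R))/= f0.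
  have := L2fun_int f; set F := EFin \o _ => Fi.
  have F0 : (\int[mu]_t `|F t| = 0)%E.
    rewrite /Rintegral in f0.
    under eq_integral do rewrite gee0_abs ?lee_fin ?sqr_ge0//.
    by rewrite -[LHS]fineK ?f0// integrable_fin_num.
  have /integrableP[mF _] := Fi.
  apply/asboolP.
  have := (ae_eq_integral_abs mu measurableT mF).1 F0.
  apply: filterS => t /(_ I)/= [/eqP]; rewrite sqrf_eq0 => /eqP.
  exact: nrm0_eq0.
move=> /asboolP f0; rewrite L2form_nrm /Rintegral.
rewrite (ae_eq_integral (cst 0%E))//.
- by rewrite integral0.
- by have /integrableP[] := L2fun_int f.
- by apply: filterS f0 => t ft _; rewrite ft nrm0 expr0n.
Qed.

End L2fun.

Section L2.
Context d (T : measurableType d) (R : realType).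
Context (mu : {measure set T -> \bar R}) (E : hilbertType R).
Local Open Scope quotient_scope.

(* square integrable functions modulo null functions *)
Definition L2 : Type := Quotient.quot (@L2null d T R mu E).

HB.instance Definition _ := Choice.on L2.
HB.instance Definition _ := EqQuotient.on L2.
HB.instance Definition _ := GRing.Zmodule.on L2.

Definition L2repr (u : L2) : L2fun mu E := repr u.
Definition L2pi (f : L2fun mu E) : L2 := \pi_L2 f.

Lemma L2reprK : cancel L2repr L2pi. Proof. exact: reprK. Qed.

Lemma L2piE f g : (L2pi f = L2pi g) <-> f - g \in @L2null d T R mu E.
Proof.
rewrite (rwP eqP).
by rewrite /L2pi -(Quotient.idealrBE (@L2null d T R mu E)).
Qed.

Lemma L2piB f g : L2pi (f - g) = L2pi f - L2pi g.
Proof. exact: (raddfB \pi_(Quotient.quot (@L2null d T R mu E))). Qed.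

Lemma L2piD f g : L2pi (f + g) = L2pi f + L2pi g.
Proof. exact: (raddfD \pi_(Quotient.quot (@L2null d T R mu E))). Qed.

Lemma L2pi_repr f : L2repr (L2pi f) - f \in @L2null d T R mu E.
Proof. by apply/L2piE; rewrite L2reprK. Qed.

Definition L2scale (a : R[i]) (u : L2) : L2 := L2pi (a *: L2repr u).

Lemma L2scale_pi a f : L2scale a (L2pi f) = L2pi (a *: f).
Proof. by apply/L2piE; rewrite -scalerBr; apply/L2nullZ/L2pi_repr. Qed.

Let scaleA a b u : L2scale a (L2scale b u) = L2scale (a * b) u.
Proof. by rewrite -[u]L2reprK !L2scale_pi scalerA. Qed.
Let scale1 : left_id 1 L2scale.
Proof. by move=> u; rewrite -[u]L2reprK !L2scale_pi scale1r. Qed.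
Let scaleDr : right_distributive L2scale +%R.
Proof.
move=> a u v; rewrite -[u]L2reprK -[v]L2reprK.
by rewrite -L2piD !L2scale_pi -L2piD scalerDr.
Qed.
Let scaleDl u : {morph L2scale^~ u : a b / a + b}.
Proof. by move=> a b; rewrite -[u]L2reprK !L2scale_pi -L2piD scalerDl. Qed.

HB.instance Definition _ := GRing.Zmodule_isLmodule.Build R[i] L2
  scaleA scale1 scaleDr scaleDl.

Lemma L2piZ a f : L2pi (a *: f) = a *: L2pi f.
Proof. by rewrite -L2scale_pi. Qed.

Lemma L2form_null n f : n \in @L2null d T R mu E -> L2form n f = 0.
Proof.
move=> /[dup] nn /asboolP n0.
have /integrableP[mR _] := integrable_Re n f.
have /integrableP[mI _] := integrable_Im n f.
apply/eqP; rewrite eq_complex/=; apply/andP; split; apply/eqP.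
  rewrite /Rintegral (ae_eq_integral (cst 0%E))//; first by rewrite integral0.
  by apply: filterS n0 => t nt _; rewrite nt inner0l.
rewrite /Rintegral (ae_eq_integral (cst 0%E))//; first by rewrite integral0.
by apply: filterS n0 => t nt _; rewrite nt inner0l.
Qed.

Definition L2inner (u v : L2) : R[i] := L2form (L2repr u) (L2repr v).

Lemma L2inner_pi f g : L2inner (L2pi f) (L2pi g) = L2form f g.
Proof.
have h f1 f2 k : f1 - f2 \in @L2null d T R mu E -> L2form f1 k = L2form f2 k.
  move=> /(L2form_null k).
  rewrite -scaleN1r addrC L2formP mulN1r => /eqP.
  by rewrite addrC subr_eq0 => /eqP.
rewrite /L2inner (h _ f _ (L2pi_repr f)) L2formC (h _ g _ (L2pi_repr g)).
by rewrite -L2formC.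
Qed.

Let L2innerP (a : R[i]) u v w :
  L2inner (a *: u + v) w = a * L2inner u w + L2inner v w.
Proof.
rewrite -[u]L2reprK -[v]L2reprK -[w]L2reprK.
by rewrite -L2piZ -L2piD !L2inner_pi L2formP.
Qed.

Let L2innerC u v : L2inner v u = (L2inner u v)^*.
Proof. exact: L2formC. Qed.

Let L2inner_ge0 u : 0 <= L2inner u u.
Proof. exact: L2form_ge0. Qed.

Let L2inner_eq0 u : L2inner u u = 0 -> u = 0.
Proof.
rewrite -[u]L2reprK; set f := L2repr u; rewrite L2inner_pi => /L2nullP f0.
have -> : 0 = L2pi 0 by rewrite -(subrr (L2pi 0)) -L2piB subrr.
by apply/L2piE; rewrite subr0.
Qed.

HB.instance Definition _ := Lmodule_isPreHilbert.Build R L2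
  L2innerP L2innerC L2inner_ge0 L2inner_eq0.

Lemma L2nrm_pi f : (nrm (L2pi f)) ^+ 2 = \int[mu]_t (nrm (f t) ^+ 2).
Proof. by apply: complexI; rewrite -inner_nrm -L2form_nrm -L2inner_pi. Qed.

Lemma L2nrm_pi_ereal f :
  ((nrm (L2pi f)) ^+ 2)%:E = (\int[mu]_t (nrm (f t) ^+ 2)%:E)%E.
Proof.
by rewrite L2nrm_pi fineK// integrable_fin_num//; exact: L2fun_int.
Qed.

End L2.

Section strongly_measurable_lim.
Context d (T : measurableType d) (R : realType) (E : hilbertType R).

Lemma strongly_measurable_lim (g : nat -> T -> E) (f : T -> E) :
  (forall k, strongly_measurable (g k)) ->
  (forall t, (fun k => g k t) @ \oo --> f t) -> strongly_measurable f.
Proof.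
move=> mg gf; apply/strongly_measurableP.
have h k : exists x : nat -> E,
    forall t (e : R), 0 < e -> exists n, nrm (g k t - x n) < e.
  by have /strongly_measurableP[x xP _] := mg k; exists x.
have [x xP] := choice h.
pose y n := if unpickle n is Some (k, m) then x k m else 0.
exists y => [t e e0|n].
  have e20 : 0 < e / 2 by rewrite divr_gt0.
  have /cvg_nrmP/(_ _ e20)[k /(_ _ (leqnn _)) gkf] := gf t.
  have [m gx] := xP k t _ e20.
  exists (pickle (k, m)); rewrite /y pickleK.
  rewrite (_ : f t - _ = (f t - g k t) + (g k t - x k m)); last by rewrite addrA subrK.
  apply: le_lt_trans (nrmD _ _) _.
  by rewrite [nrm (f t - _)]nrmB [ltRHS](splitr e) ltrD.
apply: (measurable_fun_cvg (h := fun k t => nrm (g k t - y n))).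
  by move=> k; exact: strongly_measurable_nrmB.
by move=> t _; apply: cvg_nrm; apply: cvgB; [exact: gf|exact: cvg_cst].
Qed.

Lemma strongly_measurable_if (b : T -> bool) (f : T -> E) :
  measurable_fun setT b -> strongly_measurable f ->
  strongly_measurable (fun t => if b t then f t else 0).
Proof.
move=> mb [s ss sf].
have sb : simple_fun b.
  split; first exact: finite_finset.
  by move=> c; rewrite -[X in measurable X]setTI; exact: mb.
exists (fun n t => if b t then s n t else 0) => [n|t].
  exact: (simple_comp (fun z => if z.1 then z.2 else 0) (simple_pair sb (ss n))).
by case: (b t); [exact: sf|exact: cvg_cst].
Qed.

End strongly_measurable_lim.

Section L2complete.
Context d (T : measurableType d) (R : realType).
Context (mu : {measure set T -> \bar R}) (E : hilbertType R).

Lemma L2_lim (g : nat -> L2fun mu E) (f : T -> E) :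
  (forall t, (fun k => g k t) @ \oo --> f t) ->
  (forall e : R, 0 < e -> exists N, forall m n, (N <= m)%N -> (N <= n)%N ->
     nrm (L2pi (g m) - L2pi (g n)) < e) ->
  exists l : L2 mu E, forall e : R, 0 < e ->
    exists N, forall n, (N <= n)%N -> nrm (L2pi (g n) - l) < e.
Proof.
move=> gf gc.
have mf : strongly_measurable f.
  by apply: strongly_measurable_lim gf => k; exact: L2fun_meas.
have key n e : (exists N, forall m, (N <= m)%N ->
      nrm (L2pi (g m) - L2pi (g n)) < e) ->
    (\int[mu]_t (nrm (f t - g n t) ^+ 2)%:E <= (e ^+ 2)%:E)%E.
  move=> [N NP].
  pose F m t := (nrm (g m t - g n t) ^+ 2)%:E : \bar R.
  have mF m : measurable_fun setT (F m).
    apply/measurable_EFinP; apply: measurable_funX.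
    exact: (strongly_measurable_nrm (L2fun_meas (g m - g n))).
  have Ff t : (fun m => F m t) @ \oo --> (nrm (f t - g n t) ^+ 2)%:E.
    apply: cvg_EFin; first exact: nearW.
    rewrite /F/= (_ : fine \o _ = fun m => nrm (g m t - g n t) ^+ 2)//.
    rewrite expr2; under eq_fun do rewrite expr2.
    have cn : (fun m => nrm (g m t - g n t)) @ \oo --> nrm (f t - g n t).
      by apply: cvg_nrm; apply: cvgB; [exact: gf|exact: cvg_cst].
    exact: cvgM.
  have -> : (\int[mu]_t (nrm (f t - g n t) ^+ 2)%:E =
             \int[mu]_t (limn_einf (F^~ t)))%E.
    apply: eq_integral => t _; rewrite limn_einf_lim; apply/esym/cvg_lim => //.
    exact: cvg_einfs.
  apply: le_trans (fatou _ measurableT mF _) _.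
    by move=> m t _; rewrite lee_fin sqr_ge0.
  rewrite limn_einf_lim; apply: lime_le; first exact: is_cvg_einfs.
  apply: nearW => m; apply: le_trans (_ : (\int[mu]_t F (maxn N m) t <= _)%E).
    by apply: ereal_inf_lbound; exists (maxn N m) => //=; rewrite leq_maxr.
  rewrite /F.
  have := NP (maxn N m) (leq_maxl _ _).
  rewrite -L2piB -(L2nrm_pi_ereal (g (maxn N m) - g n)) lee_fin => lt_e.
  by rewrite ler_sqr ?nnegrE ?nrm_ge0 ?(le_trans (nrm_ge0 _) (ltW lt_e))// ltW.
have Lf : f \in @L2fun_pred _ _ _ mu E.
  have [N NP] := gc 1 ltr01.
  have -> : f = (f - g N) + g N by apply/funext => t /=; rewrite subrK.
  apply: rpredD; last exact: valP.
  apply/asboolP; split.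
    apply: strongly_measurableD => //; rewrite -scaleN1r.
    exact/strongly_measurableZ/L2fun_meas.
  apply: le_lt_trans (key N 1 _) (ltry _).
  by exists N => m Nm; exact: NP.
pose h := MkL2fun Lf; exists (L2pi h) => e e0.
have [N NP] := gc (e / 2) ltac:(by rewrite divr_gt0).
exists N => n Nn; rewrite nrmB.
have : (\int[mu]_t (nrm (f t - g n t) ^+ 2)%:E <= ((e / 2) ^+ 2)%:E)%E.
  by apply: key; exists N => m Nm; exact: NP.
rewrite -L2piB -(L2nrm_pi_ereal (h - g n)) lee_fin.
have e20 : 0 <= e / 2 by rewrite divr_ge0// ltW.
rewrite ler_sqr ?nnegrE ?nrm_ge0// => /le_lt_trans; apply.
by rewrite ltr_pdivrMr// ltr_pMr// ltr1n.
Qed.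

Lemma fast_cauchy (x : nat -> E) (c : R) :
  (forall k, nrm (x k.+1 - x k) <= c * 2^-1 ^+ k) -> exists l : E, x @ \oo --> l.
Proof.
move=> xc.
have c0 : 0 <= c.
  by have := le_trans (nrm_ge0 _) (xc 0%N); rewrite expr0 mulr1.
have key n j : nrm (x (n + j)%N - x n) <=
    2 * c * (2^-1 ^+ n - 2^-1 ^+ (n + j)).
  elim: j => [|j IH]; first by rewrite addn0 !subrr nrm0 mulr0.
  rewrite addnS (_ : x _ - x n = (x (n + j).+1 - x (n + j)%N) + (x (n + j)%N - x n)); last first.
    by rewrite addrA subrK.
  apply: le_trans (nrmD _ _) _; apply: le_trans (lerD (xc _) IH) _.
  rewrite exprS; set p := 2^-1 ^+ n; set q := 2^-1 ^+ (n + j).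
  by rewrite le_eqVlt; apply/orP; left; apply/eqP; field.
have [l lP] : exists l, forall e : R, 0 < e -> exists N, forall n, (N <= n)%N ->
    nrm (x n - l) < e.
  apply: hilbert_seq_complete => e e0.
  have : geometric (2 * c) (2^-1 : R) @ \oo --> 0.
    by apply: cvg_geometric; rewrite ger0_norm// invf_lt1// ltr1n.
  move=> /cvgrPdist_lt/(_ (e / 2) ltac:(by rewrite divr_gt0))[N _ NP].
  have small m : (N <= m)%N -> nrm (x m - x N) < e / 2.
    move=> /subnKC <-; apply: le_lt_trans (key _ _) _.
    have := NP N (leqnn N); rewrite /= sub0r normrN.
    rewrite ger0_norm ?mulr_ge0 ?exprn_ge0 ?invr_ge0//.
    apply: le_lt_trans; rewrite mulrBr gerBl.
    by rewrite mulr_ge0 ?exprn_ge0 ?invr_ge0// mulr_ge0.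
  exists N => m n Nm Nn.
  rewrite (_ : x m - x n = (x m - x N) + (x N - x n)); last by rewrite addrA subrK.
  apply: le_lt_trans (nrmD _ _) _.
  by rewrite [nrm (x N - _)]nrmB [ltRHS](splitr e) ltrD// small.
by exists l; apply/cvg_nrmP.
Qed.

Lemma L2_seq_complete : seq_complete (L2 mu E).
Proof.
move=> u uc.
have /choice[N NP] k : exists N, forall m n, (N <= m)%N -> (N <= n)%N ->
    nrm (u m - u n) < (4^-1 : R) ^+ k.
  by apply: uc; rewrite exprn_gt0// invr_gt0.
pose phi k := (\max_(i < k.+1) maxn (N i) i)%N.
have le_phi k : (maxn (N k) k <= phi k)%N.
  exact: (leq_bigmax (ord_max : 'I_k.+1)).
have Nphi k : (N k <= phi k)%N by apply: leq_trans (le_phi k); rewrite leq_maxl.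
have phi_ge k : (k <= phi k)%N by apply: leq_trans (le_phi k); rewrite leq_maxr.
have phiS k : (phi k <= phi k.+1)%N.
  by rewrite [leqRHS]/phi big_ord_recr/= leq_max leqnn.
pose f k := L2repr (u (phi k)).
have fu k : L2pi (f k) = u (phi k) by exact: L2reprK.
pose D k t := (4 ^+ k * nrm (f k.+1 t - f k t) ^+ 2)%:E : \bar R.
have mD k : measurable_fun setT (D k).
  apply/measurable_EFinP; apply: measurable_funM; first exact: measurable_cst.
  apply: measurable_funX.
  exact: (strongly_measurable_nrm (L2fun_meas (f k.+1 - f k))).
have D0 k t : (0 <= D k t)%E.
  by rewrite lee_fin mulr_ge0 ?sqr_ge0 ?exprn_ge0.
have ID k : (\int[mu]_t D k t <= ((4^-1 : R) ^+ k)%:E)%E.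
  rewrite /D; under eq_integral do rewrite EFinM.
  rewrite ge0_integralZl_EFin ?exprn_ge0//; last 2 first.
    by move=> t _; rewrite lee_fin sqr_ge0.
    apply/measurable_EFinP; apply: measurable_funX.
    exact: (strongly_measurable_nrm (L2fun_meas (f k.+1 - f k))).
  rewrite (_ : integral _ _ _ = ((nrm (u (phi k.+1) - u (phi k))) ^+ 2)%:E);
    last by rewrite -!fu -L2piB L2nrm_pi_ereal.
  rewrite -EFinM lee_fin.
  have le4 : nrm (u (phi k.+1) - u (phi k)) ^+ 2 <= (4^-1 ^+ k) ^+ 2.
    rewrite ler_sqr ?nnegrE ?nrm_ge0 ?exprn_ge0 ?invr_ge0//.
    exact: ltW (NP k _ _ (leq_trans (Nphi k) (phiS k)) (Nphi k)).
  apply: le_trans (ler_wpM2l _ le4) _; first by rewrite exprn_ge0.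
  by rewrite expr2 mulrA -exprMn divff// expr1n mul1r.
pose G t := (\sum_(k <oo) D k t)%E.
have mG : measurable_fun setT G by exact: ge0_emeasurable_sum.
have G0 t : (0 <= G t)%E by exact: nneseries_ge0.
have IG : (\int[mu]_t G t < +oo)%E.
  rewrite integral_nneseries//.
  have le4 : (\sum_(k <oo) \int[mu]_t D k t <=
              \sum_(k <oo) ((4^-1 : R) ^+ k)%:E)%E.
    by apply: lee_nneseries => // k _ _; apply: integral_ge0.
  apply: le_lt_trans le4 _.
  have cvg4 : series (geometric (1 : R) 4^-1) @ \oo --> 1 * (1 - 4^-1 : R)^-1.
    by apply: cvg_geometric_series; rewrite ger0_norm// invf_lt1// ltr1n.
  rewrite (_ : (\sum_(k <oo) ((4^-1 : R) ^+ k)%:E)%E = (1 * (1 - 4^-1 : R)^-1)%:E).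
    exact: ltry.
  apply/cvg_lim => //.
  rewrite (_ : (fun n => _) = EFin \o series (geometric (1 : R) 4^-1)).
    by apply: cvg_EFin; [exact: nearW|exact: cvg4].
  apply/funext => n /=; rewrite /series/= sumEFin; congr EFin.
  by apply: eq_bigr => i _; rewrite mul1r.
pose b t := G t \is a fin_num.
have mb : measurable_fun setT b.
  apply: (measurable_fun_bool true).
  rewrite preimage_true.
  exact: emeasurable_fin_num.
have bae : {ae mu, forall t, b t}.
  have : mu.-integrable setT G.
    by apply/integrableP; split=> //; under eq_integral do rewrite gee0_abs//.
  by move=> /(integrable_ae measurableT) h; apply: filterS h => t /(_ I).
pose g0 k t := if b t then f k t else 0.
have g0E k : g0 k \in @L2fun_pred _ _ _ mu E.
  have mg : strongly_measurable (g0 k).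
    exact: strongly_measurable_if mb (L2fun_meas (f k)).
  apply/L2funP; split=> //.
  apply: (le_integrable measurableT _ _ (L2fun_int (f k))).
    apply/measurable_EFinP; apply: measurable_funX.
    exact: strongly_measurable_nrm.
  move=> t _ /=; rewrite lee_fin /g0; case: ifP => // _.
  by rewrite nrm0 expr0n/= normr0.
pose g k := MkL2fun (g0E k).
have gu k : L2pi (g k) = u (phi k).
  rewrite -fu; apply/L2piE/asboolP; apply: filterS bae => t bt.
  by rewrite [LHS](_ : _ = g0 k t - f k t)// /g0 bt subrr.
have /choice[h gh] t : exists l : E, (fun k => g k t) @ \oo --> l.
  rewrite /g/= /g0; case: (boolP (b t)) => [bt|_]; last first.
    by exists 0; exact: cvg_cst.
  pose M := fine (G t).
  have M0 : 0 <= M by rewrite fine_ge0.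
  have DM k : 4 ^+ k * nrm (f k.+1 t - f k t) ^+ 2 <= M.
    rewrite -lee_fin fineK// -[leLHS]/(D k t).
    apply: le_trans (nneseries_lim_ge k.+1 _) => //.
    rewrite big_nat_recr//= leeDr//.
    by apply: sume_ge0.
  apply: (@fast_cauchy _ (Num.sqrt M)) => k.
  rewrite -ler_sqr ?nnegrE ?nrm_ge0 ?mulr_ge0 ?sqrtr_ge0 ?exprn_ge0 ?invr_ge0//.
  rewrite exprMn sqr_sqrtr// -exprM mulnC exprM (_ : 2^-1 ^+ 2 = 4^-1 :> R).
    rewrite exprVn ler_pdivlMr ?exprn_gt0// mulrC; exact: DM.
  by field.
have [l lP] : exists l : L2 mu E, forall e : R, 0 < e ->
    exists N, forall n, (N <= n)%N -> nrm (L2pi (g n) - l) < e.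
  apply: (L2_lim gh) => e /uc[K KP].
  exists K => m n Km Kn; rewrite !gu.
  by apply: KP; [exact: leq_trans Km (phi_ge _)|exact: leq_trans Kn (phi_ge _)].
exists l => e e0; have e20 : 0 < e / 2 by rewrite divr_gt0.
have [K1 K1P] := uc _ e20; have [K2 K2P] := lP _ e20.
exists K1 => n Kn; pose m := maxn K1 K2.
rewrite (_ : u n - l = (u n - u (phi m)) + (L2pi (g m) - l)); last first.
  by rewrite gu addrA subrK.
apply: le_lt_trans (nrmD _ _) _; rewrite [ltRHS](splitr e) ltrD//.
  by apply: K1P => //; apply: leq_trans (phi_ge m); rewrite leq_maxl.
by apply: K2P; rewrite leq_maxr.
Qed.

HB.instance Definition _ := Uniform_isComplete.Build (L2 mu E)
  (seq_complete_cvg L2_seq_complete).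

End L2complete.

Section linear_subspaces.
Context (R : realType) (H : hilbertType R).
Implicit Types (K S : set H).

Definition closed_subspace K := [/\ K 0,
  forall (a : R[i]) u v, K u -> K v -> K (a *: u + v) & closed K].

Definition lspan S : set H := [set x | exists n (a : 'I_n -> R[i]) (v : 'I_n -> H),
  (forall i, S (v i)) /\ x = \sum_(i < n) a i *: v i].

(* K0 ⊖ K *)
Definition orth_in K0 K : set H :=
  [set u | K0 u /\ forall k, K k -> '[u, k] = 0].

(* [xget 0 P] is the element of [P] if there is exactly one, as is the case
   here for a closed subspace [K] *)
Definition orth_proj K (h : H) : H :=
  xget 0 [set k | K k /\ forall l, K l -> '[h - k, l] = 0].

End linear_subspaces.

(* unbounded operators: only the values on [dom] are relevant *)
Record operator (U V : Type) := Operator { dom : set U ; opfun :> U -> V }.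

Definition op_eq (U V : Type) (A B : operator U V) :=
  dom A = dom B /\ forall u, dom A u -> A u = B u.

Definition op_extends (U V : Type) (A B : operator U V) :=
  dom A `<=` dom B /\ forall u, dom A u -> B u = A u.

Definition restr (U V : Type) (K : set U) (A : operator U V) : operator U V :=
  Operator (dom A `&` K) A.

Definition linear_op (R : realType) (U V : hilbertType R) (A : operator U V) :=
  [/\ dom A 0,
    forall (a : R[i]) u v, dom A u -> dom A v -> dom A (a *: u + v) &
    forall (a : R[i]) u v, dom A u -> dom A v -> A (a *: u + v) = a *: A u + A v].

Definition bounded_adjoint (R : realType) (U V : hilbertType R) (T : U -> V) :
    V -> U :=
  fun v => xget 0 [set w | forall u, '[T u, v] = '[u, w]].

(* [K] is the Hilbert space in which the operator acts, given as a closed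
   subspace of an ambient one: [setT] for [H] itself, or a reducing subspace *)
Section operators.
Context (R : realType) (H : hilbertType R).
Implicit Types (K : set H) (A B M : operator H H).

Definition densely_defined K A := [/\ closed_subspace K, linear_op A,
  dom A `<=` K, (forall u, dom A u -> K (A u)) & K `<=` closure (dom A)].

Definition adjoint_rel K A v w :=
  K w /\ forall u, dom A u -> '[A u, v] = '[u, w].

Definition adjoint K A : operator H H :=
  Operator [set v | K v /\ exists w, adjoint_rel K A v w]
           (fun v => xget 0 (adjoint_rel K A v)).

(* (A - z)^-1, meaningful for z in the resolvent set *)
Definition resolvent A (z : R[i]) : H -> H :=
  fun h => xget 0 [set u | dom A u /\ A u - z *: u = h].

Definition selfadjoint K A := densely_defined K A /\ op_eq A (adjoint K A).

Definition dissipative K A := densely_defined K A /\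
  forall u, dom A u -> 0 <= complex.Im '[A u, u].

Definition maximal_dissipative K A := dissipative K A /\
  forall B, dissipative K B -> op_extends A B -> op_eq A B.

Definition invariant_for B K :=
  forall h, dom B h -> dom B (orth_proj K h) /\ K (B (orth_proj K h)).

Definition reducing K0 B K := [/\ closed_subspace K, K `<=` K0,
  invariant_for B K & invariant_for B (orth_in K0 K)].

Definition completely_nonselfadjoint K0 B := maximal_dissipative K0 B /\
  ~ exists K, [/\ reducing K0 B K, K <> [set 0] & selfadjoint K (restr K B)].

Definition selfadjoint_dilation K M K0 B := [/\ maximal_dissipative K0 B,
  selfadjoint K M, K0 `<=` K &
  forall z : R[i], complex.Im z < 0 -> forall h, K0 h ->
    resolvent B z h = orth_proj K0 (resolvent M z h)].

Definition minimal_selfadjoint_dilation K M K0 B :=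
  selfadjoint_dilation K M K0 B /\
  ~ exists K1, [/\ reducing K M K1, K0 `<=` K1, K1 <> K &
      selfadjoint_dilation K1 (restr K1 M) K0 B].

End operators.

Section sobolev.
Context (R : realType).

Definition leb_on (i : interval R) :
    {measure set (measurableTypeR R) -> \bar R} :=
  mrestr (@lebesgue_measure R) (measurable_itv i).

Context (i : interval R) (E : hilbertType R).
Local Notation L2i := (L2 (leb_on i) E).

(* the integral of an [E]-valued function, taken weakly; it agrees with the
   Bochner integral whenever the latter exists *)
Definition is_integral (D : set R) (g : R -> E) (x : E) :=
  forall e, '[x, e] =
    Cintegral (@lebesgue_measure R) D (fun t => '[g t, e]).

(* [w] is an absolutely continuous representative of [v], with derivative [g];
   the values of [w] outside the closure of [i] are irrelevant *)
Definition ac_rep (v g : L2i) (w : R -> E) :=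
  {ae leb_on i, forall t, w t = L2repr v t} /\
  forall s t, closure [set` i] s -> closure [set` i] t -> s <= t ->
    is_integral `[s, t] (L2repr g) (w t - w s).

Definition H1 : set L2i := [set v | exists g w, ac_rep v g w].

Definition H1_deriv (v : L2i) : L2i := xget 0 [set g | exists w, ac_rep v g w].

Definition trace0 (v : L2i) : E :=
  xget 0 [set e | exists g w, ac_rep v g w /\ w 0 = e].

End sobolev.

Section dilation.
Context (R : realType) (H E Es : hilbertType R).
Context (A : operator H H) (G : H -> E) (Gs : H -> Es).

Local Notation As := (adjoint setT A).

(* the hypotheses on Γ (with [B := A], [eps := i]) and on Γ_* (with [B := A^*],
   [eps := -i]); only the values of [Q] on the domain of [B] are relevant *)
Definition boundary_operator (F : hilbertType R) (B : operator H H)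
    (Q : H -> F) (eps : R[i]) :=
  [/\ linear_op (Operator (dom B) Q),
    exists c : R, forall u, dom B u -> nrm (Q u) <= c * (nrm u + nrm (B u)),
    closure (Q @` dom B) = setT &
    forall u v, dom B u -> dom B v ->
      '[B u, v] - '[u, B v] = eps * '[Q u, Q v]].

(* S(z), the only bounded operator satisfying these equations when
   z belongs to the resolvent set of A^*, as the range of [G] is dense *)
Definition charfun (z : R[i]) : E -> Es :=
  xget (fun=> 0) [set S | [/\ linear S, continuous S & forall u, dom A u ->
    S (G u) = Gs (resolvent As z (A u - z *: u))]].

(* (Γ (A - z)^-1)^* and (Γ_* (A^* - z)^-1)^* *)
Definition gam (z : R[i]) : E -> H :=
  bounded_adjoint (fun h => G (resolvent A z h)).
Definition gams (z : R[i]) : Es -> H :=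
  bounded_adjoint (fun h => Gs (resolvent As z h)).

Definition Hcns : set H :=
  let Ran := range (gam (- 'i%C)) `|` range (gams 'i%C) in
  closure [set x + y | x in lspan (\bigcup_(m in [set m | complex.Im m < 0])
                                     (resolvent A m @` Ran))
                     & y in lspan (\bigcup_(l in [set l | 0 < complex.Im l])
                                     (resolvent As l @` Ran))].

Definition dilspace : hilbertType R :=
  (L2 (leb_on `]-oo, (0 : R)[) Es ⊕ H ⊕ L2 (leb_on `](0 : R), +oo[) E).

Definition dilop (m l : R[i]) : operator dilspace dilspace :=
  Operator
    [set U | let vm := U.1.1 in let u := U.1.2 in let vp := U.2 in
      [/\ H1 vm, H1 vp,
        dom A (u + gams (- m) (trace0 vm)),
        dom As (u + gam (- l) (trace0 vp)) &
        trace0 vp = bounded_adjoint (charfun (- m)) (trace0 vm)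
                    + 'i%C *: G (u + gams (- m) (trace0 vm)) /\
        trace0 vm = charfun (- l^*) (trace0 vp)
                    - 'i%C *: Gs (u + gam (- l) (trace0 vp))]]
    (fun U => let vm := U.1.1 in let u := U.1.2 in let vp := U.2 in
      ('i%C *: H1_deriv vm,
       As (u + gam (- l) (trace0 vp)) + l^* *: gam (- l) (trace0 vp),
       'i%C *: H1_deriv vp)).

Definition dil_inj (h : H) : dilspace := ((0, h), 0).

(* an operator in [H] seen as an operator in {0} ⊕ H ⊕ {0} *)
Definition dil_op (B : operator H H) : operator dilspace dilspace :=
  Operator (dil_inj @` dom B) (fun U => dil_inj (B U.1.2)).

(* L^2 ⊕ K ⊕ L^2 *)
Definition dil_cyl (K : set H) : set dilspace := [set U | K U.1.2].

End dilation.

Arguments dil_inj {R H} E Es h.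
Arguments dil_op {R H} E Es B.
Arguments dil_cyl {R H} E Es K.

(* Main.v *)
Require Import Defs.
From HB Require Import structures.
From mathcomp Require Import all_boot all_order all_algebra complex.
From mathcomp Require Import all_classical all_reals all_analysis measurable_realfun.
From mathcomp Require Import ring lra.
Set Implicit Arguments.
Unset Strict Implicit.
Unset Printing Implicit Defensive.
Import Order.TTheory GRing.Theory Num.Theory.
Import numFieldNormedType.Exports.

Local Open Scope classical_set_scope.
Local Open Scope complex_scope.
Local Open Scope ring_scope.

(** The key to the theorem is a description of the dilation [L] that mentions no
    point of a half-plane. Let [C] be the adjoint of [A]. A triple [(v_-, u, v_+)]
    lies in the domain of [L] if and only if [v_-] and [v_+] are of class [H^1],
    with values [phi] and [psi] at the origin, and there is [t] with
    [<u, A x> + <psi, G x> = <t, x>] for [x] in the domain of [A] and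
    [<u, C y> + <phi, Gs y> = <t, y>] for [y] in the domain of [C]; the image is
    then [(i v_-', t, i v_+')] ([linked], [linkedP], [dilop_graph],
    [graph_dilop]). In this form [L] is symmetric, because the boundary terms of
    the two half-lines cancel those of [linked_green]. It is also surjective after
    a shift by [i] or [- i]: on one half-line the boundary value is free, so that
    the equation can be solved there; this prescribes [phi] or [psi], one of
    [linked_onto_lower] and [linked_onto_upper] provides [u] and the other
    boundary value, and the other half-line is solved with that value. Hence
    [L - z] is surjective for all non-real [z] ([dilop_onto]).

    The complement [Hs] of [Hcns] consists of the vectors [g] for which
    [G (A - z)^-1 g] and [Gs (C - z)^-1 g] vanish throughout the half-planes
    ([orth_Hcns]). On solutions with zero boundary value [A] and [C] agree, by
    Green's formulas ([null_boundary]), so [Hs] reduces [A] to a selfadjoint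
    operator ([selfadjoint_Hs]). Conversely [|G u|^2 = 2 Im <A u, u>] vanishes on a
    reducing subspace where [A] is selfadjoint, so such a subspace lies in [Hs];
    this is complete non-selfadjointness on [Hcns].

    A vector [(0, u, 0)] belongs to the domain of [L] exactly when [u] is in the
    domain of [A] and [G u = 0], and [L] acts on it as [A]; this gives the
    reduction of [L] by [Hs]. If [W] is orthogonal to all [(L - z)^-1 F] with [F] in the outer components, then all
    [(L - z)^-1 W] have zero outer components, hence zero boundary values, and
    [W = (0, g, 0)] with [g] in [Hs] ([resolvent_span_orth]). Taking complements
    describes the closed span.

    If [(L - z) U = (0, h, 0)] with [z] in the lower half-plane, then
    [i v_-' = z v_-] forces [v_- = 0], and the remaining conditions say that
    [(A - z) u = h]: this is the dilation property ([compression]). For minimality,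
    on a reducing part of [L] orthogonal to [Hcns] the middle components of
    [V = (L - z)^-1 U] and of [L V] vanish, so by density of the ranges of [G] and
    [Gs] the boundary values of [V] vanish too. Green's formula on the half-lines
    then makes the outer components of [U] orthogonal to every exponential, and
    the exponentials are total ([zero_trace_pairing], [Exp_total]).

    Two facts about the half-line carry the analysis. Green's formula for vector
    valued functions ([dist_rep_green]) is obtained from the weak definition of the
    derivative by cutting a segment into many pieces, the error on each being of
    second order. Totality of the exponentials is the uniqueness of the Laplace
    transform ([laplace_unique]): suitable polynomials in an exponential converge
    to the indicator of a bounded interval. *)

(** * Geometry of Hilbert spaces *)

Notation Re := (@complex.Re _).
Notation Im := (@complex.Im _).

Lemma natSinv_small (R : realType) (e : R) : 0 < e ->
  exists N, forall n, (N <= n)%N -> n.+1%:R^-1 < e.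
Proof.
move=> e0; have [N _ NP] := near_infty_natSinv_lt (PosNum e0).
by exists N => n Nn; exact: NP.
Qed.

Arguments natSinv_small [R] e _.

Section inner_more.
Context (R : realType) (H : preHilbertType R).
Implicit Types u v w : H.

Lemma complex_eq (a b : R[i]) : Re a = Re b -> Im a = Im b -> a = b.
Proof. by case: a b => [x y] [z t] /= -> ->. Qed.

Lemma inner0r u : '[u, 0] = 0 :> R[i].
Proof. by rewrite innerC inner0l conjC0. Qed.
Lemma innerNl u v : '[- u, v] = - '[u, v].
Proof. by rewrite -scaleN1r innerZl mulN1r. Qed.
Lemma innerNr u v : '[u, - v] = - '[u, v].
Proof. by rewrite innerC innerNl rmorphN/= -innerC. Qed.
Lemma innerBl u v w : '[u - v, w] = '[u, w] - '[v, w].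
Proof. by rewrite innerDl innerNl. Qed.
Lemma innerBr u v w : '[w, u - v] = '[w, u] - '[w, v].
Proof. by rewrite innerDr innerNr. Qed.

Lemma Re_innerC u v : Re '[v, u] = Re '[u, v].
Proof. by rewrite innerC; case: '[u, v]. Qed.
Lemma Im_innerC u v : Im '[v, u] = - Im '[u, v].
Proof. by rewrite innerC; case: '[u, v]. Qed.
Lemma Re_inner_nrm u : Re '[u, u] = nrm u ^+ 2.
Proof. by rewrite inner_nrm. Qed.
Lemma inner_eq0 u : '[u, u] = 0 -> u = 0.
Proof.
move=> /(congr1 Re); rewrite Re_inner_nrm => /eqP.
by rewrite sqrf_eq0 => /eqP; exact: nrm0_eq0.
Qed.

Lemma inner_Re_eq0 u v : Re '[u, v] = 0 -> Re '[u, 'i%C *: v] = 0 -> '[u, v] = 0.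
Proof. by rewrite -Im_inner => r i; apply: complex_eq. Qed.

Lemma nrmD2 u v : nrm (u + v) ^+ 2 = nrm u ^+ 2 + 2 * Re '[u, v] + nrm v ^+ 2.
Proof. by rewrite Re_inner; field. Qed.

Lemma nrmB2 u v : nrm (u - v) ^+ 2 = nrm u ^+ 2 - 2 * Re '[u, v] + nrm v ^+ 2.
Proof. by rewrite nrmD2 innerNr nrmN; case: '[u, v] => a b /=; ring. Qed.

Lemma Re_CS u v : `|Re '[u, v]| <= nrm u * nrm v.
Proof.
have [->|v0] := eqVneq v 0; first by rewrite inner0r nrm0 mulr0 normr0.
have v1 : 0 < nrm v.
  rewrite lt_def nrm_ge0 andbT; apply: contra v0 => /eqP v0.
  by apply/eqP; exact: nrm0_eq0.
rewrite -ler_sqr ?nnegrE ?mulr_ge0 ?nrm_ge0// real_normK ?num_real// exprMn.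
have key (t : R) : 0 <= nrm u ^+ 2 - 2 * t * Re '[u, v] + t ^+ 2 * nrm v ^+ 2.
  have := sqr_ge0 (nrm (u - t%:C *: v)); rewrite nrmB2 nrmZ innerZr.
  have -> : Re `|t%:C| = `|t| by rewrite normc_def/= expr0n addr0 sqrtr_sqr.
  rewrite exprMn real_normK ?num_real//; case: '[u, v] => a b /=.
  by rewrite oppr0 mul0r subr0 mulrA.
have := key (Re '[u, v] / nrm v ^+ 2).
have n0 : nrm v != 0 by rewrite gt_eqF.
rewrite (_ : _ + _ = nrm u ^+ 2 - Re '[u, v] ^+ 2 / nrm v ^+ 2); last by field.
by rewrite subr_ge0 ler_pdivrMr// exprn_gt0.
Qed.

Lemma Re_le_CS u v : Re '[u, v] <= nrm u * nrm v.
Proof. exact: le_trans (ler_norm _) (Re_CS u v). Qed.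

Lemma Im_CS u v : `|Im '[u, v]| <= nrm u * nrm v.
Proof.
rewrite Im_inner; apply: le_trans (Re_CS _ _) _.
by rewrite nrmZ (_ : Re `|'i%C| = 1) ?mul1r// normc_def/= expr0n expr1n add0r sqrtr1.
Qed.

Lemma cabs_lt_eq0 (a : R[i]) :
  (forall e : R, 0 < e -> `|Re a| <= e /\ `|Im a| <= e) -> a = 0.
Proof.
move=> h.
have z (x : R) : (forall e : R, 0 < e -> `|x| <= e) -> x = 0.
  move=> xe; apply/eqP; rewrite -normr_le0; apply/ler_addgt0Pr => e e0.
  by rewrite add0r xe.
apply: complex_eq; apply: z => e /h[]//.
Qed.

(** Closedness arguments use this with [u] a fixed test vector, often in an
    orthogonal sum, where several limits are taken at once. *)
Lemma inner_small u v : (forall e : R, 0 < e -> exists v',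
  nrm (v - v') < e /\ '[u, v'] = 0) -> '[u, v] = 0.
Proof.
move=> h; apply: cabs_lt_eq0 => e e0.
have n1 : 0 < nrm u + 1 by rewrite ltr_wpDl ?nrm_ge0.
have [v' [vv' uv']] := h (e / (nrm u + 1)) ltac:(by rewrite divr_gt0).
have -> : '[u, v] = '[u, v - v'] by rewrite innerBr uv' subr0.
have le : nrm u * nrm (v - v') <= e.
  apply: le_trans (_ : (nrm u + 1) * (e / (nrm u + 1)) <= _).
    by rewrite ler_pM ?nrm_ge0 ?lerDl ?ler01// ltW.
  by rewrite mulrC divfK// gt_eqF.
by split; apply: le_trans le; [exact: Re_CS|exact: Im_CS].
Qed.

Lemma closure_nrmP (S : set H) x :
  closure S x <-> forall e : R, 0 < e -> exists2 s, S s & nrm (x - s) < e.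
Proof.
split=> [Sx e e0|Sx B /nbhs_ballP[e0 /= /posC_gt0[e e_gt0 ->] eB]].
  have /Sx[s [Ss /ball_nrm xs]] : nbhs x (ball x e%:C).
    by apply: nbhsx_ballx; rewrite ltcR.
  by exists s.
have [s Ss xs] := Sx e e_gt0; exists s; split=> //.
exact/eB/ball_nrm.
Qed.

Lemma orth_closure (S : set H) w : (forall s, S s -> '[w, s] = 0) ->
  forall x, closure S x -> '[w, x] = 0.
Proof.
move=> Sw x /closure_nrmP Sx; apply: inner_small => e /Sx[s Ss xs].
by exists s; split=> //; exact: Sw.
Qed.

End inner_more.

Section subspaces.
Context (R : realType) (H : hilbertType R).
Implicit Types (K S : set H) (u v : H).

Definition subspace K := K 0 /\
  forall (a : R[i]) u v, K u -> K v -> K (a *: u + v).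

Lemma closed_subspaceW K : closed_subspace K -> subspace K.
Proof. by case. Qed.

Lemma subspaceZ K (a : R[i]) u : subspace K -> K u -> K (a *: u).
Proof. by move=> [K0 KP] Ku; rewrite -[_ *: _]addr0; exact: KP. Qed.
Lemma subspaceD K u v : subspace K -> K u -> K v -> K (u + v).
Proof. by move=> [K0 KP] Ku Kv; rewrite -[u]scale1r; exact: KP. Qed.
Lemma subspaceB K u v : subspace K -> K u -> K v -> K (u - v).
Proof. by move=> [K0 KP] Ku Kv; rewrite addrC -scaleN1r; exact: KP. Qed.

Lemma closed_subspaceT : closed_subspace [set: H].
Proof. by split=> //; exact: closedT. Qed.

Lemma closed_subspace_closure S : subspace S -> closed_subspace (closure S).
Proof.
move=> [S0 SP]; split; [exact: subset_closure| |exact: closed_closure].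
move=> a u v /closure_nrmP Su /closure_nrmP Sv; apply/closure_nrmP => e e0.
have n1 : 0 < Re `|a| + 1.
  by rewrite ltr_wpDl// normc_def/= sqrtr_ge0.
have [s Ss us] := Su (e / 2 / (Re `|a| + 1)) ltac:(by rewrite !divr_gt0).
have [t St vt] := Sv (e / 2) ltac:(by rewrite divr_gt0).
exists (a *: s + t); first exact: SP.
rewrite opprD addrACA -scalerBr (splitr e).
apply: le_lt_trans (nrmD _ _) _; apply: ler_ltD => //.
rewrite nrmZ.
apply: le_trans (_ : (Re `|a| + 1) * (e / 2 / (Re `|a| + 1)) <= _).
  rewrite ler_pM ?nrm_ge0 ?lerDl ?ler01 ?(ltW us)//.
  by rewrite normc_def/= sqrtr_ge0.
by rewrite mulrC divfK// gt_eqF.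
Qed.

Lemma closed_subspace_lim K u : closed_subspace K ->
  (forall e : R, 0 < e -> exists2 s, K s & nrm (u - s) < e) -> K u.
Proof. by move=> [_ _ Kc] /closure_nrmP; rewrite -(closure_id K).1. Qed.

Lemma closed_subspace_orth K0 K : closed_subspace K0 ->
  closed_subspace (orth_in K0 K).
Proof.
move=> [K00 K0P K0c]; split.
- by split=> // k _; rewrite inner0l.
- move=> a u v [K0u Ku] [K0v Kv]; split; first exact: K0P.
  by move=> k Kk; rewrite innerP Ku// Kv// mulr0 addr0.
- move=> u cu; split.
    apply: K0c; apply: closureS cu; by move=> ? [].
  move=> k Kk; rewrite innerC (orth_closure (S := orth_in K0 K)) ?conjC0//.
  by move=> s [_ /(_ _ Kk) sk]; rewrite innerC sk conjC0.
Qed.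

(** The minimum of [t ^+ 2 * c - 2 * t * r] is attained at [t = r / c], where it
    is negative unless [r = 0]; [t = r / (c + 1)] serves as well and allows
    [c = 0]. *)
Lemma first_variation (r c : R) :
  (forall t : R, 0 <= t ^+ 2 * c - 2 * t * r) -> r = 0.
Proof.
move=> h; have c0 : 0 <= c by have := h 1; have := h (-1); lra.
have c1 : c + 1 != 0 by rewrite gt_eqF// ltr_wpDl.
have := h (r / (c + 1)).
rewrite (_ : _ - _ = - (r ^+ 2 * ((c + 2) / (c + 1) ^+ 2))); last by field.
rewrite oppr_ge0 => le0; apply/eqP; rewrite -sqrf_eq0 eq_le sqr_ge0 andbT.
by move: le0; rewrite pmulr_lle0// divr_gt0 ?exprn_gt0 ?ltr_wpDl.
Qed.

(** A minimizing sequence is Cauchy by the parallelogram law, and the first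
    variation at the minimum vanishes. *)
Lemma projection_theorem K h : closed_subspace K ->
  exists k, K k /\ forall l, K l -> '[h - k, l] = 0.
Proof.
move=> Kc; have [K0 KP _] := Kc; have Ks := closed_subspaceW Kc.
pose D := [set nrm (h - k) ^+ 2 | k in K].
have Dinf : has_inf D.
  split; first by exists (nrm (h - 0) ^+ 2), 0.
  by exists 0 => _ [k _ <-]; exact: sqr_ge0.
pose d := inf D.
have dle k : K k -> d <= nrm (h - k) ^+ 2.
  by move=> Kk; apply: inf_lbound; [exact: Dinf.2|exists k].
have /choice[k kP] n : exists k, K k /\ nrm (h - k) ^+ 2 < d + n.+1%:R^-1.
  have [|_ [k Kk <-] kd] := @inf_adherent _ D n.+1%:R^-1 _ Dinf.
    by rewrite invr_gt0.
  by exists k.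
have par m n : nrm (k m - k n) ^+ 2 <= 2 * m.+1%:R^-1 + 2 * n.+1%:R^-1.
  have := dle (2^-1%:C *: (k m + k n))
    (subspaceZ _ Ks (subspaceD Ks (kP m).1 (kP n).1)).
  have := (kP m).2; have := (kP n).2.
  set a := h - k m; set b := h - k n.
  have -> : h - 2^-1%:C *: (k m + k n) = 2^-1%:C *: (a + b).
    have {1}-> : h = 2^-1%:C *: (h + h).
      rewrite scalerDr -scalerDl -rmorphD/= (_ : 2^-1 + 2^-1 = 1) ?scale1r//.
      by field.
    by rewrite -scalerBr opprD addrACA.
  have -> : k m - k n = b - a by rewrite /a /b opprB [RHS]addrC addrA subrK.
  rewrite nrmZ exprMn (_ : Re `|2^-1%:C| = 2^-1); last first.
    by rewrite normc_def/= expr0n addr0 sqrtr_sqr ger0_norm// invr_ge0.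
  clearbody a b; rewrite nrmB2 nrmD2 (Re_innerC a b); move: (m.+1%:R^-1 : R) (n.+1%:R^-1 : R) => p q; lra.
have [l lP] : exists l, forall e : R, 0 < e -> exists N, forall n, (N <= n)%N ->
    nrm (k n - l) < e.
  apply: hilbert_seq_complete => e e0.
  have [N NP] := natSinv_small (e ^+ 2 / 4) ltac:(by rewrite divr_gt0// exprn_gt0).
  exists N => m n Nm Nn; rewrite -ltr_sqr ?nnegrE ?nrm_ge0 ?ltW//.
  apply: le_lt_trans (par m n) _; move: (NP _ Nm) (NP _ Nn).
  by move: (m.+1%:R^-1 : R) (n.+1%:R^-1 : R) => p q; lra.
have Kl : K l.
  apply: (closed_subspace_lim Kc) => e /lP[N /(_ _ (leqnn N)) Nl].
  by exists (k N); [exact: (kP N).1|rewrite nrmB].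
have hl : nrm (h - l) ^+ 2 <= d.
  have d0 : 0 <= d by apply: lb_le_inf => [|_ [? _ <-]]; [case: Dinf|exact: sqr_ge0].
  rewrite -[d]sqr_sqrtr// ler_sqr ?nnegrE ?nrm_ge0 ?sqrtr_ge0//.
  apply/ler_addgt0Pr => e e0; have e20 : 0 < e / 2 by rewrite divr_gt0.
  have [N1 N1P] := lP _ e20.
  have [N2 N2P] := natSinv_small ((e / 2) ^+ 2) ltac:(by rewrite exprn_gt0).
  pose n := maxn N1 N2.
  have -> : h - l = (h - k n) + (k n - l) by rewrite addrA subrK.
  apply: le_trans (nrmD _ _) _; rewrite (splitr e) addrA lerD//; last first.
    by apply/ltW/N1P; rewrite leq_maxl.
  rewrite -ler_sqr ?nnegrE ?nrm_ge0 ?addr_ge0 ?sqrtr_ge0 ?(ltW e20)//.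
  apply: le_trans (_ : d + (e / 2) ^+ 2 <= _).
    rewrite ltW//; apply: lt_trans (kP n).2 _; rewrite ltrD2l.
    by apply: N2P; rewrite leq_maxr.
  rewrite sqrrD sqr_sqrtr// -addrA lerD2l lerDr mulrn_wge0// mulr_ge0 ?sqrtr_ge0//.
  exact: ltW.
exists l; split=> // v Kv.
have var w : K w -> Re '[h - l, w] = 0.
  move=> Kw; apply: (@first_variation _ (nrm w ^+ 2)) => t.
  have := dle _ (KP t%:C w l Kw Kl).
  rewrite (_ : h - _ = (h - l) - t%:C *: w); last by rewrite opprD addrCA addrC.
  move=> /(le_trans hl); rewrite (nrmB2 (h - l)) nrmZ innerZr exprMn.
  have -> : Re `|t%:C| = `|t| by rewrite normc_def/= expr0n addr0 sqrtr_sqr.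
  rewrite real_normK ?num_real//; case: '[h - l, w] => a b /=; lra.
by apply: inner_Re_eq0; apply: var => //; exact: subspaceZ.
Qed.

Lemma orth_proj_unique K h k : subspace K -> K k ->
  (forall l, K l -> '[h - k, l] = 0) -> orth_proj K h = k.
Proof.
move=> Ks Kk hk; apply: xget_unique => //= k' [Kk' hk'].
apply/eqP; rewrite -subr_eq0; apply/eqP/inner_eq0.
have Kd := subspaceB Ks Kk' Kk.
have -> : '[k' - k, k' - k] = '[h - k, k' - k] - '[h - k', k' - k].
  by rewrite -innerBl opprB [h - k + _]addrC addrA subrK.
by rewrite hk// hk'// subrr.
Qed.

Lemma orth_projP K h : closed_subspace K ->
  K (orth_proj K h) /\ forall l, K l -> '[h - orth_proj K h, l] = 0.
Proof. by move=> /(projection_theorem h) ex; rewrite /orth_proj; exact: (xgetPex 0 ex). Qed.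

Lemma orth_proj_id K h : subspace K -> K h -> orth_proj K h = h.
Proof. by move=> Ks Kh; apply: orth_proj_unique => // l _; rewrite subrr inner0l. Qed.

Lemma orth_proj_rest K0 K h : closed_subspace K -> subspace K0 -> K `<=` K0 -> K0 h ->
  orth_in K0 K (h - orth_proj K h).
Proof.
move=> Kc K0s KK0 K0h; have [Kp pP] := orth_projP h Kc.
by split=> //; apply: subspaceB => //; exact: KK0.
Qed.

Lemma orth_proj_orth K0 K h : closed_subspace K -> subspace K0 -> K `<=` K0 -> K0 h ->
  orth_proj (orth_in K0 K) h = h - orth_proj K h.
Proof.
move=> Kc K0s KK0 K0h; have [Kp pP] := orth_projP h Kc.
have oP := orth_proj_rest Kc K0s KK0 K0h.
apply: orth_proj_unique => //.
  split; first by split=> [|k _]; [exact: K0s.1|rewrite inner0l].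
  move=> a u v [K0u Ku] [K0v Kv]; split; first exact: K0s.2.
  by move=> k Kk; rewrite innerP Ku// Kv// mulr0 addr0.
by move=> l [_ /(_ _ Kp) lp]; rewrite opprB addrC subrK innerC lp conjC0.
Qed.

Lemma orth_in_orth_in K0 K : closed_subspace K -> subspace K0 -> K `<=` K0 ->
  orth_in K0 (orth_in K0 K) = K.
Proof.
move=> Kc K0s KK0; apply/seteqP; split=> [u [K0u uP]|u Ku].
  have := orth_proj_rest Kc K0s KK0 K0u.
  have [Kp pP] := orth_projP u Kc.
  set q := _ - _ => qo.
  suff q0 : q = 0 by rewrite -(subrK (orth_proj K u) u) -/q q0 add0r.
  apply: inner_eq0; rewrite {1}/q innerBl uP// innerC.
  by have [_ /(_ _ Kp) ->] := qo; rewrite conjC0 subr0.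
by split; [exact: KK0|move=> k [_ /(_ _ Ku) ku]; rewrite innerC ku conjC0].
Qed.

Lemma orth_in_closure K0 S : orth_in K0 (closure S) = orth_in K0 S.
Proof.
apply/seteqP; split=> u [K0u uS]; split=> // s Ss; first exact/uS/subset_closure.
exact: orth_closure Ss.
Qed.

(** The form in which density is always proved below: nothing in [K] but [0] is
    orthogonal to [S]. *)
Lemma dense_of_orth K S : closed_subspace K -> subspace S -> S `<=` K ->
  (forall w, K w -> (forall s, S s -> '[w, s] = 0) -> w = 0) -> K `<=` closure S.
Proof.
move=> Kc Ss SK orth0 u Ku.
have Cc := closed_subspace_closure Ss; have CK : closure S `<=` K.
  by case: Kc => _ _ /closure_id ->; exact: closureS.
have [Kq qP] := orth_proj_rest Cc (closed_subspaceW Kc) CK Ku.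
have [Cp _] := orth_projP u Cc.
have := orth0 _ Kq (fun s Ss => qP s (subset_closure Ss)).
by move/eqP; rewrite subr_eq0 => /eqP ->.
Qed.

(** The representing vector is a multiple of the part of some [u] with
    [f u != 0] that is orthogonal to the kernel. Boundedness is asked of the real
    part only, which is what the Cauchy-Schwarz estimates provide. *)
Lemma riesz (f : H -> R[i]) (c : R) :
  (forall (a : R[i]) u v, f (a *: u + v) = a * f u + f v) ->
  (forall u, `|Re (f u)| <= c * nrm u) ->
  exists w, forall u, f u = '[u, w].
Proof.
move=> fl fb.
have f0 : f 0 = 0.
  by have := fl (-1) 0 0; rewrite scaler0 addr0 mulN1r addNr.
have fZ (a : R[i]) u : f (a *: u) = a * f u by have := fl a u 0; rewrite addr0 f0 addr0.
have fB u v : f (u - v) = f u - f v.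
  by rewrite addrC -scaleN1r fl mulN1r addrC.
pose K := [set u | f u = 0].
have Kc : closed_subspace K.
  split=> //= [a u v /= fu fv|u /closure_nrmP Ku].
    by rewrite /K /= fl fu fv mulr0 addr0.
  suff re v : closure K v -> Re (f v) = 0.
    apply: complex_eq; first exact/re/closure_nrmP.
    have : Re (f (- 'i%C *: u)) = 0.
      have Ks : subspace K.
        by split=> // a x y fx fy; rewrite /K /= fl fx fy mulr0 addr0.
      apply/re/(subspaceZ _ (closed_subspaceW (closed_subspace_closure Ks))).
      exact/closure_nrmP.
    by rewrite fZ; case: (f u) => a b /=; rewrite oppr0 mul0r sub0r mulN1r opprK.
  move=> /closure_nrmP Kv; apply/eqP; rewrite -normr_le0; apply/ler_addgt0Pr => e e0.
  have c1 : 0 < `|c| + 1 by rewrite ltr_wpDl.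
  have [s /= fs vs] := Kv (e / (`|c| + 1)) ltac:(by rewrite divr_gt0).
  have -> : f v = f (v - s) by rewrite fB fs subr0.
  rewrite add0r; apply: le_trans (fb _) _.
  apply: le_trans (_ : (`|c| + 1) * (e / (`|c| + 1)) <= _).
    apply: le_trans (_ : `|c| * nrm (v - s) <= _).
      by rewrite ler_wpM2r ?nrm_ge0// ler_norm.
    by rewrite ler_pM ?nrm_ge0 ?lerDl// ltW.
  by rewrite mulrC divfK// gt_eqF.
case: (pselect (forall u, K u)) => [all0|/existsNP[u Ku]].
  by exists 0 => u; rewrite inner0r; exact: all0.
have [Kp pP] := orth_projP u Kc; set p := u - orth_proj K u in pP *.
have fp : f p = f u by rewrite fB [f (orth_proj _ _)]Kp subr0.
have fp0 : f p != 0 by rewrite fp; apply/eqP.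
have p0 : '[p, p] != 0.
  by apply/eqP => /inner_eq0 p0; move: fp0; rewrite p0 f0 eqxx.
exists (((f p)^* / '[p, p]) *: p) => x.
have /pP : K (x - (f x / f p) *: p) by rewrite /K /= fB fZ divfK// subrr.
rewrite innerBr innerZr => /eqP; rewrite subr_eq0 => /eqP px.
have pp : ('[p, p])^* = '[p, p] by rewrite -innerC.
rewrite innerZr (innerC p x) px !rmorphM/= !fmorphV/= pp.
rewrite ![(_^*)^*](conjcK _).
by field; rewrite p0 fp0.
Qed.

End subspaces.

(** * Symmetric and dissipative operators *)

Section linear_operators.
Context (R : realType) (H F : hilbertType R).
Implicit Types (A : operator H F) (u v : H).

Lemma dom_subspace A : linear_op A -> subspace (dom A).
Proof. by case. Qed.

Lemma linear_opZ A (a : R[i]) u : linear_op A -> dom A u -> A (a *: u) = a *: A u.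
Proof.
move=> [A0 _ AP] Au; have A00 : A 0 = 0.
  by have := AP (-1) _ _ A0 A0; rewrite scaler0 addr0 scaleN1r addNr.
by rewrite -[a *: u]addr0 AP// A00 addr0.
Qed.

Lemma linear_opD A u v : linear_op A -> dom A u -> dom A v -> A (u + v) = A u + A v.
Proof. by move=> [_ _ AP] Au Av; rewrite -[u]scale1r AP// !scale1r. Qed.

Lemma linear_opB A u v : linear_op A -> dom A u -> dom A v -> A (u - v) = A u - A v.
Proof. by move=> [_ _ AP] Au Av; rewrite addrC -scaleN1r AP// scaleN1r addrC. Qed.

Lemma linear_op0 A : linear_op A -> A 0 = 0.
Proof. by move=> Al; rewrite -(scale0r (0 : H)) linear_opZ ?scale0r//; case: Al. Qed.

End linear_operators.

Section operator_criteria.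
Context (R : realType) (H : hilbertType R).
Implicit Types (K : set H) (A B M : operator H H) (u v w : H) (z : R[i]).

Definition symmetric_op M := forall u v, dom M u -> dom M v -> '[M u, v] = '[u, M v].

Definition onto K B z := forall f, K f -> exists2 u, dom B u & B u - z *: u = f.

Lemma shiftB A z u v : linear_op A -> dom A u -> dom A v ->
  A (u - v) - z *: (u - v) = (A u - z *: u) - (A v - z *: v).
Proof. by move=> Al Au Av; rewrite linear_opB// scalerBr opprD addrACA -opprD. Qed.

Lemma restr_linear K A : subspace K -> linear_op A -> linear_op (restr K A).
Proof.
move=> [K0 KP] [A0 AD AP]; split=> // [a u v [? ?] [? ?]|a u v [? _] [? _]].
  by split; [exact: AD|exact: KP].
exact: AP.
Qed.

Lemma injective_of_bound B z : linear_op B ->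
  (forall u, dom B u -> B u - z *: u = 0 -> u = 0) ->
  forall u v, dom B u -> dom B v -> B u - z *: u = B v - z *: v -> u = v.
Proof.
move=> Bl inj u v Bu Bv uv; apply/eqP; rewrite -subr_eq0; apply/eqP/inj.
  exact: subspaceB (dom_subspace Bl) Bu Bv.
by rewrite shiftB// uv subrr.
Qed.

Lemma resolventE B z u h : linear_op B ->
  (forall u, dom B u -> B u - z *: u = 0 -> u = 0) ->
  dom B u -> B u - z *: u = h -> resolvent B z h = u.
Proof.
move=> Bl inj Bu uh; apply: xget_unique => // v /= [Bv vh].
by apply: injective_of_bound inj _ _ _ _ _ => //; rewrite vh uh.
Qed.

Lemma cancel_nrm (c : R) u w : c * nrm u ^+ 2 <= nrm w * nrm u -> c * nrm u <= nrm w.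
Proof.
move=> h; have [u0|u0] := eqVneq (nrm u) 0; first by rewrite u0 mulr0 nrm_ge0.
have u1 : 0 < nrm u by rewrite lt_def u0 nrm_ge0.
by rewrite -(ler_pM2r u1) -mulrA -expr2.
Qed.

(** The source of all resolvent estimates below. *)
Lemma Im_shift B z u : Im '[B u - z *: u, u] = Im '[B u, u] - Im z * nrm u ^+ 2.
Proof.
rewrite innerBl innerZl inner_nrm; case: '[B u, u] => a b; case: z => c d /=.
by rewrite mulr0 add0r.
Qed.

Lemma dissipative_bound B z u : 0 <= Im '[B u, u] ->
  - Im z * nrm u <= nrm (B u - z *: u).
Proof.
move=> Bu; apply: cancel_nrm; apply: le_trans (_ : Im '[B u - z *: u, u] <= _).
  by rewrite Im_shift mulNr -[leLHS]add0r lerB.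
exact: le_trans (ler_norm _) (Im_CS _ _).
Qed.

Lemma dissipative_inj B z : (forall u, dom B u -> 0 <= Im '[B u, u]) -> Im z < 0 ->
  forall u, dom B u -> B u - z *: u = 0 -> u = 0.
Proof.
move=> Bd z0 u /Bd/(dissipative_bound z) + uz; rewrite uz nrm0 pmulr_rle0 ?oppr_gt0//.
by move=> u0; apply/nrm0_eq0/eqP; rewrite eq_le u0 nrm_ge0.
Qed.

Lemma symmetric_Im M u : symmetric_op M -> dom M u -> Im '[M u, u] = 0.
Proof.
move=> sM Mu; have := Im_innerC (M u) u; rewrite -sM//; lra.
Qed.

Lemma symmetric_inj M z : symmetric_op M -> Im z != 0 ->
  forall u, dom M u -> M u - z *: u = 0 -> u = 0.
Proof.
move=> sM z0 u Mu uz; have := Im_shift M z u; rewrite uz inner0l symmetric_Im//= sub0r.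
move=> /esym/eqP; rewrite oppr_eq0 mulf_eq0 (negbTE z0)/= sqrf_eq0.
by move=> /eqP/nrm0_eq0.
Qed.

Lemma symmetric_bound M z u : symmetric_op M -> dom M u ->
  `|Im z| * nrm u <= nrm (M u - z *: u).
Proof.
move=> sM Mu; apply: cancel_nrm; apply: le_trans (Im_CS _ _).
by rewrite Im_shift symmetric_Im// sub0r normrN normrM (ger0_norm (sqr_ge0 _)).
Qed.

Lemma conj_Im z : Im z^* = - Im z.
Proof. by case: z. Qed.

(** Surjectivity at a conjugate pair of points leaves no room between [N] and
    the adjoint of [M]: if [<M u, v> = <u, w>] for all [u] in the domain, solve
    [(N - z) x = w - z v]; then [v - x] is orthogonal to the range of
    [M - z^*]. *)
Lemma adjoint_pair_maximal K M N z : subspace K -> dom N `<=` K ->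
  (forall u v, dom M u -> dom N v -> '[M u, v] = '[u, N v]) ->
  onto K N z -> onto K M z^* ->
  forall v w, K v -> K w -> (forall u, dom M u -> '[M u, v] = '[u, w]) ->
  dom N v /\ N v = w.
Proof.
move=> Ks NK MN sz sz' v w Kv Kw vw.
have [x Nx xE] := sz (w - z *: v) ltac:(by apply: subspaceB => //; exact: subspaceZ).
suff vx : v = x.
  move: xE; rewrite -vx in Nx * => /eqP; rewrite (inj_eq (addIr _)) => /eqP.
  by split.
apply/eqP; rewrite -subr_eq0; apply/eqP/inner_eq0.
have [u Mu {1}<-] := sz' (v - x) ltac:(by apply: subspaceB => //; exact: NK).
have -> : '[M u - z^* *: u, v - x] = '[u, (w - z *: v) - (N x - z *: x)].
  rewrite !innerBl !innerBr !innerZl !innerZr (vw u Mu) (MN u x Mu Nx).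
  by ring.
by rewrite xE subrr inner0r.
Qed.

(** Density of the domain comes for free: if [w] is orthogonal to it and
    [(M - z) x = w], then [Im <w, x> = 0] forces [x = 0]. *)
Lemma selfadjoint_crit K M z : closed_subspace K -> linear_op M ->
  dom M `<=` K -> (forall u, dom M u -> K (M u)) -> symmetric_op M -> Im z != 0 ->
  onto K M z -> onto K M z^* -> selfadjoint K M.
Proof.
move=> Kc Ml MK KM sM z0 sz sz'; have Ks := closed_subspaceW Kc.
have orth0 w : K w -> (forall s, dom M s -> '[w, s] = 0) -> w = 0.
  move=> Kw ws; have [x Mx xw] := sz _ Kw.
  have : x = 0.
    have := ws x Mx; rewrite -xw => /(congr1 Im).
    rewrite Im_shift symmetric_Im//= sub0r => /eqP.
    by rewrite oppr_eq0 mulf_eq0 (negbTE z0)/= sqrf_eq0 => /eqP/nrm0_eq0.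
  by move=> x0; rewrite -xw x0 linear_op0// scaler0 subr0.
have dM : K `<=` closure (dom M).
  by apply: dense_of_orth => //; exact: dom_subspace.
split; first by split.
have adj := adjoint_pair_maximal Ks MK sM sz sz'.
split.
  apply/seteqP; split=> [v Mv|v [Kv [w [Kw vw]]]].
    split; first exact: MK.
    by exists (M v); split; [exact: KM|move=> u Mu; exact: sM].
  by have [] := adj v w Kv Kw vw.
move=> u Mu; apply/esym/xget_unique => /=.
  by split; [exact: KM|move=> v Mv; exact: sM].
by move=> w [Kw vw]; have [_ ->] := adj u w (MK _ Mu) Kw vw.
Qed.

(** [B - z] is already surjective, and a dissipative extension stays injective
    when shifted by [z], so it cannot be larger. Density of the domain is
    obtained as for symmetric operators. *)
Lemma maxdiss_crit K B z : closed_subspace K -> linear_op B ->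
  dom B `<=` K -> (forall u, dom B u -> K (B u)) ->
  (forall u, dom B u -> 0 <= Im '[B u, u]) -> Im z < 0 -> onto K B z ->
  maximal_dissipative K B.
Proof.
move=> Kc Bl BK KB Bd z0 sz; have Ks := closed_subspaceW Kc.
have orth0 w : K w -> (forall s, dom B s -> '[w, s] = 0) -> w = 0.
  move=> Kw ws; have [x Bx xw] := sz _ Kw.
  have x0 : x = 0.
    have := ws x Bx; rewrite -xw => /(congr1 Im); rewrite Im_shift/= => h.
    have : - Im z * nrm x ^+ 2 <= 0 by have := Bd x Bx; lra.
    rewrite pmulr_rle0 ?oppr_gt0// => x0; apply/nrm0_eq0/eqP.
    by rewrite -sqrf_eq0 eq_le x0 sqr_ge0.
  by rewrite -xw x0 linear_op0// scaler0 subr0.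
have dB : K `<=` closure (dom B).
  by apply: dense_of_orth => //; exact: dom_subspace.
split; first by split.
move=> C [[_ Cl CK KC _] Cd] [BC CB].
have BE u : dom C u -> dom B u.
  move=> Cu; have [x Bx xu] := sz (C u - z *: u)
    ltac:(by apply: (subspaceB Ks); [exact: KC|exact/(subspaceZ _ Ks)/CK]).
  suff -> : u = x by [].
  apply: (injective_of_bound Cl (dissipative_inj Cd z0)) => //; first exact: BC.
  by rewrite (CB x).
split; last by move=> u Bu; rewrite CB.
by apply/seteqP; split.
Qed.

(** A lower bound makes solutions of [(B - z) u = f_n] Cauchy when [f_n] is, so
    the range of [B - z] is closed; by the last hypothesis it is dense. Closedness
    of [B] is phrased by approximation, which is how it is met. *)
Lemma onto_closed_range K B z (c : R) : closed_subspace K -> linear_op B ->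
  dom B `<=` K -> (forall u, dom B u -> K (B u)) -> 0 < c ->
  (forall u, dom B u -> c * nrm u <= nrm (B u - z *: u)) ->
  (forall u y, K u -> K y -> (forall e : R, 0 < e -> exists u',
     [/\ dom B u', nrm (u - u') < e & nrm (y - B u') < e]) ->
     dom B u /\ B u = y) ->
  (forall w, K w -> (forall u, dom B u -> '[w, B u - z *: u] = 0) -> w = 0) ->
  onto K B z.
Proof.
move=> Kc Bl BK KB c0 bound cl orth0 f Kf; have Ks := closed_subspaceW Kc.
pose S := [set B u - z *: u | u in dom B].
have B0 := (dom_subspace Bl).1.
have Sf : closure S f.
  apply: (dense_of_orth Kc) Kf.
  - split; first by exists 0 => //; rewrite linear_op0// scaler0 subr0.
    move=> a _ _ [u Bu <-] [v Bv <-]; exists (a *: u + v).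
      exact: (dom_subspace Bl).2.
    have [_ _ ->] := Bl; rewrite // !scalerDr opprD scalerN addrACA.
    by rewrite !scalerA [z * a]mulrC.
  - move=> _ [u Bu <-]; apply: (subspaceB Ks); first exact: KB.
    exact/(subspaceZ _ Ks)/BK.
  - by move=> w Kw ws; apply: orth0 => // u Bu; apply: ws; exists u.
have ex n : exists u, dom B u /\ nrm (f - (B u - z *: u)) < n.+1%:R^-1.
  have /closure_nrmP/(_ n.+1%:R^-1) := Sf.
  by rewrite invr_gt0 => /(_ (ltr0Sn _ _))[_ [u Bu <-] fu]; exists u.
have /choice[u uP] := ex.
have [l lP] : exists l, forall e : R, 0 < e -> exists N, forall n, (N <= n)%N ->
    nrm (u n - l) < e.
  apply: hilbert_seq_complete => e e0.
  have [N NP] := natSinv_small (c * e / 2) ltac:(by rewrite divr_gt0// mulr_gt0).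
  exists N => m n Nm Nn; rewrite -(ltr_pM2l c0).
  have Bm := (uP m).1; have Bn := (uP n).1.
  apply: le_lt_trans (bound _ (subspaceB (dom_subspace Bl) Bm Bn)) _.
  rewrite shiftB//.
  set x := B (u m) - _; set y := B (u n) - _.
  rewrite (_ : x - y = (f - y) - (f - x)); last first.
    by clearbody x y; rewrite opprB [RHS]addrC addrA subrK.
  apply: le_lt_trans (nrmD _ _) _; rewrite nrmN [ltRHS](splitr _) ltrD//.
    exact: lt_trans (uP n).2 (NP _ Nn).
  exact: lt_trans (uP m).2 (NP _ Nm).
have Kl : K l.
  apply: (closed_subspace_lim Kc) => e /lP[N /(_ _ (leqnn N)) Nl].
  by exists (u N); [exact/BK/(uP N).1|rewrite nrmB].
have [|||Bl' BlE] := cl l (f + z *: l); first exact: Kl.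
- by apply: (subspaceD Ks) => //; exact: subspaceZ.
- move=> e e0; have n1 : 0 < Re `|z| + 1.
    by rewrite ltr_wpDl// normc_def/= sqrtr_ge0.
  pose d := e / 2 / (Re `|z| + 1).
  have d0 : 0 < d by rewrite !divr_gt0.
  have dle : d <= e / 2.
    rewrite ler_pdivrMr// ler_peMr ?divr_ge0 ?(ltW e0)// lerDr.
    by rewrite normc_def/= sqrtr_ge0.
  have [N1 N1P] := lP _ d0.
  have [N2 N2P] := natSinv_small (e / 2) ltac:(by rewrite divr_gt0).
  pose n := maxn N1 N2; exists (u n).
  have un : nrm (l - u n) < d by rewrite nrmB; apply: N1P; rewrite leq_maxl.
  split; first exact: (uP n).1.
    apply: lt_le_trans un _; apply: le_trans dle _.
    by rewrite ler_pdivrMr// ler_peMr ?ler1n// ltW.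
  rewrite (_ : _ - _ = (f - (B (u n) - z *: u n)) + z *: (l - u n)); last first.
    rewrite scalerBr opprB -!addrA; congr (_ + _).
    by rewrite [RHS]addrA [RHS]addrC !addrA subrK.
  apply: le_lt_trans (nrmD _ _) _; rewrite [ltRHS](splitr e) ltr_leD//.
    by apply: lt_trans (uP n).2 (N2P _ _); rewrite leq_maxr.
  rewrite nrmZ; apply: le_trans (_ : (Re `|z| + 1) * d <= _).
    rewrite ler_pM ?nrm_ge0 ?lerDl ?ler01 ?(ltW un)//.
    by rewrite normc_def/= sqrtr_ge0.
  by rewrite mulrC divfK// gt_eqF.
by exists l => //; rewrite BlE addrK.
Qed.

(** Surjectivity at one conjugate pair propagates to every non-real point: the
    graph of [M] is closed because [M] coincides with its adjoint. *)
Lemma symmetric_onto K M z0 : closed_subspace K -> linear_op M ->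
  dom M `<=` K -> (forall u, dom M u -> K (M u)) -> symmetric_op M -> Im z0 != 0 ->
  onto K M z0 -> onto K M z0^* -> forall z, Im z != 0 -> onto K M z.
Proof.
move=> Kc Ml MK KM sM z00 sz sz' z zn0; have Ks := closed_subspaceW Kc.
have adj := adjoint_pair_maximal Ks MK sM sz sz'.
apply: (@onto_closed_range _ _ _ `|Im z|) => //.
- by rewrite normr_gt0.
- by move=> u Mu; exact: symmetric_bound.
- move=> u y Ku Ky uy; apply: adj => // v Mv; apply/eqP; rewrite -subr_eq0; apply/eqP.
  suff : '[((M v, v) : H ⊕ H), ((u, - y) : H ⊕ H)] = 0.
    by rewrite hsum_innerE/= innerNr.
  apply: inner_small => e e0; have [w [Mw uw yw]] := uy (e / 2) ltac:(by rewrite divr_gt0).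
  exists ((w, - M w) : H ⊕ H); split.
    rewrite -ltr_sqr ?nnegrE ?nrm_ge0 ?(ltW e0)// hsum_nrm2/=.
    rewrite -opprD nrmN; move: uw yw (nrm_ge0 (u - w)) (nrm_ge0 (y - M w)).
    by move: (nrm _) (nrm _) => p q; nra.
  by rewrite hsum_innerE/= innerNr sM// subrr.
- move=> w Kw wo; have [Mw wE] : dom M w /\ M w = z^* *: w.
    apply: adj => //; first exact: subspaceZ.
    move=> u Mu; have := wo u Mu; rewrite innerBr innerZr => /eqP.
    rewrite subr_eq0 => /eqP uw.
    by rewrite innerC [in RHS]innerC uw innerZl.
  apply: (symmetric_inj sM (z := z^*)) => //; first by rewrite conj_Im oppr_eq0.
  by rewrite wE subrr.
Qed.

End operator_criteria.

Section maximal_dissipative_theory.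
Context (R : realType) (H : hilbertType R).
Implicit Types (K : set H) (A B M : operator H H) (u v w : H) (z : R[i]).

Lemma affine_ge0 (c x : R) : (forall s : R, 0 <= c + s * x) -> x = 0.
Proof.
move=> h; have [//|x0] := eqVneq x 0; have := h (- (c + 1) / x).
by rewrite divfK//; lra.
Qed.

Lemma complex_affine_ge0 (c : R) (r : R[i]) :
  (forall a : R[i], 0 <= c + Im (a * r)) -> r = 0.
Proof.
case: r => x y h; apply: complex_eq => /=; apply: (@affine_ge0 c) => s.
  by have := h (0 +i* s); rewrite /= mul0r add0r.
by have := h (s +i* 0); rewrite /= mul0r addr0.
Qed.

Lemma Im_inner_ge0_lim u v : (forall e : R, 0 < e -> exists u' v',
  [/\ nrm (u - u') < e, nrm (v - v') < e & 0 <= Im '[u', v']]) -> 0 <= Im '[u, v].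
Proof.
move=> h; apply/ler_addgt0Pr => e e0.
pose d := Num.min 1 (e / (nrm u + nrm v + 1)).
have n1 : 0 < nrm u + nrm v + 1 by rewrite ltr_wpDl ?addr_ge0 ?nrm_ge0.
have d0 : 0 < d by rewrite lt_min ltr01 divr_gt0.
have [u' [v' [uu vv uv]]] := h d d0.
have -> : '[u, v] = '[u - u', v] + '[u', v - v'] + '[u', v'].
  by rewrite innerBl innerBr addrA subrK subrK.
have d1 : d <= 1 by rewrite ge_min lexx.
have de : d * (nrm u + nrm v + 1) <= e.
  by rewrite -ler_pdivlMr// ge_min lexx orbT.
have nu' : nrm u' <= nrm u + 1.
  rewrite (_ : u' = u - (u - u')); last by rewrite opprB addrC subrK.
  by apply: le_trans (nrmD _ _) _; rewrite nrmN lerD2l (le_trans (ltW uu)).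
have h1 : - (d * nrm v) <= Im '[u - u', v].
  have := Im_CS (u - u') v; rewrite ler_norml => /andP[+ _]; apply: le_trans.
  by rewrite lerN2 ler_wpM2r ?nrm_ge0 ?ltW.
have h2 : - ((nrm u + 1) * d) <= Im '[u', v - v'].
  have := Im_CS u' (v - v'); rewrite ler_norml => /andP[+ _]; apply: le_trans.
  by rewrite lerN2 ler_pM ?nrm_ge0 ?(ltW vv).
move: h1 h2 uv; case: '[u - u', v] => ? ?; case: '[u', v - v'] => ? ?.
case: '[u', v'] => ? ? /=; lra.
Qed.

(** Otherwise adjoining [w |-> y] would give a proper dissipative extension. *)
Lemma maximal_dissipative_absorbs K A w y : maximal_dissipative K A -> K w -> K y ->
  (forall v (a : R[i]), dom A v -> 0 <= Im '[A v + a *: y, v + a *: w]) ->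
  dom A w /\ A w = y.
Proof.
move=> [[[Kc Al AK KA dA] Ad] Amax] Kw Ky wy; have Ks := closed_subspaceW Kc.
have As := dom_subspace Al.
have val : dom A w -> A w = y.
  move=> Aw; apply/esym/eqP; rewrite -subr_eq0; apply/eqP/inner_eq0.
  have orth v : closure (dom A) v -> '[y - A w, v] = 0.
    apply: orth_closure => {}v Av; apply: (@complex_affine_ge0 (Im '[A v, v])) => a.
    have := wy (v - a *: w) a (subspaceB As Av (subspaceZ _ As Aw)).
    rewrite linear_opB ?linear_opZ//; last exact: subspaceZ.
    rewrite subrK -addrA [- _ + _]addrC -scalerBr.
    by rewrite innerDl innerZl; case: '[A v, v] => ? ?; case: (a * _).
  by apply/orth/dA/(subspaceB Ks) => //; exact: KA.
suff Aw : dom A w by split=> //; exact: val.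
pose P x b := exists v (a : R[i]), [/\ dom A v, x = v + a *: w & b = A v + a *: y].
have Pl (a : R[i]) x b x' b' : P x b -> P x' b' -> P (a *: x + x') (a *: b + b').
  move=> [v [c [Av -> ->]]] [v' [c' [Av' -> ->]]].
  exists (a *: v + v'), (a * c + c'); split; first exact: As.2.
    by rewrite scalerDr scalerDl scalerA addrACA.
  have [_ _ ->] := Al; rewrite //.
  by rewrite scalerDr scalerDl scalerA addrACA.
have P0 : P 0 0.
  by exists 0, 0; rewrite linear_op0// !scale0r !addr0; split=> //; exact: As.1.
have [//|nAw] := pselect (dom A w).
have P0E b : P 0 b -> b = 0.
  move=> [v [a [Av /esym/eqP]]]; rewrite addr_eq0 => /eqP vw ->.
  have a0 : a = 0.
    apply/eqP/contraT => a0; exfalso; apply: nAw.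
    have -> : w = (- a^-1) *: v by rewrite vw scalerN scaleNr opprK scalerA mulVf// scale1r.
    exact: subspaceZ.
  by rewrite a0 scale0r addr0 vw a0 scale0r oppr0 linear_op0.
have PE x b b' : P x b -> P x b' -> b = b'.
  move=> Pb Pb'; apply/eqP; rewrite -subr_eq0; apply/eqP/P0E.
  by have := Pl (-1) _ _ _ _ Pb' Pb; rewrite !scaleN1r addNr addrC.
pose B := Operator [set x | exists b, P x b] (fun x => xget 0 [set b | P x b]).
have BP x : dom B x -> P x (B x) by move=> Bx; exact: (xgetPex 0 Bx).
have BE x b : P x b -> B x = b.
  by move=> Pb; have Bx : dom B x by [exists b]; exact: PE (BP _ Bx) Pb.
have Bl : linear_op B.
  split=> [|a u v Bu Bv|a u v Bu Bv].
  - by exists 0.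
  - by exists (a *: B u + B v); apply: Pl; exact: BP.
  - by apply: BE; apply: Pl; exact: BP.
have AP u : dom A u -> P u (A u).
  by move=> Au; exists u, 0; rewrite !scale0r !addr0.
have AB : op_extends A B.
  split=> u Au; first by exists (A u); exact: AP.
  by apply/BE/AP.
have [dAB _] : op_eq A B.
  apply: Amax => //; split; last first.
    by move=> x /BP[v [a [Av xE ->]]]; rewrite xE; exact: wy.
  split=> //.
  - move=> x /BP[v [a [Av -> _]]]; apply: (subspaceD Ks); first exact: AK.
    exact: subspaceZ.
  - move=> x /BP[v [a [Av _ ->]]]; apply: (subspaceD Ks); first exact: KA.
    exact: subspaceZ.
  - by move=> x /dA; apply: closureS; case: AB.
rewrite dAB; exists y, 0, 1; rewrite linear_op0// !scale1r !add0r; split=> //.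
exact: As.1.
Qed.

(** Both hypotheses of [onto_closed_range] that concern the graph of [A] come
    from maximality: a limit of points of the graph can be adjoined to [A], and so
    can [w |-> z^* w] when [w] is orthogonal to the range of [A - z]. *)
Lemma maximal_dissipative_onto K A z : maximal_dissipative K A -> Im z < 0 ->
  onto K A z.
Proof.
move=> mA z0; have [[[Kc Al AK KA dA] Ad] _] := mA.
have Ks := closed_subspaceW Kc; have As := dom_subspace Al.
apply: (@onto_closed_range _ _ _ _ _ (- Im z)) => //.
- by rewrite oppr_gt0.
- by move=> u Au; apply: dissipative_bound; exact: Ad.
- move=> u y Ku Ky uy; apply: (maximal_dissipative_absorbs mA) => // v a Av.
  apply: Im_inner_ge0_lim => e e0.
  have n1 : 0 < Re `|a| + 1 by rewrite ltr_wpDl// normc_def/= sqrtr_ge0.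
  have [u' [Au' uu yu]] := uy (e / (Re `|a| + 1)) ltac:(by rewrite divr_gt0).
  have bd (x : H) : nrm x < e / (Re `|a| + 1) -> nrm (a *: x) < e.
    move=> xe; rewrite nrmZ; apply: le_lt_trans (_ : (Re `|a| + 1) * nrm x < e).
      by rewrite ler_wpM2r ?nrm_ge0 ?lerDl.
    by rewrite mulrC -ltr_pdivlMr.
  exists (A v + a *: A u'), (v + a *: u').
  rewrite !opprD ![_ + _ + (- _ - _)]addrACA !subrr !add0r -!scalerBr.
  split; [exact: bd|exact: bd|].
  rewrite -linear_opZ// -linear_opD//; last exact: subspaceZ.
  by apply: Ad; apply: (subspaceD As) => //; exact: subspaceZ.
- move=> w Kw wo.
  have [||v a Av|Aw wE] := maximal_dissipative_absorbs mA (w := w) (y := z^* *: w).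
  + by [].
  + exact: subspaceZ.
  + have := wo v Av; rewrite innerBr innerZr => /eqP; rewrite subr_eq0 => /eqP wv.
    have Avw : '[A v, w] = z * '[v, w].
      by rewrite innerC wv rmorphM/= [(z^*)^*](conjcK z) -innerC.
    have := Ad v Av; rewrite !innerDl !innerDr !innerZl !innerZr Avw.
    rewrite inner_nrm (innerC v w).
    have : 0 <= - Im z * nrm w ^+ 2 by rewrite mulr_ge0 ?sqr_ge0// oppr_ge0 ltW.
    move: (nrm w ^+ 2) => n.
    case: '[A v, v] => p q; case: '[v, w] => r s; case: z {wo z0 wv Avw} => c d.
    case: a => a b /=; nra.
  + have := wo w Aw; rewrite wE -scalerBl innerZr => /eqP.
    rewrite mulf_eq0 => /orP[/eqP/(congr1 Im)|/eqP/inner_eq0//].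
    by case: z z0 {wo wE} => c d /= d0 h; exfalso; lra.
Qed.

End maximal_dissipative_theory.

(** * Boundary operators and the characteristic function *)

Section bounded_operators.
Context (R : realType) (U V : hilbertType R).

Lemma bounded_adjointP (T : U -> V) (c : R) :
  (forall (a : R[i]) u v, T (a *: u + v) = a *: T u + T v) ->
  (forall u, nrm (T u) <= c * nrm u) ->
  forall v u, '[T u, v] = '[u, bounded_adjoint T v].
Proof.
move=> Tl Tb v.
have [w wP] : exists w, forall u, '[T u, v] = '[u, w].
  apply: (@riesz _ _ (fun u => '[T u, v]) (c * nrm v)) => [a u u'|u].
    by rewrite Tl innerP.
  apply: le_trans (Re_CS _ _) _.
  by rewrite mulrAC ler_wpM2r ?nrm_ge0.
exact: (xgetPex 0 (ex_intro (fun w => forall u, '[T u, v] = '[u, w]) w wP)).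
Qed.

(** The image of a point is the limit of [Q u] along any sequence with [P u]
    tending to that point. *)
Lemma contraction_extension (H : hilbertType R) (D : set H) (P : H -> U) (Q : H -> V) :
  linear_op (Operator D P) -> linear_op (Operator D Q) ->
  (forall u, D u -> nrm (Q u) <= nrm (P u)) -> closure (P @` D) = setT ->
  exists S : U -> V, [/\
    forall (a : R[i]) u v, S (a *: u + v) = a *: S u + S v,
    forall u, nrm (S u) <= nrm u & forall u, D u -> S (P u) = Q u].
Proof.
move=> Pl Ql QP Pd; have [D0 DP _] := Pl; rewrite /= in D0 DP.
pose rel e s := forall d : R, 0 < d ->
  exists u, [/\ D u, nrm (e - P u) < d & nrm (s - Q u) < d].
have PB u v : D u -> D v -> P (u - v) = P u - P v by exact: (linear_opB Pl).
have QB u v : D u -> D v -> Q (u - v) = Q u - Q v by exact: (linear_opB Ql).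
have DB u v : D u -> D v -> D (u - v) by exact: (subspaceB (dom_subspace Pl)).
have tot e : exists s, rel e s.
  have ce : closure (P @` D) e by rewrite Pd.
  have ex n : exists u, D u /\ nrm (e - P u) < n.+1%:R^-1.
    have /closure_nrmP/(_ n.+1%:R^-1) := ce.
    by rewrite invr_gt0 => /(_ (ltr0Sn _ _))[_ [u Du <-] eu]; exists u.
  have /choice[u uP] := ex.
  have [s sP] : exists s, forall d : R, 0 < d -> exists N, forall n, (N <= n)%N ->
      nrm (Q (u n) - s) < d.
    apply: hilbert_seq_complete => d d0.
    have [N NP] := natSinv_small (d / 2) ltac:(by rewrite divr_gt0).
    exists N => m n Nm Nn; have Dm := (uP m).1; have Dn := (uP n).1.
    rewrite -QB//; apply: le_lt_trans (QP _ (DB _ _ Dm Dn)) _; rewrite PB//.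
    rewrite (_ : P _ - _ = (e - P (u n)) - (e - P (u m))); last first.
      by rewrite opprB [RHS]addrC addrA subrK.
    apply: le_lt_trans (nrmD _ _) _; rewrite nrmN [ltRHS](splitr _) ltrD//.
      exact: lt_trans (uP n).2 (NP _ Nn).
    exact: lt_trans (uP m).2 (NP _ Nm).
  exists s => d d0; have [N1 N1P] := sP _ d0; have [N2 N2P] := natSinv_small _ d0.
  exists (u (maxn N1 N2)); split; first exact: (uP _).1.
    by apply: lt_trans (uP _).2 (N2P _ _); rewrite leq_maxr.
  by rewrite nrmB; apply: N1P; rewrite leq_maxl.
have le e s : rel e s -> nrm s <= nrm e.
  move=> es; apply/ler_addgt0Pr => d d0.
  have [u [Du eu su]] := es (d / 2) ltac:(by rewrite divr_gt0).
  rewrite -(subrK (Q u) s); apply: le_trans (nrmD _ _) _.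
  rewrite (splitr d) addrA [leRHS]addrC lerD ?(ltW su)//.
  apply: le_trans (QP _ Du) _; rewrite (_ : P u = e + (P u - e)); last by rewrite addrC subrK.
  by apply: le_trans (nrmD _ _) _; rewrite lerD2l nrmB ltW.
have lin (a : R[i]) e s e' s' : rel e s -> rel e' s' -> rel (a *: e + e') (a *: s + s').
  move=> es es' d d0.
  have n1 : 0 < Re `|a| + 1 by rewrite ltr_wpDl// normc_def/= sqrtr_ge0.
  have [u [Du eu su]] := es (d / 2 / (Re `|a| + 1)) ltac:(by rewrite !divr_gt0).
  have [v [Dv ev sv]] := es' (d / 2) ltac:(by rewrite divr_gt0).
  have bd (W : hilbertType R) (x y x' y' : W) :
      nrm (x - x') < d / 2 / (Re `|a| + 1) -> nrm (y - y') < d / 2 ->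
      nrm (a *: x + y - (a *: x' + y')) < d.
    move=> xx yy; rewrite opprD addrACA -scalerBr (splitr d).
    apply: le_lt_trans (nrmD _ _) _; apply: ler_ltD => //.
    rewrite nrmZ; apply: le_trans (_ : (Re `|a| + 1) * nrm (x - x') <= _).
      by rewrite ler_wpM2r ?nrm_ge0 ?lerDl.
    by rewrite mulrC -ler_pdivlMr// ltW.
  exists (a *: u + v); have [_ _ /= PE] := Pl; have [_ _ /= QE] := Ql.
  by rewrite PE// QE//; split; [exact: DP|exact: bd|exact: bd].
have uniq e s s' : rel e s -> rel e s' -> s = s'.
  move=> es es'; have := lin (-1) _ _ _ _ es' es; rewrite !scaleN1r addNr.
  move=> /le; rewrite nrm0 => le0; apply/eqP; rewrite -subr_eq0 addrC; apply/eqP.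
  by apply/nrm0_eq0/eqP; rewrite eq_le le0 nrm_ge0.
have /choice[S SP] := tot; exists S; split.
- by move=> a u v; apply: uniq (SP _) _; apply: lin; exact: SP.
- by move=> u; exact: le.
- move=> u Du; apply: uniq (SP _) _ => d d0; exists u.
  by rewrite !subrr !nrm0.
Qed.

Lemma contraction_continuous (S : U -> V) :
  (forall (a : R[i]) u v, S (a *: u + v) = a *: S u + S v) ->
  (forall u, nrm (S u) <= nrm u) -> continuous S.
Proof.
move=> Sl Sb x; apply/cvg_ballP => _ /posC_gt0[e e0 ->].
apply/nbhs_ballP; exists e%:C => /=; first by rewrite ltcR.
move=> y /ball_nrm xy; apply/ball_nrm.
rewrite (_ : S x - S y = S (x - y)); last by rewrite addrC -scaleN1r -Sl scaleN1r addrC.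
exact: le_lt_trans (Sb _) xy.
Qed.

End bounded_operators.

Section resolvent_theory.
Context (R : realType) (H : hilbertType R) (B : operator H H) (z : R[i]).
Context (Bl : linear_op B) (Bo : onto setT B z).
Context (Bi : forall u, dom B u -> B u - z *: u = 0 -> u = 0).

Lemma resolventP h : dom B (resolvent B z h) /\
  B (resolvent B z h) - z *: resolvent B z h = h.
Proof. by have [u Bu uh] := Bo (f := h) I; rewrite (resolventE Bl Bi Bu uh). Qed.

Lemma resolventK u : dom B u -> resolvent B z (B u - z *: u) = u.
Proof. by move=> Bu; exact: resolventE. Qed.

Lemma resolvent_linear (a : R[i]) h k :
  resolvent B z (a *: h + k) = a *: resolvent B z h + resolvent B z k.
Proof.
have [dh hE] := resolventP h; have [dk kE] := resolventP k.
apply: resolventE => //; first exact: (dom_subspace Bl).2.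
have [_ _ ->] := Bl => //; rewrite -[in RHS]hE -[in RHS]kE.
by rewrite !scalerDr opprD scalerN addrACA !scalerA [z * a]mulrC.
Qed.

(** Testing against [(B - z) u] instead of an arbitrary vector keeps the
    resolvent out of the formulas that use the adjoint of [Q (B - z)^-1]. *)
Lemma resolvent_adjointP (F : hilbertType R) (Q : H -> F) (c : R) :
  linear_op (Operator (dom B) Q) ->
  (forall u, dom B u -> nrm (Q u) <= c * nrm (B u - z *: u)) ->
  forall e u, dom B u ->
    '[Q u, e] = '[B u - z *: u, bounded_adjoint (fun h => Q (resolvent B z h)) e].
Proof.
move=> Ql Qb e u Bu.
rewrite -(@bounded_adjointP _ _ _ (fun h => Q (resolvent B z h)) c); last 2 first.
- move=> a h k; rewrite resolvent_linear; have [_ _ /= ->] := Ql => //.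
    exact: (resolventP h).1.
  exact: (resolventP k).1.
- by move=> h; have [dh {2}<-] := resolventP h; exact: Qb.
by rewrite resolventK.
Qed.

End resolvent_theory.

Section boundary_systems.
Context (R : realType).

Definition opN (H : hilbertType R) (B : operator H H) := Operator (dom B) (fun u => - B u).

Definition green_map (H F : hilbertType R) (B : operator H H) (Q : H -> F) (eps : R[i]) :=
  [/\ linear_op (Operator (dom B) Q), closure (Q @` dom B) = setT &
    forall u v, dom B u -> dom B v -> '[B u, v] - '[u, B v] = eps * '[Q u, Q v]].

(** The properties of [A], [C = A^*] and the boundary operators that the
    construction uses. They are invariant under exchanging
    [(A, C, G, Gs)] with [(- C, - A, Gs, G)], which turns each statement about
    the lower half-plane into one about the upper half-plane. *)
Definition boundary_system (H E Es : hilbertType R) (A C : operator H H)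
    (G : H -> E) (Gs : H -> Es) :=
  [/\ linear_op A /\ linear_op C,
    forall u v, dom A u -> dom C v -> '[A u, v] = '[u, C v],
    (forall z, Im z < 0 -> onto setT A z) /\ (forall z, 0 < Im z -> onto setT C z),
    green_map A G 'i%C & green_map C Gs (- 'i%C)].

Lemma opN_linear (H : hilbertType R) (B : operator H H) : linear_op B -> linear_op (opN B).
Proof.
by move=> [B0 BD BP]; split=> //= a u v Bu Bv; rewrite BP// opprD scalerN.
Qed.

Lemma opN_onto (H : hilbertType R) (B : operator H H) (z : R[i]) :
  onto setT B (- z) -> onto setT (opN B) z.
Proof.
move=> Bo f _; have [u Bu uf] := Bo (- f) I; exists u => //=.
by rewrite -[f]opprK -uf scaleNr opprK opprD.
Qed.

Lemma green_mapN (H F : hilbertType R) (B : operator H H) (Q : H -> F) (eps : R[i]) :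
  green_map B Q eps -> green_map (opN B) Q (- eps).
Proof.
move=> [Ql Qd Qg]; split=> //= u v Bu Bv.
by rewrite innerNl innerNr opprK mulNr -Qg// opprB addrC.
Qed.

Lemma boundary_system_swap (H E Es : hilbertType R) (A C : operator H H)
    (G : H -> E) (Gs : H -> Es) :
  boundary_system A C G Gs -> boundary_system (opN C) (opN A) Gs G.
Proof.
move=> [[Al Cl] AC [Ao Co] Gg Gsg]; split.
- by split; exact: opN_linear.
- move=> u v Cu Av /=; rewrite innerNl innerNr.
  by rewrite innerC -AC// -innerC.
- split=> z z0; apply: opN_onto; [apply: Co|apply: Ao].
    by case: z z0 => a b /=; rewrite oppr_gt0.
  by case: z z0 => a b /=; rewrite oppr_lt0.
- by have := green_mapN Gsg; rewrite opprK.
- exact: green_mapN.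
Qed.

(** The only property that is not immediate is that [C - z], for [C] the adjoint
    of [A] and [z] in the upper half-plane, is surjective: a solution [y] of
    [(C - z) y = h] represents the functional [k |-> <(A - z^* )^-1 k, h>]. *)
Lemma boundary_system_adjoint (H E Es : hilbertType R) (A : operator H H)
    (G : H -> E) (Gs : H -> Es) : maximal_dissipative setT A ->
  boundary_operator A G 'i%C -> boundary_operator (adjoint setT A) Gs (- 'i%C) ->
  boundary_system A (adjoint setT A) G Gs.
Proof.
move=> mA [Gl _ Gd Gg] [Gsl _ Gsd Gsg]; have [[[_ Al _ _ dA] Ad] _] := mA.
have adjP v : dom (adjoint setT A) v -> adjoint_rel setT A v (adjoint setT A v).
  by move=> [_ ex]; exact: (xgetPex 0 ex).
have adjE v w : adjoint_rel setT A v w -> adjoint setT A v = w.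
  move=> [_ vw]; apply: xget_unique => //= w' [_ vw'].
  apply/eqP; rewrite -subr_eq0; apply/eqP/inner_eq0; apply: (@orth_closure _ _ (dom A)).
    move=> u Au; rewrite innerC innerBr -vw// -vw'// subrr; exact: conjC0.
  exact: dA.
have adjA u v : dom A u -> dom (adjoint setT A) v -> '[A u, v] = '[u, adjoint setT A v].
  by move=> Au /adjP[_ ->].
have Ao z : Im z < 0 -> onto setT A z by exact: maximal_dissipative_onto.
split=> //; split=> //.
- have relP (a : R[i]) u v w x : adjoint_rel setT A u w -> adjoint_rel setT A v x ->
      adjoint_rel setT A (a *: u + v) (a *: w + x).
    move=> [_ uw] [_ vx]; split=> // y Ay.
    by rewrite !innerDr !innerZr uw// vx.
  split=> [|a u v /adjP du /adjP dv|a u v /adjP du /adjP dv].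
  + by split=> //; exists 0; split=> // u _; rewrite !inner0r.
  + by split=> //; eexists; exact: (relP a _ _ _ _ du dv).
  + by apply: adjE; exact: relP.
- move=> z z0 h _; have z0' : Im z^* < 0 by rewrite conj_Im oppr_lt0.
  have inj := dissipative_inj Ad z0'.
  have [resd resE] : (forall k, dom A (resolvent A z^* k)) /\ forall k,
      A (resolvent A z^* k) - z^* *: resolvent A z^* k = k.
    by split=> k; have [] := resolventP Al (Ao _ z0') inj k.
  have [y yP] : exists y, forall k, '[resolvent A z^* k, h] = '[k, y].
    apply: (@riesz _ _ (fun k => '[resolvent A z^* k, h]) ((Im z)^-1 * nrm h)).
      by move=> a k k'; rewrite (resolvent_linear Al (Ao _ z0') inj) innerP.
    move=> k; apply: le_trans (Re_CS _ _) _; rewrite mulrAC ler_wpM2r ?nrm_ge0//.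
    rewrite ler_pdivlMl//.
    by have := dissipative_bound z^* (Ad _ (resd k)); rewrite resE conj_Im opprK.
  have yrel : adjoint_rel setT A y (h + z *: y).
    split=> // u Au; have := yP (A u - z^* *: u).
    rewrite (resolventK Al inj)// innerBl innerZl innerDr innerZr => ->.
    by rewrite subrK.
  exists y; first by split=> //; exists (h + z *: y).
  by rewrite (adjE _ _ yrel) addrK.
Qed.

End boundary_systems.

Section boundary_theory.
Context (R : realType) (H E Es : hilbertType R) (A C : operator H H).
Context (G : H -> E) (Gs : H -> Es) (BS : boundary_system A C G Gs).
Implicit Types (u v w x y a b : H) (z : R[i]).

Let Al : linear_op A. Proof. by case: BS => -[]. Qed.
Let AC u v : dom A u -> dom C v -> '[A u, v] = '[u, C v].
Proof. by case: BS => _ h _ _ _; exact: h. Qed.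
Let Ao z : Im z < 0 -> onto setT A z. Proof. by case: BS => _ _ [h _] _ _; exact: h. Qed.
Let Co z : 0 < Im z -> onto setT C z. Proof. by case: BS => _ _ [_ h] _ _; exact: h. Qed.
Let Gl : linear_op (Operator (dom A) G). Proof. by case: BS => _ _ _ []. Qed.
Let Gg u v : dom A u -> dom A v -> '[A u, v] - '[u, A v] = 'i%C * '[G u, G v].
Proof. by case: BS => _ _ _ [_ _ h] _; exact: h. Qed.
Let Gd : closure (G @` dom A) = setT. Proof. by case: BS => _ _ _ []. Qed.

(** Boundary operators measure the failure of symmetry. *)
Lemma Im_green u : dom A u -> nrm (G u) ^+ 2 = 2 * Im '[A u, u].
Proof.
move=> Au; have := Gg Au Au; rewrite inner_nrm [in X in _ - X]innerC.
by move=> /(congr1 Im); case: '[A u, u] => p q /=; lra.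
Qed.

Lemma boundary_dissipative u : dom A u -> 0 <= Im '[A u, u].
Proof. by move=> /Im_green; have := sqr_ge0 (nrm (G u)); lra. Qed.

Lemma lower_inj z : Im z < 0 -> forall u, dom A u -> A u - z *: u = 0 -> u = 0.
Proof. exact/dissipative_inj/boundary_dissipative. Qed.

(** By [Im_green], [|G u|^2] is at most [2 |(A - z) u| |u|], and [|u|] is at most
    [|(A - z) u| / |Im z|]. *)
Lemma boundary_bound z u : Im z < 0 -> dom A u ->
  nrm (G u) ^+ 2 * (- Im z) <= 2 * nrm (A u - z *: u) ^+ 2.
Proof.
move=> z0 Au; rewrite Im_green//.
have h1 := dissipative_bound z (boundary_dissipative Au).
have h2 : Im '[A u, u] <= nrm (A u - z *: u) * nrm u.
  apply: le_trans (_ : Im '[A u - z *: u, u] <= _).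
    by rewrite Im_shift lerDl -mulNr mulr_ge0 ?sqr_ge0 ?oppr_ge0 ?ltW.
  exact: le_trans (ler_norm _) (Im_CS _ _).
rewrite -mulrA ler_pM2l//.
apply: le_trans (_ : nrm (A u - z *: u) * nrm u * - Im z <= _).
  by rewrite ler_wpM2r// oppr_ge0 ltW.
by rewrite -mulrA [nrm u * _]mulrC expr2 ler_wpM2l ?nrm_ge0.
Qed.

Lemma boundary_resolvent_bound z : Im z < 0 -> exists c : R, forall u, dom A u ->
  nrm (G u) <= c * nrm (A u - z *: u).
Proof.
move=> z0; exists (Num.sqrt (2 / - Im z)) => u Au.
have z1 : 0 < - Im z by rewrite oppr_gt0.
rewrite -ler_sqr ?nnegrE ?mulr_ge0 ?nrm_ge0 ?sqrtr_ge0//.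
rewrite exprMn sqr_sqrtr; last by rewrite divr_ge0// ltW.
by rewrite mulrAC ler_pdivlMr//; exact: boundary_bound.
Qed.

Lemma gamP z : Im z < 0 -> forall e u, dom A u ->
  '[G u, e] = '[A u - z *: u, gam A G z e].
Proof.
move=> z0; have [c cP] := boundary_resolvent_bound z0.
exact: (resolvent_adjointP Al (Ao z0) (lower_inj z0) Gl cP).
Qed.

(** [C] is the full adjoint of [A]: a dual pair that is onto at conjugate points
    has no room for a larger [C]. *)
Lemma mem_dom_C b t : (forall x, dom A x -> '[A x, b] = '[x, t]) -> dom C b /\ C b = t.
Proof.
apply: (adjoint_pair_maximal (K := setT) (z := 'i%C)) => //.
by apply: Co => /=; exact: ltr01.
by apply: Ao => /=; rewrite oppr_lt0 ltr01.
Qed.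

Lemma G_dense (e : E) : (forall x, dom A x -> '[e, G x] = 0) -> e = 0.
Proof.
move=> eG; apply: inner_eq0; apply: (@orth_closure _ _ (G @` dom A)); last by rewrite Gd.
by move=> _ [x Ax <-]; exact: eG.
Qed.

End boundary_theory.

Section upper_half_plane.
Context (R : realType) (H E Es : hilbertType R) (A C : operator H H).
Context (G : H -> E) (Gs : H -> Es) (BS : boundary_system A C G Gs).
Implicit Types (u v w x y a b : H) (z : R[i]).
Let BS' := boundary_system_swap BS.

Lemma Im_green_star y : dom C y -> nrm (Gs y) ^+ 2 = - (2 * Im '[C y, y]).
Proof. by move=> Cy; have := Im_green BS' (u := y) Cy; rewrite innerNl raddfN/= mulrN. Qed.

Let oppIm z : 0 < Im z -> Im (- z) < 0.
Proof. by case: z => a b /=; rewrite oppr_lt0. Qed.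

Lemma upper_inj z : 0 < Im z -> forall u, dom C u -> C u - z *: u = 0 -> u = 0.
Proof.
move=> /oppIm z0 u Cu uz; apply: (lower_inj BS' z0) => //=.
by rewrite scaleNr -opprD uz oppr0.
Qed.

Lemma boundary_resolvent_bound_star z : 0 < Im z -> exists c : R, forall u, dom C u ->
  nrm (Gs u) <= c * nrm (C u - z *: u).
Proof.
move=> /oppIm z0; have [c cP] := boundary_resolvent_bound BS' z0; exists c => u Cu.
by have := cP u Cu; rewrite /= scaleNr -opprD nrmN.
Qed.

Lemma gamsP z : 0 < Im z -> forall e u, dom C u ->
  '[Gs u, e] = '[C u - z *: u, bounded_adjoint (fun h => Gs (resolvent C z h)) e].
Proof.
move=> z0; have [c cP] := boundary_resolvent_bound_star z0.
have [[_ Cl] _ [_ Co] _ [Gsl _ _]] := BS.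
exact: (resolvent_adjointP Cl (Co _ z0) (upper_inj z0) Gsl cP).
Qed.

Lemma mem_dom_A a t : (forall y, dom C y -> '[C y, a] = '[y, t]) -> dom A a /\ A a = t.
Proof.
move=> aP; have [|Aa aE] := mem_dom_C BS' (b := a) (t := - t).
  by move=> y Cy /=; rewrite innerNl innerNr aP.
by split=> //; apply: oppr_inj.
Qed.

Lemma Gs_dense (e : Es) : (forall y, dom C y -> '[e, Gs y] = 0) -> e = 0.
Proof. exact: (G_dense BS'). Qed.

(** For [p = (C - z)^-1 (A - z) x] one finds
    [|G x|^2 - |Gs p|^2 = 2 Im z |x - p|^2]. *)
Lemma charfun_contractive z x p : 0 < Im z -> dom A x -> dom C p ->
  C p - z *: p = A x - z *: x -> nrm (Gs p) <= nrm (G x).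
Proof.
move=> z0 Ax Cp pE; rewrite -ler_sqr ?nnegrE ?nrm_ge0//.
rewrite (Im_green BS Ax) (Im_green_star Cp).
have [_ AC _ _ _] := BS.
have h1 : '[A x, x] = '[C p, x] - z * '[p, x] + z * '[x, x].
  by rewrite -innerZl -innerZl -innerBl pE innerBl subrK.
have h2 : '[C p, p] = '[A x, p] - z * '[x, p] + z * '[p, p].
  by rewrite -innerZl -innerZl -innerBl -pE innerBl subrK.
have h3 := AC x p Ax Cp; have h4 : '[C p, x] = ('[A x, p])^* by rewrite h3 -innerC.
rewrite h1 h2 h4 !inner_nrm (innerC x p).
have := nrmB2 x p; have := sqr_ge0 (nrm (x - p)).
move: (nrm (x - p) ^+ 2) (nrm x ^+ 2) (nrm p ^+ 2) => d m n.
case: '[A x, p] => q r; case: '[x, p] => s t; case: z z0 {pE h1 h2 h3 h4} => a b /=.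
move=> b0 d0 dE; rewrite -subr_ge0 (_ : _ - _ = 2 * b * d); last by rewrite dE; ring.
by rewrite mulr_ge0// mulr_ge0// ltW.
Qed.

Definition chresolvent z (u : H) := resolvent C z (A u - z *: u).

Lemma chresolventP z u : 0 < Im z ->
  dom C (chresolvent z u) /\ C (chresolvent z u) - z *: chresolvent z u = A u - z *: u.
Proof.
move=> z0; have [[_ Cl] _ [_ Co] _ _] := BS.
exact: (resolventP Cl (Co _ z0) (upper_inj z0)).
Qed.

(** [G u |-> Gs (C - z)^-1 (A - z) u] is a contraction on the dense range of
    [G], hence well defined, and extends. *)
Lemma charfun_spec z (z0 : 0 < Im z) : exists S : E -> Es,
  [/\ linear S, continuous S & forall u, dom A u ->
      S (G u) = Gs (resolvent C z (A u - z *: u))].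
Proof.
have [[Al Cl] _ [_ Co] [Gl Gd _] [Gsl _ _]] := BS.
have [] := @contraction_extension R E Es H (dom A) G (fun u => Gs (chresolvent z u)) Gl.
- split=> [|a u v Au Av|a u v Au Av] /=; [by case: Al|exact: (dom_subspace Al).2|].
  have [du uE] := chresolventP u z0; have [dv vE] := chresolventP v z0.
  have [_ _ /= <-//] := Gsl; congr Gs; rewrite /chresolvent.
  have inj := upper_inj z0; have := resolvent_linear Cl (Co _ z0) inj.
  move=> <-; congr (resolvent C z _); have [_ _ ->//] := Al.
  by rewrite !scalerDr opprD scalerN addrACA !scalerA [z * a]mulrC.
- move=> u Au; have [du uE] := chresolventP u z0.
  exact: (charfun_contractive z0 Au du uE).
- by [].
move=> S [Sl Sb SG]; exists S; split=> //; exact: contraction_continuous.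
Qed.

End upper_half_plane.

(** * The boundary conditions in weak form *)

Section link.
Context (R : realType) (H E Es : hilbertType R) (A C : operator H H).
Context (G : H -> E) (Gs : H -> Es).
Implicit Types (u v w x y a b t : H) (z m l : R[i]) (psi : E) (phi : Es).

(** The weak form of the two boundary conditions of the dilation: [u], [phi],
    [psi] are the middle component and the boundary values of an element of its
    domain, [t] is the middle component of its image. No point of a half-plane
    enters, which is why the dilation does not depend on [mu] and [lambda]. *)
Definition linked u phi psi t :=
  (forall x, dom A x -> '[u, A x] + '[psi, G x] = '[t, x]) /\
  (forall y, dom C y -> '[u, C y] + '[phi, Gs y] = '[t, y]).

Definition charfun_at z (S : E -> Es) := [/\ linear S, continuous S &
  forall u, dom A u -> S (G u) = Gs (resolvent C z (A u - z *: u))].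

(** [gams], with an arbitrary operator [C] in place of the adjoint of [A], so that
    the exchange of the half-planes applies. *)
Definition gamC z : Es -> H := bounded_adjoint (fun h => Gs (resolvent C z h)).

Context (BS : boundary_system A C G Gs).

Let AC u v : dom A u -> dom C v -> '[A u, v] = '[u, C v].
Proof. by case: BS => _ h _ _ _; exact: h. Qed.
Let Ao z : Im z < 0 -> onto setT A z. Proof. by case: BS => _ _ [h _] _ _; exact: h. Qed.
Let Gg u v : dom A u -> dom A v -> '[A u, v] - '[u, A v] = 'i%C * '[G u, G v].
Proof. by case: BS => _ _ _ [_ _ h] _; exact: h. Qed.
Let Gsg u v : dom C u -> dom C v -> '[C u, v] - '[u, C v] = - 'i%C * '[Gs u, Gs v].
Proof. by case: BS => _ _ _ _ [_ _ h]; exact: h. Qed.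

Section charfun.
Context (z : R[i]) (z0 : 0 < Im z) (S : E -> Es) (SP : charfun_at z S).

Let zc0 : Im z^* < 0. Proof. by rewrite conj_Im oppr_lt0. Qed.

(** Contractivity on the range of [G] passes to the closure by continuity. *)
Lemma charfun_bound e : nrm (S e) <= nrm e.
Proof.
have [_ Sc SG] := SP; apply/ler_addgt0Pr => d d0.
have d20 : 0 < d / 2 by rewrite divr_gt0.
have /cvg_ballP/(_ (d / 2)%:C) := Sc e; rewrite ltcR => /(_ d20).
move=> /nbhs_ballP[_ /= /posC_gt0[r r0 ->] rP].
have ce : closure (G @` dom A) e by case: BS => _ _ _ [_ -> _] _.
have /closure_nrmP/(_ (Num.min r (d / 2))) := ce; rewrite lt_min r0 d20 => /(_ isT).
move=> [_ [u Au <-] eu].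
have /rP/ball_nrm Su : ball e r%:C (G u).
  by apply/ball_nrm; apply: lt_le_trans eu _; rewrite ge_min lexx.
rewrite (_ : S e = (S e - S (G u)) + S (G u)); last by rewrite subrK.
apply: le_trans (nrmD _ _) _; rewrite (splitr d) [nrm e + _]addrC -addrA lerD ?(ltW Su)//.
rewrite SG//; have [Cp pE] := chresolventP BS u z0.
apply: le_trans (charfun_contractive BS z0 Au Cp pE) _.
rewrite (_ : G u = e - (e - G u)); last by rewrite opprB addrC subrK.
apply: le_trans (nrmD _ _) _; rewrite nrmN [leRHS]addrC lerD2l.
by apply: le_trans (ltW eu) _; rewrite ge_min lexx orbT.
Qed.

Lemma charfun_adjointP psi phi : '[S psi, phi] = '[psi, bounded_adjoint S phi].
Proof.
have [Sl _ _] := SP.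
apply: (@bounded_adjointP _ _ _ S 1) => [a u v|u]; first exact: Sl.
by rewrite mul1r charfun_bound.
Qed.

Lemma charfun_adjoint_G phi x : dom A x ->
  '[bounded_adjoint S phi, G x] = '[gamC z phi, A x - z *: x].
Proof.
move=> Ax; rewrite innerC -charfun_adjointP; have [_ _ ->//] := SP.
have [Cp pE] := chresolventP BS x z0.
by rewrite (gamsP BS z0)// pE -innerC.
Qed.

(** With [p = (C - z)^-1 (A - z) x], the two Green formulas express
    [<G q, G x>] and [<Gs y, Gs p>] through the same inner products. *)
Lemma charfun_adjoint_Gs y q : dom C y -> dom A q -> A q - z^* *: q = C y - z^* *: y ->
  bounded_adjoint S (Gs y) = G q.
Proof.
move=> Cy Aq qE; apply/eqP; rewrite -subr_eq0; apply/eqP; apply: (G_dense BS) => x Ax.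
have [Cp pE] := chresolventP BS x z0.
rewrite innerBl [X in X - _]innerC -charfun_adjointP; have [_ _ ->//] := SP.
rewrite -/(chresolvent A C z x) in Cp pE *; set p := chresolvent A C z x in Cp pE *.
rewrite -innerC.
apply/eqP; rewrite subr_eq0; apply/eqP.
have i0 : ('i%C : R[i]) != 0 by rewrite eq_complex/= oner_eq0 andbF.
apply: (mulfI i0); rewrite -Gg//; apply: oppr_inj; rewrite -mulNr -Gsg//.
have f1 : '[C y, p] = '[q, A x] - z^* * '[q, x] + z^* * '[y, p].
  have : '[A q - z^* *: q, p] = '[q, A x - z *: x].
    by rewrite -pE innerBl innerBr innerZl innerZr AC.
  by rewrite qE innerBl innerZl innerBr innerZr => <-; rewrite subrK.
have f2 : '[y, C p] = '[y, A x] - z^* * '[y, x] + z^* * '[y, p].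
  have : '[y, C p - z *: p] = '[y, A x - z *: x] by rewrite pE.
  by rewrite !innerBr !innerZr => <-; rewrite subrK.
have f3 : '[A q, x] = '[y, A x] - z^* * '[y, x] + z^* * '[q, x].
  have : '[A q - z^* *: q, x] = '[C y - z^* *: y, x] by rewrite qE.
  rewrite !innerBl !innerZl (_ : '[C y, x] = '[y, A x]) => [<-|]; first by rewrite subrK.
  by rewrite innerC -AC// -innerC.
by rewrite f1 f2 f3; ring.
Qed.

Lemma charfun_Gs psi y : dom C y ->
  '[S psi, Gs y] = '[gam A G z^* psi, C y - z^* *: y].
Proof.
move=> Cy; rewrite charfun_adjointP.
have [q Aq qE] := Ao zc0 (f := C y - z^* *: y) I.
by rewrite (charfun_adjoint_Gs Cy Aq qE) innerC (gamP BS zc0)// qE -innerC.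
Qed.

(** The first boundary condition is what makes the form on the left bounded in
    the norm of [x]: the terms with [A x] and [G x] combine by Green's formula. *)
Lemma lower_form u phi x : dom A (u + gamC z phi) -> dom A x ->
  '[u, A x] + '[bounded_adjoint S phi + 'i%C *: G (u + gamC z phi), G x] =
  '[A (u + gamC z phi) - z^* *: gamC z phi, x].
Proof.
move=> Aa Ax; rewrite [X in _ + X]innerDl charfun_adjoint_G// innerZl -Gg//.
by rewrite !innerBl !innerBr !innerDl !innerZl !innerZr; ring.
Qed.

Lemma upper_form u psi y : dom C (u + gam A G z^* psi) -> dom C y ->
  '[u, C y] + '[S psi - 'i%C *: Gs (u + gam A G z^* psi), Gs y] =
  '[C (u + gam A G z^* psi) - z *: gam A G z^* psi, y].
Proof.
move=> Cb Cy; rewrite -scaleNr [X in _ + X]innerDl charfun_Gs// innerZl -Gsg//.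
rewrite !innerBl !innerBr !innerDl !innerZl !innerZr.
by rewrite [(z^*)^*](conjcK z); ring.
Qed.

(** [phi] enters the second identity through [gamC z phi], tested against
    [(C - z) y]; so the identity says that [a = u + gamC z phi] lies in the domain
    of the adjoint of [C], which is [A]. *)
Lemma linked_lower u phi psi t : linked u phi psi t ->
  [/\ dom A (u + gamC z phi), A (u + gamC z phi) = t + z^* *: gamC z phi &
      psi = bounded_adjoint S phi + 'i%C *: G (u + gamC z phi)].
Proof.
move=> [ux uy]; have [|Aa aE] := mem_dom_A BS (a := u + gamC z phi) (t := t + z^* *: gamC z phi).
  move=> y Cy; have := uy y Cy.
  have := gamsP BS z0 phi Cy; rewrite -/(gamC z phi) => g.
  have -> : '[phi, Gs y] = '[gamC z phi, C y - z *: y] by rewrite innerC g -innerC.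
  move=> h; rewrite innerC [in RHS]innerC; congr (_^*).
  by rewrite !innerDl innerZl -h innerBr innerZr; ring.
split=> //; apply/eqP; rewrite -subr_eq0; apply/eqP; apply: (G_dense BS) => x Ax.
have := lower_form Aa Ax; rewrite aE addrK -(ux x Ax) => /addrI.
by rewrite innerBl => ->; rewrite subrr.
Qed.

Lemma linked_upper u phi psi t : linked u phi psi t ->
  [/\ dom C (u + gam A G z^* psi),
      C (u + gam A G z^* psi) = t + z *: gam A G z^* psi &
      phi = S psi - 'i%C *: Gs (u + gam A G z^* psi)].
Proof.
move=> [ux uy]; set g := gam A G z^* psi.
have [|Cb bE] := mem_dom_C BS (b := u + g) (t := t + z *: g).
  move=> x Ax; have := ux x Ax.
  have gE := gamP BS zc0 psi Ax.
  have -> : '[psi, G x] = '[g, A x - z^* *: x] by rewrite innerC gE -innerC.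
  move=> h; rewrite innerC [in RHS]innerC; congr (_^*).
  by rewrite !innerDl innerZl -h innerBr innerZr [(z^*)^*](conjcK z); ring.
split=> //; apply/eqP; rewrite -subr_eq0; apply/eqP; apply: (Gs_dense BS) => y Cy.
have := upper_form Cb Cy; rewrite bE addrK -(uy y Cy) => /addrI.
by move=> h; rewrite innerBl h subrr.
Qed.

End charfun.

(** From right to left, take [t = A a - z^* gamC z phi] with
    [a = u + gamC z phi]: the first boundary condition is the first half of
    [linked], which determines [C b] for [b = u + gam z'^* psi]; then the second
    boundary condition is the second half. *)
Lemma linkedP z z' S S' u phi psi : 0 < Im z -> 0 < Im z' ->
  charfun_at z S -> charfun_at z' S' ->
  (exists t, linked u phi psi t) <->
  [/\ dom A (u + gamC z phi), dom C (u + gam A G z'^* psi) &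
      psi = bounded_adjoint S phi + 'i%C *: G (u + gamC z phi) /\
      phi = S' psi - 'i%C *: Gs (u + gam A G z'^* psi)].
Proof.
move=> z0 z0' SP SP'; split=> [[t ut]|[Aa Cb [psiE phiE]]].
  have [Aa _ psiE] := linked_lower z0 SP ut.
  by have [Cb _ phiE] := linked_upper z0' SP' ut.
pose t := A (u + gamC z phi) - z^* *: gamC z phi.
have ux x : dom A x -> '[u, A x] + '[psi, G x] = '[t, x].
  by move=> Ax; rewrite psiE (lower_form z0 SP).
clearbody t; exists t; split=> // y Cy; set g := gam A G z'^* psi in Cb phiE *.
have zc0 : Im z'^* < 0 by rewrite conj_Im oppr_lt0.
have [|_ bE] := mem_dom_C BS (b := u + g) (t := t + z' *: g).
  move=> x Ax; have := ux x Ax.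
  have -> : '[psi, G x] = '[g, A x - z'^* *: x].
    by rewrite innerC (gamP BS zc0)// -innerC.
  move=> h; rewrite innerC [in RHS]innerC; congr (_^*).
  by rewrite !innerDl innerZl -h innerBr innerZr [(z'^*)^*](conjcK z'); ring.
by rewrite phiE (upper_form z0' SP')// bE addrK.
Qed.

Let i0 : 0 < Im ('i%C : R[i]). Proof. by rewrite /= ltr01. Qed.
Let mulii : 'i%C * 'i%C = -1 :> R[i]. Proof. by apply: complex_eq => /=; ring. Qed.

(** Test the first identity for [u] with [a' = u' + g'], and pair [Gs b],
    [b = u + g], with [phi'], both at the point [i]; the two boundary conditions
    and the adjoint of the characteristic function turn the result into boundary
    terms. *)
Lemma linked_green u phi psi t u' phi' psi' t' :
  linked u phi psi t -> linked u' phi' psi' t' ->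
  '[t, u'] - '[u, t'] = 'i%C * '[psi, psi'] - 'i%C * '[phi, phi'].
Proof.
move=> ut ut'; have [S SP] := charfun_spec BS i0.
have [Aa' aE' psiE'] := linked_lower i0 SP ut'.
have [Cb bE phiE] := linked_upper i0 SP ut.
set g' := gamC 'i%C phi' in Aa' aE' psiE'; set g := gam A G _ psi in Cb bE phiE.
have h1 := ut.1 _ Aa'.
have h2 := gamsP BS i0 phi' Cb; rewrite -/(gamC 'i%C phi') -/g' in h2.
have h3 := charfun_adjointP i0 SP psi phi'.
have e1 : '[psi, G (u' + g')] = 'i%C * '[psi, psi'] - 'i%C * '[psi, bounded_adjoint S phi'].
  rewrite [in RHS]psiE' innerDr innerZr; rewrite mulrDr addrAC subrr add0r mulrA.
  by rewrite (_ : 'i%C * _ = 1) ?mul1r//; apply: complex_eq => /=; ring.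
have e2 : '[Gs (u + g), phi'] = 'i%C * '[phi, phi'] - 'i%C * '[S psi, phi'].
  rewrite [in RHS]phiE innerBl innerZl mulrBr addrAC subrr sub0r mulrA mulii.
  by rewrite mulN1r opprK.
have -> : 'i%C * '[psi, psi'] - 'i%C * '[phi, phi'] = '[psi, G (u' + g')] - '[Gs (u + g), phi'].
  by rewrite e1 e2 h3; ring.
rewrite h2 bE (_ : '[psi, _] = '[t, u' + g'] - '[u, A (u' + g')]); last first.
  by rewrite -h1 addrAC subrr add0r.
rewrite aE' !innerDr !innerBl !innerDl !innerZl !innerZr.
by rewrite !innerDl (_ : ('i%C^*)^* = 'i%C :> R[i]); [ring|exact: conjcK].
Qed.

(** In the lower half-plane the incoming value [phi] may be prescribed: [a] must
    be [(A - z)^-1 f], then [u = a - gamC z^* phi]; the first boundary condition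
    gives [psi]. *)
Lemma linked_onto_lower z phi f : Im z < 0 ->
  exists u psi, linked u phi psi (f + z *: u).
Proof.
move=> z0; have zc0 : 0 < Im z^* by rewrite conj_Im oppr_gt0.
have [S SP] := charfun_spec BS zc0.
have [w Aw wE] := Ao z0 (f := f) I.
pose u := w - gamC z^* phi; have uw : u + gamC z^* phi = w by rewrite subrK.
exists u, (bounded_adjoint S phi + 'i%C *: G w).
have tE : A w - (z^*)^* *: gamC z^* phi = f + z *: u.
  rewrite [(z^*)^*](conjcK z) /u scalerBr -wE.
  by rewrite addrA subrK.
split=> [x Ax|y Cy].
  by have := lower_form zc0 SP (u := u) (phi := phi) (x := x); rewrite uw tE; exact.
have -> : '[phi, Gs y] = '[gamC z^* phi, C y - z^* *: y].
  by rewrite innerC (gamsP BS zc0)// -innerC.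
rewrite -tE /u !innerBl innerBr innerZr innerZl AC//.
by ring.
Qed.

End link.

Lemma linked_onto_upper (R : realType) (H E Es : hilbertType R) (A C : operator H H)
    (G : H -> E) (Gs : H -> Es) (BS : boundary_system A C G Gs)
    (z : R[i]) (psi : E) (f : H) : 0 < Im z ->
  exists u phi, linked A C G Gs u phi psi (f + z *: u).
Proof.
move=> z0; have [|u [phi [ux uy]]] :=
  linked_onto_lower (boundary_system_swap BS) psi f (z := - z).
  by case: z z0 => a b /=; rewrite oppr_lt0.
exists (- u), phi; rewrite scalerN -scaleNr; split=> [x Ax|y Cy].
  by have := uy x Ax; rewrite /= innerNr innerNl.
by have := ux y Cy; rewrite /= innerNr innerNl.
Qed.

(** * Reducing subspaces and the selfadjoint part *)

Section reducing_subspaces.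
Context (R : realType) (H : hilbertType R).
Implicit Types (K W S : set H) (B M : operator H H) (u v w : H) (z : R[i]).

(** If the resolvent at one point preserves [W] and its complement, then the
    components of [(B - z) h] are solved for separately, and by injectivity the
    solutions are the components of [h]. *)
Lemma invariant_of_resolvent K0 B W z : closed_subspace K0 -> closed_subspace W ->
  W `<=` K0 -> linear_op B -> dom B `<=` K0 -> (forall u, dom B u -> K0 (B u)) ->
  onto K0 B z -> (forall u, dom B u -> B u - z *: u = 0 -> u = 0) ->
  (forall u, dom B u -> W (B u - z *: u) -> W u) ->
  (forall u, dom B u -> orth_in K0 W (B u - z *: u) -> orth_in K0 W u) ->
  invariant_for B W /\ invariant_for B (orth_in K0 W).
Proof.
move=> K0c Wc WK Bl BK KB Bo Bi W1 W2.
have K0s := closed_subspaceW K0c; have Ws := closed_subspaceW Wc.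
have Oc := closed_subspace_orth W K0c; have Os := closed_subspaceW Oc.
have key h : dom B h -> exists u1 u2, [/\ dom B u1, W u1, W (B u1) &
    [/\ dom B u2, orth_in K0 W u2, orth_in K0 W (B u2) & h = u1 + u2]].
  move=> Bh; pose f := B h - z *: h.
  have Kf : K0 f by apply: (subspaceB K0s); [exact: KB|exact/(subspaceZ _ K0s)/BK].
  have [Wp _] := orth_projP f Wc; have Op := orth_proj_rest Wc K0s WK Kf.
  have [u1 Bu1 u1E] := Bo _ (WK _ Wp); have [u2 Bu2 u2E] := Bo _ Op.1.
  have Wu1 : W u1 by apply: W1; rewrite ?u1E.
  have Ou2 : orth_in K0 W u2 by apply: W2; rewrite ?u2E.
  exists u1, u2; split=> //.
    by rewrite -(subrK (z *: u1) (B u1)) u1E; apply: (subspaceD Ws) => //; exact: subspaceZ.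
  split=> //.
    by rewrite -(subrK (z *: u2) (B u2)) u2E; apply: (subspaceD Os) => //; exact: subspaceZ.
  apply: (injective_of_bound Bl Bi) => //; first exact: (subspaceD (dom_subspace Bl)).
  rewrite linear_opD// scalerDr opprD addrACA u1E u2E addrC subrK.
  by [].
split=> h Bh; have [u1 [u2 [Bu1 Wu1 WBu1 [Bu2 Ou2 OBu2 hE]]]] := key h Bh.
  rewrite (_ : orth_proj W h = u1)//; apply: orth_proj_unique => // l Wl.
  by rewrite hE addrC addKr; exact: Ou2.2.
rewrite (_ : orth_proj _ h = u2)//; apply: orth_proj_unique => // l [_ lW].
by rewrite hE addrK innerC lW// conjC0.
Qed.

Lemma reducing_split K0 B W u : closed_subspace K0 -> dom B `<=` K0 -> reducing K0 B W ->
  dom B u -> [/\ dom B (orth_proj W u), W (B (orth_proj W u)),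
    dom B (u - orth_proj W u), orth_in K0 W (B (u - orth_proj W u)) &
    W (orth_proj W u) /\ orth_in K0 W (u - orth_proj W u)].
Proof.
move=> K0c BK [Wc WK W1 W2] Bu; have K0s := closed_subspaceW K0c.
have [Bp Wp] := W1 u Bu; have := W2 u Bu.
rewrite (orth_proj_orth Wc K0s WK (BK _ Bu)) => -[Bq Wq]; split=> //.
split; first by case: (orth_projP u Wc).
by apply: orth_proj_rest => //; exact: BK.
Qed.

Lemma orth_in_self K0 W u : W u -> orth_in K0 W u -> u = 0.
Proof. by move=> Wu [_ /(_ _ Wu)/inner_eq0]. Qed.

Lemma reducing_resolvent K0 B W z : closed_subspace K0 -> linear_op B ->
  dom B `<=` K0 -> (forall u, dom B u -> B u - z *: u = 0 -> u = 0) ->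
  reducing K0 B W ->
  (forall u, dom B u -> W (B u - z *: u) -> W u) /\
  (forall u, dom B u -> orth_in K0 W (B u - z *: u) -> orth_in K0 W u).
Proof.
move=> K0c Bl BK Bi Wr; have [Wc WK _ _] := Wr.
have Ws := closed_subspaceW Wc.
have Os := closed_subspaceW (closed_subspace_orth W K0c).
split=> u Bu; have [Bp Wp Bq Wq [Wpu Wqu]] := reducing_split K0c BK Wr Bu.
all: have uE : u = orth_proj W u + (u - orth_proj W u) by rewrite addrC subrK.
all: move: (orth_proj W u) (u - orth_proj W u) uE Bp Wp Bq Wq Wpu Wqu.
all: move=> p q -> Bp Wp Bq Wq Wpu Wqu.
all: rewrite linear_opD// scalerDr opprD addrACA => Wf.
- suff -> : q = 0 by rewrite addr0.
  apply: Bi => //; apply: (orth_in_self (K0 := K0) (W := W)); last first.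
    by apply: (subspaceB Os) => //; exact: subspaceZ.
  rewrite -(addKr (B p - z *: p) (B q - _)) addrC; apply: (subspaceB Ws) => //.
  by apply: (subspaceB Ws) => //; exact: subspaceZ.
- suff -> : p = 0 by rewrite add0r.
  apply: Bi => //; apply: (orth_in_self (K0 := K0) (W := W)).
    by apply: (subspaceB Ws) => //; exact: subspaceZ.
  rewrite -(addrK (B q - z *: q) (B p - _)); apply: (subspaceB Os) => //.
  by apply: (subspaceB Os) => //; exact: subspaceZ.
Qed.

Lemma reducing_orth K0 B W : closed_subspace K0 -> reducing K0 B W ->
  reducing K0 B (orth_in K0 W).
Proof.
move=> K0c [Wc WK W1 W2]; split=> //; first exact: closed_subspace_orth.
  by move=> ? [].
by rewrite orth_in_orth_in//; exact: closed_subspaceW.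
Qed.

Lemma lspan_subspace S : subspace (lspan S).
Proof.
split.
  by exists 0%N, (fun=> 0), (fun=> 0); split=> [[]//|]; rewrite big_ord0.
move=> c _ _ [m [a [u [Su ->]]]] [n [b [v [Sv ->]]]].
exists (m + n)%N, (fun i => match fintype.split i with inl i => c * a i | inr i => b i end).
exists (fun i => match fintype.split i with inl i => u i | inr i => v i end); split.
  by move=> i; case: fintype.split.
rewrite big_split_ord/= scaler_sumr; congr (_ + _); apply: eq_bigr => i _.
  by rewrite scalerA; case: split_ordP => j /eqP; rewrite ?eq_lshift ?eq_lrshift// => /eqP <-.
by case: split_ordP => j /eqP; rewrite ?eq_rshift ?eq_rlshift// => /eqP <-.
Qed.

Lemma sub_lspan S : S `<=` lspan S.
Proof.
by move=> s Ss; exists 1%N, (fun=> 1), (fun=> s); rewrite big_ord1 scale1r.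
Qed.

Lemma lspan_min S W : subspace W -> S `<=` W -> lspan S `<=` W.
Proof.
move=> Ws SW _ [n [a [v [Sv ->]]]].
elim/big_ind: _ => [||i _]; [exact: Ws.1|by move=> x y; exact: subspaceD|].
by apply: subspaceZ => //; exact: SW.
Qed.

Lemma orth_lspan S w : (forall s, S s -> '[w, s] = 0) -> forall x, lspan S x -> '[w, x] = 0.
Proof.
move=> Sw; apply: (@lspan_min S [set x | '[w, x] = 0]) => //.
split=> [|a u v /= wu wv] /=; first exact: inner0r.
by rewrite innerDr innerZr wu wv mulr0 addr0.
Qed.

End reducing_subspaces.

Section null_part.
Context (R : realType) (H E Es : hilbertType R).
Implicit Types (u v w x y g : H) (z : R[i]).

(** The part of [H] that the boundary operators do not see through the
    resolvents; it will turn out to be the complement of [Hcns]. *)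
Definition null_part (A C : operator H H) (G : H -> E) (Gs : H -> Es) : set H :=
  [set g | (forall z u, Im z < 0 -> dom A u -> A u - z *: u = g -> G u = 0) /\
           (forall z u, 0 < Im z -> dom C u -> C u - z *: u = g -> Gs u = 0)].

End null_part.

Section null_part_theory.
Context (R : realType) (H E Es : hilbertType R) (A C : operator H H).
Context (G : H -> E) (Gs : H -> Es) (BS : boundary_system A C G Gs).
Implicit Types (u v w x y g : H) (z : R[i]).
Local Notation N := (null_part A C G Gs).

Let Al : linear_op A. Proof. by case: BS => -[]. Qed.
Let Cl : linear_op C. Proof. by case: BS => -[]. Qed.
Let Ao z : Im z < 0 -> onto setT A z. Proof. by case: BS => _ _ [h _] _ _; exact: h. Qed.
Let Co z : 0 < Im z -> onto setT C z. Proof. by case: BS => _ _ [_ h] _ _; exact: h. Qed.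
Let Gl : linear_op (Operator (dom A) G). Proof. by case: BS => _ _ _ []. Qed.
Let Gsl : linear_op (Operator (dom C) Gs). Proof. by case: BS => _ _ _ _ []. Qed.
Let Gg u v : dom A u -> dom A v -> '[A u, v] - '[u, A v] = 'i%C * '[G u, G v].
Proof. by case: BS => _ _ _ [_ _ h] _; exact: h. Qed.

(** With [G u = 0], Green's formula makes [u] an element of the domain of the
    adjoint, on which [|Gs u|^2 = - 2 Im <A u, u> = 0]. *)
Lemma null_boundary u : dom A u -> G u = 0 -> [/\ dom C u, C u = A u & Gs u = 0].
Proof.
move=> Au Gu; have [|Cu CE] := mem_dom_C BS (b := u) (t := A u).
  move=> x Ax; apply/eqP; rewrite -subr_eq0; apply/eqP.
  by rewrite Gg// Gu inner0r mulr0.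
split=> //; apply/nrm0_eq0/eqP; rewrite -sqrf_eq0 (Im_green_star BS Cu) CE.
by rewrite -(Im_green BS Au) Gu nrm0 expr0n oppr0.
Qed.

Lemma scale_shift_eq (B : operator H H) z z' u g : B u - z *: u = g ->
  B u - z' *: u = g + (z - z') *: u.
Proof. by move=> <-; rewrite scalerBl addrA subrK. Qed.

(** By the resolvent identity, [(A - z')^-1 u] is a multiple of the difference of
    [u] and [(A - z')^-1 g], on both of which [G] vanishes; [z' = z] follows by
    approximation. Since [G u = 0], the vector [u] is also in the domain of [C],
    and the same identity holds in the upper half-plane. *)
Lemma null_part_resolvent z u : Im z < 0 -> dom A u -> N (A u - z *: u) -> N u.
Proof.
move=> z0 Au; set g := _ - _ => -[N1 N2].
have Gu : G u = 0 by exact: (N1 z).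
have [Cu CE Gsu] := null_boundary Au Gu.
have case1 z' w : Im z' < 0 -> z' != z -> dom A w -> A w - z' *: w = u -> G w = 0.
  move=> z0' zz' Aw wE; have [v Av vE] := Ao z0' (f := g) I.
  have Gv : G v = 0 by exact: (N1 z').
  have n0 : z - z' != 0 by rewrite subr_eq0 eq_sym.
  have uvw : u - v = (z - z') *: w.
    apply: (injective_of_bound Al (lower_inj BS z0')).
    - exact: subspaceB (dom_subspace Al) Au Av.
    - exact: subspaceZ (dom_subspace Al) Aw.
    rewrite shiftB// vE (scale_shift_eq _ (erefl g)) addrC addKr.
    by rewrite linear_opZ// scalerA mulrC -scalerA -scalerBr wE.
  have := linear_opB Gl Au Av; rewrite uvw (linear_opZ _ Gl Aw) /= Gu Gv subrr.
  by move/eqP; rewrite scaler_eq0 (negbTE n0) => /eqP.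
split=> z' w z0' dw wE; last first.
  have [v Cv vE] := Co z0' (f := g) I.
  have Gv : Gs v = 0 by exact: (N2 z').
  have n0 : z - z' != 0.
    rewrite subr_eq0; apply: contraTneq z0 => ->.
    by rewrite -leNgt ltW.
  have uvw : u - v = (z - z') *: w.
    apply: (injective_of_bound Cl (upper_inj BS z0')).
    - exact: subspaceB (dom_subspace Cl) Cu Cv.
    - exact: subspaceZ (dom_subspace Cl) dw.
    rewrite shiftB// vE CE (scale_shift_eq _ (erefl g)) addrC addKr.
    by rewrite linear_opZ// scalerA mulrC -scalerA -scalerBr wE.
  have := linear_opB Gsl Cu Cv; rewrite uvw (linear_opZ _ Gsl dw) /= Gsu Gv subrr.
  by move/eqP; rewrite scaler_eq0 (negbTE n0) => /eqP.
(* at [z' = z], approach [z] by [z - i e] *)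
have [zz|zz] := eqVneq z' z; last exact: (case1 z').
rewrite zz {z' z0' zz} in wE.
have le (e : R) : 0 < e -> nrm (G w) ^+ 2 <= e * (2 * nrm w ^+ 2).
  move=> e0; pose z' := z - (0 +i* e).
  have zE : z - z' = 0 +i* e by rewrite opprB addrC subrK.
  have Iz' : Im z' = Im z - e by rewrite /z'; move: (z) => [? ?].
  have z0' : Im z' < 0 by rewrite Iz'; lra.
  have zz' : z' != z.
    by apply: contraTneq e0 => zz; move: zE; rewrite zz subrr => -[<-]; rewrite ltxx.
  have [w' Aw' wE'] := Ao z0' (f := u) I.
  have Gw' := case1 z' w' z0' zz' Aw' wE'.
  have := boundary_bound BS z0' (subspaceB (dom_subspace Al) dw Aw').
  rewrite shiftB// wE' (scale_shift_eq _ wE) addrAC subrr add0r zE.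
  have /= -> := linear_opB Gl dw Aw'; rewrite Gw' subr0 nrmZ exprMn.
  have -> : Re `|0 +i* e| = e.
    by rewrite normc_def/= expr0n add0r sqrtr_sqr ger0_norm// ltW.
  have := sqr_ge0 (nrm (G w)); move: (nrm (G w) ^+ 2) (nrm w ^+ 2) => n m n0.
  rewrite Iz' opprB mulrBr => h.
  have : n * e <= 2 * (e ^+ 2 * m).
    by apply: le_trans h; rewrite lerBrDr -lerBrDl subrr nmulr_lle0.
  by rewrite [2 * _]mulrCA expr2 -!mulrA mulrC ler_pM2l// mulrC.
apply/nrm0_eq0/eqP; rewrite -sqrf_eq0 eq_le sqr_ge0 andbT.
have m1 : 0 < 2 * nrm w ^+ 2 + 1 by rewrite ltr_wpDl// mulr_ge0 ?sqr_ge0.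
apply/ler_addgt0Pr => e e0; rewrite add0r.
apply: le_trans (le (e / (2 * nrm w ^+ 2 + 1)) _) _; first by rewrite divr_gt0.
by rewrite mulrAC ler_pdivrMr// ler_pM2l// lerDl.
Qed.

(** [G (A - z)^-1 g] is then independent of [z], and it tends to [0] as
    [Im z -> -oo]. *)
Lemma constant_boundary g :
  (forall z u, Im z < 0 -> dom A u -> A u - z *: u = g ->
     exists w, [/\ dom A w, A w - (- 'i%C) *: w = u & G w = 0]) ->
  forall z u, Im z < 0 -> dom A u -> A u - z *: u = g -> G u = 0.
Proof.
move=> h; have i0 : Im (- 'i%C : R[i]) < 0 by rewrite /= oppr_lt0 ltr01.
have [w0 Aw0 w0E] := Ao i0 (f := g) I.
have cst z u : Im z < 0 -> dom A u -> A u - z *: u = g -> G u = G w0.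
  move=> z0 Au uE; have [w [Aw wE Gw]] := h z u z0 Au uE.
  have uw : u - w0 = (z - - 'i%C) *: w.
    apply: (injective_of_bound Al (lower_inj BS i0)).
    - exact: subspaceB (dom_subspace Al) Au Aw0.
    - exact: subspaceZ (dom_subspace Al) Aw.
    rewrite shiftB// w0E (scale_shift_eq _ uE) addrC addKr.
    by rewrite linear_opZ// scalerA [_ * (z - _)]mulrC -scalerA -scalerBr wE.
  have := linear_opB Gl Au Aw0; rewrite uw (linear_opZ _ Gl Aw) /= Gw scaler0.
  by move=> /esym/eqP; rewrite subr_eq0 => /eqP.
suff G0 : G w0 = 0 by move=> z u z0 Au uE; rewrite (cst z).
have le (t : R) : 0 < t -> nrm (G w0) ^+ 2 * t <= 2 * nrm g ^+ 2.
  move=> t0; pose z : R[i] := 0 +i* (- t).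
  have z0 : Im z < 0 by rewrite /= oppr_lt0.
  have [u Au uE] := Ao z0 (f := g) I.
  by have := boundary_bound BS z0 Au; rewrite uE (cst z)//= opprK.
apply/nrm0_eq0/eqP; rewrite -sqrf_eq0 eq_le sqr_ge0 andbT.
apply/ler_addgt0Pr => e e0; rewrite add0r.
have m1 : 0 < 2 * nrm g ^+ 2 + 1 by rewrite ltr_wpDl// mulr_ge0 ?sqr_ge0.
have := le ((2 * nrm g ^+ 2 + 1) / e) ltac:(by rewrite divr_gt0).
rewrite mulrA ler_pdivrMr// mulrC => h1.
rewrite -(ler_pM2l m1); apply: le_trans h1 _.
by rewrite ler_pM2r// lerDl.
Qed.

End null_part_theory.

Section null_part_star.
Context (R : realType) (H E Es : hilbertType R) (A C : operator H H).
Context (G : H -> E) (Gs : H -> Es) (BS : boundary_system A C G Gs).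
Implicit Types (u v w x y g : H) (z : R[i]).
Local Notation N := (null_part A C G Gs).

Lemma linear_opN (F : hilbertType R) (B : operator H F) u : linear_op B -> dom B u ->
  dom B (- u) /\ B (- u) = - B u.
Proof.
move=> Bl Bu; rewrite -[- u]scaleN1r -[- B u]scaleN1r; split; first exact: subspaceZ (dom_subspace Bl) Bu.
exact: linear_opZ.
Qed.

Let oppIm z : 0 < Im z -> Im (- z) < 0.
Proof. by case: z => a b /=; rewrite oppr_lt0. Qed.
Let oppIm' z : Im z < 0 -> 0 < Im (- z).
Proof. by case: z => a b /=; rewrite oppr_gt0. Qed.

(** The exchange of the half-planes preserves the null part, so that
    [null_part_resolvent] and [constant_boundary] have counterparts for [C]. *)
Lemma null_part_swap : null_part (opN C) (opN A) Gs G = N.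
Proof.
have [[Al Cl] _ _ [Gl _ _] [Gsl _ _]] := BS.
have shiftN (B : operator H H) z u : linear_op B -> dom B u ->
    B (- u) - (- z) *: (- u) = - B u - z *: u.
  by move=> Bl Bu; rewrite (linear_opN Bl Bu).2 scalerN scaleNr opprK.
have shiftN' (B : operator H H) z u : linear_op B -> dom B u ->
    - B (- u) - (- z) *: (- u) = B u - z *: u.
  by move=> Bl Bu; rewrite (linear_opN Bl Bu).2 scalerN scaleNr !opprK.
have oppQ (F : hilbertType R) (D : set H) (Q : H -> F) u :
    linear_op (Operator D Q) -> D u -> Q (- u) = 0 -> Q u = 0.
  move=> Ql Du Qu; have /= [_] := linear_opN Ql Du; rewrite Qu.
  by move=> /esym/eqP; rewrite oppr_eq0 => /eqP.
apply/seteqP; split=> g [N1 N2]; split=> z u z0 du uE.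
- apply: (oppQ _ _ _ _ Gl du); apply: (N2 (- z)); rewrite ?oppIm'//=.
    exact: (linear_opN Al du).1.
  by rewrite shiftN'.
- apply: (oppQ _ _ _ _ Gsl du); apply: (N1 (- z)); rewrite ?oppIm//=.
    exact: (linear_opN Cl du).1.
  by rewrite shiftN'.
- apply: (oppQ _ _ _ _ Gsl du); apply: (N2 (- z)); rewrite ?oppIm'//=.
    exact: (linear_opN Cl du).1.
  by rewrite shiftN.
- apply: (oppQ _ _ _ _ Gl du); apply: (N1 (- z)); rewrite ?oppIm//=.
    exact: (linear_opN Al du).1.
  by rewrite shiftN.
Qed.

Lemma null_part_resolvent_star z u : 0 < Im z -> dom C u -> N (C u - z *: u) -> N u.
Proof.
move=> z0 Cu Ng; rewrite -null_part_swap.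
apply: (null_part_resolvent (boundary_system_swap BS) (oppIm z0)) => //=.
rewrite null_part_swap scaleNr opprK addrC -opprB.
case: Ng => N1 N2; split=> z' w z0' dw wE.
  have [[Al _] _ _ [Gl _ _] _] := BS; have [dN GN] := linear_opN Gl dw.
  apply/eqP; rewrite -oppr_eq0 -[- _]GN; apply/eqP; apply: (N1 z') => //.
  by rewrite (linear_opN Al dw).2 scalerN -opprD wE opprK.
have [[_ Cl] _ _ _ [Gsl _ _]] := BS; have [dN GN] := linear_opN Gsl dw.
apply/eqP; rewrite -oppr_eq0 -[- _]GN; apply/eqP; apply: (N2 z') => //.
by rewrite (linear_opN Cl dw).2 scalerN -opprD wE opprK.
Qed.

Lemma null_boundary_star y : dom C y -> Gs y = 0 -> [/\ dom A y, A y = C y & G y = 0].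
Proof.
move=> Cy Gy; have [Ay AE Gz] := null_boundary (boundary_system_swap BS) (u := y) Cy Gy.
by split=> //; exact: oppr_inj.
Qed.

Lemma constant_boundary_star g :
  (forall z u, 0 < Im z -> dom C u -> C u - z *: u = g ->
     exists w, [/\ dom C w, C w - 'i%C *: w = u & Gs w = 0]) ->
  forall z u, 0 < Im z -> dom C u -> C u - z *: u = g -> Gs u = 0.
Proof.
move=> h z u z0 Cu uE; have [[_ Cl] _ _ _ [Gsl _ _]] := BS.
have [CNu GNu] := linear_opN Gsl Cu; rewrite /= in CNu GNu.
suff : Gs (- u) = 0 by move/eqP; rewrite GNu oppr_eq0 => /eqP.
apply: (constant_boundary (boundary_system_swap BS) (g := g) _ (oppIm z0)) => //=.
  move=> z' u' z0' Cu' uE'; have [CN CNE] := linear_opN Cl Cu'.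
  have [|w [Cw wE Gw]] := h (- z') (- u') (oppIm' z0') CN.
    by rewrite CNE scaleNr scalerN opprK.
  exists w; split=> //=; rewrite scaleNr opprK addrC -opprB.
  by rewrite wE opprK.
by rewrite (linear_opN Cl Cu).2 scalerN scaleNr !opprK.
Qed.

End null_part_star.

Section selfadjoint_part.
Context (R : realType) (H E Es : hilbertType R) (A : operator H H).
Context (G : H -> E) (Gs : H -> Es).
Local Notation C := (adjoint setT A).
Context (BS : boundary_system A C G Gs).
Implicit Types (u v w x y g : H) (z : R[i]) (K : set H).
Local Notation N := (null_part A C G Gs).
Local Notation Hc := (Hcns A G Gs).
Local Notation Hs := (orth_in setT Hc).

Let Al : linear_op A. Proof. by case: BS => -[]. Qed.
Let Cl : linear_op C. Proof. by case: BS => -[]. Qed.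
Let AC u v : dom A u -> dom C v -> '[A u, v] = '[u, C v].
Proof. by case: BS => _ h _ _ _; exact: h. Qed.
Let Ao z : Im z < 0 -> onto setT A z. Proof. by case: BS => _ _ [h _] _ _; exact: h. Qed.
Let Co z : 0 < Im z -> onto setT C z. Proof. by case: BS => _ _ [_ h] _ _; exact: h. Qed.
Let Gg u v : dom A u -> dom A v -> '[A u, v] - '[u, A v] = 'i%C * '[G u, G v].
Proof. by case: BS => _ _ _ [_ _ h] _; exact: h. Qed.
Let i0 : 0 < Im ('i%C : R[i]). Proof. by rewrite /= ltr01. Qed.
Let Ni0 : Im (- 'i%C : R[i]) < 0. Proof. by rewrite /= oppr_lt0 ltr01. Qed.
Let AP z u : Im z < 0 -> dom A (resolvent A z u) /\
  A (resolvent A z u) - z *: resolvent A z u = u.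
Proof. by move=> z0; exact: (resolventP Al (Ao z0) (lower_inj BS z0)). Qed.
Let CP z u : 0 < Im z -> dom C (resolvent C z u) /\
  C (resolvent C z u) - z *: resolvent C z u = u.
Proof. by move=> z0; exact: (resolventP Cl (Co z0) (upper_inj BS z0)). Qed.

Let shift_pair z u y : dom A u -> dom C y -> '[A u - z *: u, y] = '[u, C y - z^* *: y].
Proof.
by move=> Au Cy; rewrite innerBl innerBr innerZl innerZr AC// [(z^*)^*](conjcK z).
Qed.

Let orth_generators v :
  (forall r, (range (gam A G (- 'i%C)) `|` range (gams A Gs 'i%C)) r -> '[v, r] = 0) <->
  G (resolvent A (- 'i%C) v) = 0 /\ Gs (resolvent C 'i%C v) = 0.
Proof.
have [Ax xE] := AP v Ni0; have [Cy yE] := CP v i0.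
have ge e : '[v, gam A G (- 'i%C) e] = '[G (resolvent A (- 'i%C) v), e].
  by rewrite (gamP BS Ni0)// xE.
have gse e : '[v, gams A Gs 'i%C e] = '[Gs (resolvent C 'i%C v), e].
  by rewrite (gamsP BS i0)// yE.
split=> [h|[h1 h2] r [[e _ <-]|[e _ <-]]].
- split; apply: inner_eq0; rewrite -?ge -?gse; apply: h; first by left.
  by right.
- by rewrite ge h1 inner0l.
- by rewrite gse h2 inner0l.
Qed.

(** Orthogonality of [g] to [(A - m)^-1 R] is orthogonality of
    [(C - m^* )^-1 g] to [R], that is, vanishing of [Gs (C - i)^-1] and
    [G (A + i)^-1] on it. By the resolvent identity this makes
    [Gs (C - z)^-1 g] independent of [z], hence zero by [constant_boundary_star];
    likewise with [A] and [C] exchanged. Conversely the null part is preserved by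
    the resolvents. *)
Lemma orth_Hcns : Hs = N.
Proof.
rewrite orth_in_closure; apply/seteqP; split=> g.
- move=> [_ gP].
  have gA m r : Im m < 0 -> (range (gam A G (- 'i%C)) `|` range (gams A Gs 'i%C)) r ->
      '[g, resolvent A m r] = 0.
    move=> m0 Rr; apply: gP; exists (resolvent A m r).
      by apply: sub_lspan; exists m => //; exists r.
    by exists 0; [exact: (lspan_subspace _).1|rewrite addr0].
  have gC l r : 0 < Im l -> (range (gam A G (- 'i%C)) `|` range (gams A Gs 'i%C)) r ->
      '[g, resolvent C l r] = 0.
    move=> l0 Rr; apply: gP; exists 0; first exact: (lspan_subspace _).1.
    exists (resolvent C l r); last by rewrite add0r.
    by apply: sub_lspan; exists l => //; exists r.
  split.
    apply: (constant_boundary BS) => z u z0 Au uE.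
    have [Aw wE] := AP u Ni0; exists (resolvent A (- 'i%C) u); split=> //.
    apply: (proj1 (proj1 (orth_generators u) _)) => r Rr.
    have zc : 0 < Im z^* by rewrite conj_Im oppr_gt0.
    have [Cy yE] := CP r zc.
    by have := gC _ _ zc Rr; rewrite -uE (shift_pair _ Au Cy) yE.
  apply: (constant_boundary_star BS) => z u z0 Cu uE.
  have [Cw wE] := CP u i0; exists (resolvent C 'i%C u); split=> //.
  apply: (proj2 (proj1 (orth_generators u) _)) => r Rr.
  have zc : Im z^* < 0 by rewrite conj_Im oppr_lt0.
  have [Ay yE] := AP r zc.
  have := gA _ _ zc Rr; rewrite -uE => h.
  by rewrite innerC -yE (shift_pair _ Ay Cu) [(z^*)^*](conjcK z) -innerC.
- move=> Ng; split=> // _ [x xs [y ys <-]]; rewrite innerDr.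
  have orthN v : N v -> forall r,
      (range (gam A G (- 'i%C)) `|` range (gams A Gs 'i%C)) r -> '[v, r] = 0.
    move=> [N1 N2]; apply/orth_generators; split.
      by have [Aw wE] := AP v Ni0; exact: N1 wE.
    by have [Cw wE] := CP v i0; exact: N2 wE.
  rewrite (orth_lspan _ xs) ?(orth_lspan _ ys) ?addr0//.
  + move=> _ [l l0 [r Rr <-]]; have lc : Im l^* < 0 by rewrite conj_Im oppr_lt0.
    have [Av vE] := AP g lc; have [Cr rE] := CP r l0.
    rewrite -vE (shift_pair _ Av Cr) [(l^*)^*](conjcK l) rE.
    by apply: orthN => //; apply: (null_part_resolvent BS lc Av); rewrite vE.
  + move=> _ [m m0 [r Rr <-]]; have mc : 0 < Im m^* by rewrite conj_Im oppr_gt0.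
    have [Cv vE] := CP g mc; have [Ar rE] := AP r m0.
    rewrite -vE innerC -(shift_pair _ Ar Cv) rE -innerC.
    by apply: orthN => //; apply: (null_part_resolvent_star BS mc Cv); rewrite vE.
Qed.

Lemma Hcns_closed : closed_subspace Hc.
Proof.
apply: closed_subspace_closure; set S1 := lspan _; set S2 := lspan _.
have [s1 p1] : subspace S1 := lspan_subspace _.
have [s2 p2] : subspace S2 := lspan_subspace _.
split; first by exists 0 => //; exists 0; rewrite ?addr0.
move=> a _ _ [x Sx [y Sy <-]] [x' Sx' [y' Sy' <-]].
exists (a *: x + x'); first exact: p1.
by exists (a *: y + y'); [exact: p2|rewrite scalerDr addrACA].
Qed.

Lemma orth_Hs : orth_in setT Hs = Hc.
Proof. by apply: orth_in_orth_in => //; exact: Hcns_closed. Qed.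

Lemma Hs_closed : closed_subspace Hs.
Proof. exact/closed_subspace_orth/closed_subspaceT. Qed.

Lemma Hs_resolvent z u : Im z < 0 -> dom A u -> Hs (A u - z *: u) -> Hs u.
Proof. by rewrite orth_Hcns; exact: null_part_resolvent. Qed.

Lemma Hs_resolvent_star z u : 0 < Im z -> dom C u -> Hs (C u - z *: u) -> Hs u.
Proof. by rewrite orth_Hcns; exact: null_part_resolvent_star. Qed.

(** Invariance of the complement is dual to invariance under the resolvents of
    [C]. *)
Lemma reducing_Hs : reducing setT A Hs.
Proof.
have [] := @invariant_of_resolvent _ _ setT A Hs (- 'i%C).
- exact: closed_subspaceT.
- exact: Hs_closed.
- by [].
- exact: Al.
- by [].
- by [].
- exact: Ao.
- exact: (lower_inj BS).
- by move=> u Au; exact: Hs_resolvent.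
- move=> u Au [_ uo]; split=> // x Hx.
  have zc : 0 < Im (- 'i%C : R[i])^* by rewrite conj_Im oppr_gt0.
  have [Cy yE] := CP x zc; rewrite -yE -(shift_pair _ Au Cy); apply: uo.
  by apply: (Hs_resolvent_star zc Cy); rewrite yE.
by move=> i1 i2; split=> //; exact: Hs_closed.
Qed.

Lemma reducing_Hcns : reducing setT A Hc.
Proof. by rewrite -orth_Hs; exact: (reducing_orth (closed_subspaceT _) reducing_Hs). Qed.

Lemma Hcns_resolvent z u : Im z < 0 -> dom A u -> Hc (A u - z *: u) -> Hc u.
Proof.
move=> z0 Au; have [h _] := reducing_resolvent (closed_subspaceT _) Al
  (fun _ _ => I) (lower_inj BS z0) reducing_Hcns; exact: h.
Qed.

Lemma Hs_dom u : dom A u -> Hs u -> G u = 0 /\ Hs (A u).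
Proof.
move=> Au Hu; have Hss := closed_subspaceW Hs_closed.
have HA : Hs (A u).
  by have [_ _ /(_ u Au)[_]] := reducing_Hs; rewrite (orth_proj_id Hss Hu).
split=> //; have : Hs (A u - (- 'i%C) *: u).
  by apply: (subspaceB Hss) => //; exact: subspaceZ.
by rewrite orth_Hcns => -[N1 _]; exact: (N1 _ u Ni0).
Qed.

(** For [z] in the upper half-plane the solution is [(C - z)^-1 f]; its boundary
    value vanishes, so it lies in the domain of [A] as well. *)
Lemma Hs_solution z f : Im z != 0 -> Hs f ->
  exists u, [/\ dom A u, Hs u & A u - z *: u = f].
Proof.
rewrite neq_lt => /orP[z0|z0] Hf.
  have [Au uE] := AP f z0; exists (resolvent A z f); split=> //.
  by apply: (Hs_resolvent z0 Au); rewrite uE.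
have [Cu uE] := CP f z0.
have Hu : Hs (resolvent C z f) by apply: (Hs_resolvent_star z0 Cu); rewrite uE.
have Gu : Gs (resolvent C z f) = 0.
  by move: Hf; rewrite orth_Hcns => -[_ N2]; exact: (N2 z).
have [Au AE _] := null_boundary_star BS Cu Gu.
by exists (resolvent C z f); rewrite AE.
Qed.

Lemma selfadjoint_Hs : selfadjoint Hs (restr Hs A).
Proof.
have Hss := closed_subspaceW Hs_closed.
have ontoHs z : Im z != 0 -> onto Hs (restr Hs A) z.
  by move=> z0 f /(Hs_solution z0)[u [Au Hu uE]]; exists u.
apply: (@selfadjoint_crit _ _ _ _ 'i%C).
- exact: Hs_closed.
- exact: restr_linear.
- by move=> u [].
- by move=> u [Au Hu]; exact: (Hs_dom Au Hu).2.
- move=> u v [Au Hu] [Av Hv] /=; apply/eqP; rewrite -subr_eq0 Gg//.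
  by rewrite (Hs_dom Au Hu).1 inner0l mulr0.
- by rewrite gt_eqF.
- by apply: ontoHs; rewrite gt_eqF.
- by apply: ontoHs; rewrite conj_Im oppr_eq0 gt_eqF.
Qed.

Lemma Hcns_maximal : maximal_dissipative Hc (restr Hc A).
Proof.
have Hcs := closed_subspaceW Hcns_closed.
apply: (@maxdiss_crit _ _ _ _ (- 'i%C)) => //.
- exact: Hcns_closed.
- exact: restr_linear.
- by move=> u [].
- move=> u [Au Hu]; have [_ _ /(_ u Au)[_]] := reducing_Hcns.
  by rewrite (orth_proj_id Hcs Hu).
- by move=> u [Au _]; exact: (boundary_dissipative BS).
- move=> f Hf; have [Au uE] := AP f Ni0; exists (resolvent A (- 'i%C) f) => //.
  by split=> //; apply: (Hcns_resolvent Ni0 Au); rewrite uE.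
Qed.

Lemma selfadjointP K M : selfadjoint K M -> symmetric_op M /\
  forall v w, K v -> K w -> (forall u, dom M u -> '[M u, v] = '[u, w]) ->
    dom M v /\ M v = w.
Proof.
move=> [[Kc Ml MK KM dM] [dE fE]].
have adj v : dom M v -> adjoint_rel K M v (M v).
  move=> Mv; rewrite fE//; have : dom (adjoint K M) v by rewrite -dE.
  by move=> [_ ex]; exact: (xgetPex 0 ex).
split=> [u v Mu /adj[_ ->//]|v w Kv Kw vw].
have Mv : dom M v by rewrite dE; split=> //; exists w; split.
split=> //; apply/eqP; rewrite -subr_eq0; apply/eqP/inner_eq0.
apply: (@orth_closure _ _ (dom M)); last first.
  by apply/dM/(subspaceB (closed_subspaceW Kc)) => //; exact: KM.
move=> u Mu; rewrite innerC innerBr -(vw u Mu) -((adj v Mv).2 u Mu) subrr.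
exact: conjC0.
Qed.

(** On a reducing subspace [K] where [A] is selfadjoint, [Im <A u, u> = 0], so [G]
    vanishes on [(A - z)^-1 K]. For [C] one first checks that [(C - z)^-1] maps
    [K] to itself; as [A] is selfadjoint on [K], the result lies in the domain of
    [A], and [Gs] vanishes on it too. So [K] lies in the null part, which is
    orthogonal to [K]. *)
Lemma Hcns_completely_nonselfadjoint : completely_nonselfadjoint Hc (restr Hc A).
Proof.
split; first exact: Hcns_maximal.
move=> [K [Kr K0 Ksa]]; apply: K0; have [Kc KH _ _] := Kr.
have [Ts Tm] := selfadjointP Ksa.
have Ks := closed_subspaceW Kc; have Hcs := closed_subspaceW Hcns_closed.
have Bl : linear_op (restr Hc A) by exact: restr_linear.
have BH : dom (restr Hc A) `<=` Hc by move=> ? [].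
have inj z (z0 : Im z < 0) u : dom (restr Hc A) u -> A u - z *: u = 0 -> u = 0.
  by move=> [Au _]; exact: (lower_inj BS z0).
have red z (z0 : Im z < 0) := reducing_resolvent Hcns_closed Bl BH (inj z z0) Kr.
have KN g : K g -> N g.
  move=> Kg; split=> z u z0 du uE.
    have Hu : Hc u by apply: (Hcns_resolvent z0 du); rewrite uE; exact: KH.
    have Ku : K u by apply: (red z z0).1 => //=; rewrite uE.
    apply/nrm0_eq0/eqP; rewrite -sqrf_eq0 (Im_green BS du).
    have -> : Im '[A u, u] = 0 by apply: (symmetric_Im Ts); split.
    by rewrite mulr0.
  have zc : Im z^* < 0 by rewrite conj_Im oppr_lt0.
  have Hu : Hc u.
    rewrite -orth_Hs; split=> // x Hx; have [y [Ay Hy yE]] := Hs_solution (ltr0_neq0 zc) Hx.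
    rewrite -yE innerC (shift_pair _ Ay du) [(z^*)^*](conjcK z) uE.
    by case: Hy => _ /(_ g (KH _ Kg)) ->; rewrite conjC0.
  have Ku : K u.
    have [Kp pP] := orth_projP u Kc; have Oq := orth_proj_rest Kc Hcs KH Hu.
    set p := orth_proj K u in Kp pP Oq; set q := u - p in pP Oq.
    have [Ay yE] := AP q zc; set y := resolvent A z^* q in Ay yE.
    have Hy : Hc y by apply: (Hcns_resolvent zc Ay); rewrite yE; exact: Oq.1.
    have [_ yo] : orth_in Hc K y by apply: (red _ zc).2 => //=; rewrite yE.
    suff q0 : q = 0 by rewrite -(subrK p u) -/q q0 add0r.
    apply: inner_eq0; have -> : '[q, q] = '[q, u].
      have qu : q - u = - p by rewrite /q addrAC subrr add0r.
      by apply/eqP; rewrite -subr_eq0 -innerBr qu innerNr pP// oppr0.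
    by rewrite -yE (shift_pair _ Ay du) [(z^*)^*](conjcK z) uE yo.
  have KC : K (C u).
    by rewrite -(subrK (z *: u) (C u)) uE; apply: (subspaceD Ks) => //; exact: subspaceZ.
  have [] := Tm u (C u) Ku KC; first by move=> x [[Ax _] _]; exact: AC.
  move=> Tu TE; have [[Au _] _] := Tu; have {}TE : A u = C u := TE.
  apply/nrm0_eq0/eqP; rewrite -sqrf_eq0 (Im_green_star BS du) -TE.
  by have /= -> := symmetric_Im Ts Tu; rewrite mulr0 oppr0.
apply/seteqP; split=> [g Kg|_ ->]; last exact: Ks.1.
have [_ h] : Hs g by rewrite orth_Hcns; exact: KN.
exact/inner_eq0/h/KH.
Qed.

End selfadjoint_part.

(** * Square integrable functions on a half-line *)

Section half_line_measure.
Context (R : realType).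

(** [sg * r] is the distance of a point [r] of the half-line from [0]; in this
    coordinate both half-lines look alike. *)
Definition half_line (i : interval R) (sg : R) :=
  i = (if sg == 1 then `](0 : R), +oo[ else `]-oo, (0 : R)[)%R /\ (sg = 1 \/ sg = -1).

Context (i : interval R) (sg : R) (hl : half_line i sg).
Local Notation mu := (leb_on i).
Local Notation leb := (@lebesgue_measure R).

Definition layer (s t : R) : set R := [set r | s < sg * r < t].

Let N1F : (-1 == 1 :> R) = false. Proof. by apply/negbTE; rewrite lt_eqF. Qed.

Lemma sg_sqr : sg * sg = 1.
Proof. by case: hl => _ [->|->]; rewrite ?mulrNN mulr1. Qed.

Lemma sgK r : sg * (sg * r) = r.
Proof. by rewrite mulrA sg_sqr mul1r. Qed.

Lemma half_lineE : [set` i] = [set r | 0 < sg * r].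
Proof.
case: hl => -> [] ->; rewrite ?eqxx ?N1F; apply/seteqP; split=> r /=;
  by rewrite in_itv/= ?andbT ?mul1r// mulN1r oppr_gt0.
Qed.

Lemma closure_half_lineE : closure [set` i] = [set r | 0 <= sg * r].
Proof.
rewrite half_lineE; case: hl => _ [] ->.
  rewrite (_ : [set r | 0 < 1 * r] = [set r | 0 < r]); last first.
    by apply/seteqP; split=> r /=; rewrite mul1r.
  by rewrite closure_gt; apply/seteqP; split=> r /=; rewrite mul1r.
rewrite (_ : [set r | 0 < -1 * r] = [set r | r < 0]); last first.
  by apply/seteqP; split=> r /=; rewrite mulN1r oppr_gt0.
by rewrite closure_lt; apply/seteqP; split=> r /=; rewrite mulN1r oppr_ge0.
Qed.

Lemma layerE s t : layer s t = [set` if sg == 1 then `]s, t[ else `]-t, -s[].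
Proof.
rewrite /layer; case: hl => _ [->|->]; rewrite ?eqxx ?N1F; last first.
  by apply/seteqP; split=> r /=; rewrite in_itv/= mulN1r ltrNr ltrNl andbC.
by apply/seteqP; split=> r /=; rewrite in_itv/= mul1r.
Qed.

Lemma measurable_layer s t : measurable (layer s t : set R).
Proof. by rewrite layerE; exact: measurable_itv. Qed.

Lemma layer_sub s t : 0 <= s -> layer s t `<=` [set` i].
Proof. by move=> s0 r /andP[sr _]; rewrite half_lineE /=; exact: le_lt_trans sr. Qed.

Lemma leb_onE (A : set R) : A `<=` [set` i] -> mu A = leb A.
Proof. by move=> Ai; rewrite /leb_on/= /mrestr; congr (leb _); apply/setIidPl. Qed.

Lemma leb_on_le (A : set R) : measurable A -> (mu A <= leb A)%E.
Proof.
move=> mA; rewrite /leb_on/= /mrestr; apply: le_measure; rewrite ?inE//.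
by apply: measurableI => //; exact: measurable_itv.
Qed.

Lemma leb_layer s t : s <= t -> leb (layer s t) = (t - s)%:E.
Proof.
move=> st; rewrite layerE lebesgue_measure_itv; case: (sg == 1) => /=.
  rewrite lte_fin -EFinB; case: ltP => // ts.
  by rewrite (_ : t = s) ?subrr//; apply/eqP; rewrite eq_le st ts.
rewrite lte_fin -EFinB ltrN2 opprK addrC; case: ltP => // ts.
by rewrite (_ : t = s) ?subrr//; apply/eqP; rewrite eq_le st ts.
Qed.

Lemma mu_layer s t : 0 <= s -> s <= t -> mu (layer s t) = (t - s)%:E.
Proof. by move=> s0 st; rewrite leb_onE ?leb_layer//; exact: layer_sub. Qed.

Lemma mu_negligible (A : set R) : measurable A -> leb A = 0%E -> mu.-negligible A.
Proof.
move=> mA A0; exists A; split=> //.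
by apply/eqP; rewrite eq_le measure_ge0 andbT -A0 leb_on_le.
Qed.

Lemma ae_neq (c : R) : {ae mu, forall r, sg * r != c}.
Proof.
have m1 : measurable [set sg * c] by exact: measurable_set1.
have := mu_negligible m1 (lebesgue_measure_set1 _); apply: negligibleS => r /=.
by move=> /negP; rewrite negbK => /eqP <-; rewrite sgK.
Qed.

Lemma ae_half_line : {ae mu, forall r, 0 < sg * r}.
Proof.
exists (~` [set` i]); split.
- by apply: measurableC; exact: measurable_itv.
- by rewrite /leb_on/= /mrestr setICl measure0.
- by rewrite half_lineE.
Qed.

Lemma leb_on_integral (D : set R) (f : R -> \bar R) : D `<=` [set` i] ->
  (\int[mu]_(r in D) f r = \int[leb]_(r in D) f r)%E.
Proof.
by move=> Di; apply: eq_measure_integral => A _ AD; apply: leb_onE; exact: subset_trans Di.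
Qed.

End half_line_measure.

Lemma continuous_expR_mul (R : realType) (c : R) : continuous (fun r : R => expR (c * r)).
Proof.
move=> r; apply: (@continuous_comp _ _ _ (fun r => c * r) expR).
  exact: mulrl_continuous.
exact: continuous_expR.
Qed.

Lemma is_derive_expR_mul (R : realType) (c r : R) : c != 0 ->
  is_derive r 1 (fun r : R => expR (c * r) / c : R^o) (expR (c * r)).
Proof.
move=> c0.
have d1 : is_derive r 1 (fun r : R => c * r : R^o) c.
  have -> : (fun r : R => c * r : R^o) = c \*: (@id R^o) by [].
  by apply: is_derive_eq; rewrite [LHS]mulr1.
have d2 : is_derive r 1 (expR \o (fun r : R => c * r)) (expR (c * r) * c).
  exact: is_derive1_comp.
have -> : (fun r : R => expR (c * r) / c : R^o) = c^-1 \*: ((expR \o (fun r : R => c * r)) : R -> R^o).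
  by apply/funext => x /=; rewrite mulrC.
have d3 := @is_deriveZ _ R^o R^o _ c^-1 _ _ _ d2.
apply: (@is_derive_eq _ _ _ _ _ _ _ _ d3).
by rewrite [LHS]mulrC mulfK.
Qed.

Lemma integral_expR (R : realType) (c a b : R) : c != 0 -> a <= b ->
  \int[lebesgue_measure]_(r in `[a, b]) expR (c * r) = (expR (c * b) - expR (c * a)) / c.
Proof.
move=> c0; rewrite le_eqVlt => /predU1P[->|ab].
  by rewrite set_itv1 Rintegral_set1 subrr mul0r.
have cF : continuous (fun r : R => expR (c * r) / c : R^o).
  by move=> r; apply: (@differentiable_continuous _ R^o R^o);
    apply/derivable1_diffP; have [] := is_derive_expR_mul r c0.
rewrite /Rintegral (@continuous_FTC2 _ _ (fun r => expR (c * r) / c))//.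
- by rewrite -EFinB/= mulrBl.
- by apply: continuous_subspaceT; exact: continuous_expR_mul.
- split.
  + by move=> r _; have [] := is_derive_expR_mul r c0.
  + by apply: cvg_at_right_filter; exact: cF.
  + by apply: cvg_at_left_filter; exact: cF.
- move=> r _; rewrite derive1E; exact: (@derive_val _ _ _ _ _ _ _ (is_derive_expR_mul r c0)).
Qed.

Section laplace.
Context (R : realType) (i : interval R) (sg : R) (hl : half_line i sg).
Local Notation mu := (leb_on i).
Local Notation leb := (@lebesgue_measure R).
Local Notation lay := (layer sg).

Let N1F : (-1 == 1 :> R) = false. Proof. by apply/negbTE; rewrite lt_eqF. Qed.

Lemma leb_on_integralT (f : R -> \bar R) : measurable_fun setT f ->
  (\int[mu]_r f r = \int[leb]_(r in [set` i]) f r)%E.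
Proof.
move=> mf; rewrite -(leb_on_integral (i := i))// [RHS]integral_mkcond.
have mi : measurable [set` i] by exact: measurable_itv.
apply: ae_eq_integral => //.
  by apply/(measurable_restrictT _ _).1 => //; exact: measurable_funTS.
have F := ae_filter_ringOfSetsType mu; apply: filterS (ae_half_line hl) => r r0 _.
by rewrite patchE mem_set// (half_lineE hl).
Qed.

(** [exp (- lam * d)] at distance [d] from [0]. *)
Definition expd (lam r : R) := expR (- (lam * (sg * r))).

Lemma expdM lam k r : expd lam r ^+ k = expd (k%:R * lam) r.
Proof. by rewrite /expd -expRM_natl mulrN -mulrA. Qed.

Lemma continuous_expd lam : continuous (expd lam).
Proof.
rewrite (_ : expd lam = fun r => expR (- (lam * sg) * r)).
  exact: continuous_expR_mul.
by apply/funext => r; rewrite /expd mulNr mulrA.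
Qed.

Lemma measurable_expd lam : measurable_fun setT (expd lam).
Proof. by apply: continuous_measurable_fun; exact: continuous_expd. Qed.

Let integrable_exp lam : 0 < lam ->
  leb.-integrable `[(0 : R), +oo[ (EFin \o (fun r => expR (- (lam * r)))).
Proof.
move=> l0; apply/integrable_mkcond; first exact: measurable_itv.
rewrite restrict_EFin.
have := integrable_EFinZ lam^-1 (integrable_exponential_pdf l0).
congr (_.-integrable _ (EFin \o _)); apply/funext => r.
rewrite /exponential_pdf !patchE; case: ifP; rewrite ?mulr0// => _.
by rewrite mulKf ?gt_eqF// mulNr.
Qed.

Lemma integrable_expd lam : 0 < lam -> mu.-integrable setT (EFin \o expd lam).
Proof.
move=> l0; have mE : measurable_fun setT (EFin \o expd lam).
  by apply/measurable_EFinP; exact: measurable_expd.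
apply/integrableP; split=> //.
rewrite leb_on_integralT; last by apply: measurableT_comp.
have /integrableP[mx] := integrable_exp l0; apply: le_lt_trans.
have mi : measurable [set` i] by exact: measurable_itv.
pose F r := (`|(EFin \o expd lam) r|)%E : \bar R.
have mF : measurable_fun setT F by apply: measurableT_comp.
rewrite -[leLHS]/(\int[leb]_(r in [set` i]) F r)%E.
case: hl => iE [sgE|sgE]; rewrite iE sgE ?eqxx ?N1F.
  apply: le_trans (_ : \int[leb]_(r in `[0%R, +oo[) F r <= _)%E.
    apply: ge0_subset_integral => //; first exact: measurable_funTS.
    + by move=> r _; exact: abse_ge0.
    + by move=> r /=; rewrite !in_itv/= !andbT; exact: ltW.
  rewrite le_eqVlt; apply/orP; left; apply/eqP; apply: eq_integral => r _.
  by rewrite /F /= /expd sgE mul1r.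
apply: le_trans (_ : \int[leb]_(r in `]-oo, 0%R]) F r <= _)%E.
  apply: ge0_subset_integral => //; first exact: measurable_funTS.
  + by move=> r _; exact: abse_ge0.
  + by move=> r /=; rewrite !in_itv/=; exact: ltW.
rewrite le_eqVlt; apply/orP; left; apply/eqP.
pose F' r := F (- r).
have -> : (\int[leb]_(r in `]-oo, 0%R]) F r = \int[leb]_(r in `]-oo, 0%R]) F' (- r)%R)%E.
  by apply: eq_integral => r _; rewrite /F' opprK.
rewrite -ge0_integration_by_substitution0; last 2 first.
  - by apply: (measurableT_comp mF); exact: oppr_measurable.
  - by move=> r; exact: abse_ge0.
by apply: eq_integral => r _; rewrite /F' /F /= /expd sgE mulN1r opprK.
Qed.

Lemma layer0 s t : t <= s -> lay s t = set0.
Proof.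
move=> ts; apply/seteqP; split=> // r /andP[sr rt]; exfalso.
by have := lt_trans sr rt; rewrite ltNge ts.
Qed.

(** Lebesgue differentiation: the primitive of [phi], cut off at distance [n],
    vanishes identically, hence so does its derivative. *)
Lemma layer_integral_eq0 (phi : R -> R) : measurable_fun setT phi ->
  (forall t, mu.-integrable (lay 0 t) (EFin \o phi)) ->
  (forall s t, 0 <= s -> s <= t -> \int[mu]_(r in lay s t) phi r = 0) ->
  {ae mu, forall r, phi r = 0}.
Proof.
move=> mphi iphi phi0.
have ml s t : measurable (lay s t) by exact: measurable_layer hl _ _.
have all0 s t : 0 <= s -> \int[leb]_(r in lay s t) phi r = 0.
  move=> s0; case: (leP s t) => st; last by rewrite layer0 ?Rintegral_set0// ltW.
  by rewrite -(phi0 s t s0 st) /Rintegral (leb_on_integral _ (layer_sub hl s0)).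
have key (n : nat) : {ae leb, forall r, lay 0 n%:R r -> phi r = 0}.
  pose f := phi \_ (lay 0 n%:R).
  have il : leb.-integrable (lay 0 n%:R) (EFin \o phi).
    have /integrableP[m1 m2] := iphi n%:R; apply/integrableP; split=> //.
    by rewrite -(leb_on_integral _ (layer_sub hl (lexx 0))).
  have ifT : leb.-integrable setT (EFin \o f).
    by rewrite -restrict_EFin; exact: (integrable_mkcond (mu := leb) (EFin \o phi) (ml 0 n%:R)).1.
  have ify y : leb.-integrable `]-oo, y] (EFin \o f).
    by apply: integrableS ifT => //; exact: measurable_itv.
  have fl : locally_integrable [set: R] f by exact: integrable_locally.
  pose F y := \int[leb]_(t in `]-oo, y]) f t.
  have h : {ae leb, forall x, derivable (F : R -> R^o) x 1 /\ (F : R -> R^o)^`()%classic x = f x}.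
    exact: FTC1Ny ify fl.
  have F0 : F = cst 0.
    apply/funext => y; rewrite /F -Rintegral_itv_bndo_bndc; last first.
      by apply: integrableS ifT => //; exact: measurable_itv.
    rewrite -Rintegral_mkcondl; have [_ [sgE|sgE]] := hl.
    - rewrite (_ : _ `&` _ = lay 0 (Num.min n%:R y)) ?all0//.
      apply/seteqP; split=> r; rewrite /layer /= in_itv/=.
        by move=> [/andP[r0 rn] ry]; rewrite lt_min r0 rn sgE mul1r.
      by move=> /andP[r0]; rewrite lt_min => /andP[-> ]; rewrite r0 sgE mul1r.
    - rewrite (_ : _ `&` _ = lay (Num.max 0 (- y)) n%:R) ?all0// ?le_max ?lexx//.
      apply/seteqP; split=> r; rewrite /layer /= in_itv/=.
        by move=> [/andP[r0 rn] ry]; rewrite gt_max r0 rn sgE mulN1r ltrN2 ry.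
      move=> /andP[]; rewrite gt_max => /andP[r0 yr] rn.
      by rewrite r0 rn; split=> //; move: yr; rewrite sgE mulN1r ltrN2.
  have AF := ae_filter_ringOfSetsType leb; apply: filterS h => r [_].
  rewrite F0 derive1_cst => fr lr; move: fr; rewrite /f patchE mem_set//.
have [N [mN N0 NP]] := ae_foralln key.
have AF := ae_filter_ringOfSetsType mu.
have mN0 : mu N = 0%E.
  apply/eqP; rewrite eq_le measure_ge0 andbT -N0.
  exact: leb_on_le.
have aeN : {ae mu, forall r, forall n : nat, lay 0 n%:R r -> phi r = 0}.
  by exists N.
apply: filterS2 (ae_half_line hl) aeN => r r0 rP.
apply: (rP (Num.trunc (sg * r)).+1); rewrite /layer /= r0.
by apply: Num.Theory.truncnS_gt.
Qed.

(** [(1 - q) ^+ 2 ^ k] is close to [1] or [0] according to whether [2 ^ k * q] is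
    small or large. *)
Lemma bernoulli_le (q : R) n : 0 <= q <= 1 -> 1 - (1 - q) ^+ n <= n%:R * q.
Proof.
move=> /andP[q0 q1]; elim: n => [|n IH]; first by rewrite expr0 subrr mul0r.
rewrite exprS; have : 0 <= (1 - q) ^+ n by rewrite exprn_ge0// subr_ge0.
have : (1 - q) ^+ n <= 1 by rewrite exprn_ile1// ?subr_ge0// gerBl.
move: IH; move: ((1 - q) ^+ n) => x IH x1 x0.
by rewrite -natr1; nra.
Qed.

Lemma bernoulli_ge (q : R) n : 0 <= q <= 1 -> (1 - q) ^+ n * (n%:R * q) <= 1.
Proof.
move=> /andP[q0 q1].
have h : 1 + n%:R * q <= (1 + q) ^+ n.
  elim: n => [|n IH]; first by rewrite expr0 mul0r addr0.
  rewrite exprS -natr1; have : 0 <= n%:R :> R by [].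
  move: ((1 + q) ^+ n) (n%:R : R) IH => x m IH m0; nra.
have p0 : 0 <= (1 - q) ^+ n by rewrite exprn_ge0// subr_ge0.
apply: le_trans (_ : (1 - q) ^+ n * (1 + q) ^+ n <= _).
  by rewrite ler_wpM2l// (le_trans _ h)// lerDr.
rewrite -exprMn exprn_ile1//; first by rewrite mulr_ge0 ?subr_ge0 ?addr_ge0.
by nra.
Qed.

Section step_approximation.
Context (s : R) (s0 : 0 < s).

(* with this rate [rho] equals [1] exactly at distance [s] *)
Let c := ln 2 / s.
Let q k r := expd (k%:R * c) r.
Let g k r := 1 - (1 - q k r) ^+ (2 ^ k).
Let rho r := 2 * expd c r.

Let ln20 : 0 < ln 2 :> R. Proof. by rewrite ln_gt0// ltr1n. Qed.
Let c0 : 0 < c. Proof. by rewrite divr_gt0. Qed.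

Let q01 k r : 0 < sg * r -> 0 <= q k r <= 1.
Proof.
move=> r0; rewrite expR_ge0/= -expR0 ler_expR oppr_le0.
by apply: mulr_ge0; [apply: mulr_ge0; last exact: ltW|exact: ltW].
Qed.

Let qE k r : (2 ^ k)%N%:R * q k r = rho r ^+ k.
Proof. by rewrite /rho exprMn expdM natrX. Qed.

Let g_le k r : 0 < sg * r -> 0 <= g k r <= Num.min 1 (rho r ^+ k).
Proof.
move=> r0; have /andP[h0 h1] := q01 k r0.
have p0 : 0 <= (1 - q k r) ^+ (2 ^ k) by rewrite exprn_ge0// subr_ge0.
rewrite subr_ge0 exprn_ile1 ?subr_ge0 ?gerBl//= le_min gerBl p0/=.
by rewrite -qE bernoulli_le// h0.
Qed.

(** A majorant independent of [k] that is integrable against [phi]: constants are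
    not, as nothing is assumed of [phi] near infinity. *)
Lemma step_dominated N k r : (N <= k)%N -> 0 < sg * r -> `|g k r| <= rho r ^+ N.
Proof.
move=> Nk r0; have /andP[h0] := g_le k r0; rewrite le_min ger0_norm// => /andP[h1 h2].
have rho0 : 0 <= rho r by rewrite mulr_ge0// expR_ge0.
case: (leP 1 (rho r)) => h.
  by apply: le_trans h1 _; exact: exprn_ege1.
by apply: le_trans h2 _; rewrite ler_wiXn2l// ltW.
Qed.

(** [2 ^ k * q k] is the [k]-th power of [rho], which exceeds [1] exactly at the
    points nearer to [0] than [s]. *)
Lemma step_cvg r : 0 < sg * r -> sg * r != s ->
  g ^~ r @ \oo --> (if sg * r < s then 1 else 0 : R).
Proof.
move=> r0 rs; have rho0 : 0 < rho r by rewrite mulr_gt0// expR_gt0.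
have rhoE : rho r = expR (ln 2 * (1 - sg * r / s)).
  rewrite /rho /expd mulrBr mulr1 expRD lnK ?posrE//; congr (_ * expR _).
  by rewrite /c; field; rewrite gt_eqF.
case: ltP => h.
  have rho1 : 1 < rho r.
    by rewrite rhoE -[ltLHS]expR0 ltr_expR mulr_gt0// subr_gt0 ltr_pdivrMr// mul1r.
  have gP : (fun k => (rho r)^-1 ^+ k) @ \oo --> (0 : R).
    by apply: cvg_expr; rewrite ger0_norm ?invr_ge0 ?ltW// invf_lt1.
  apply/cvgrPdist_lt => e e0; have /cvgrPdist_lt/(_ e e0) := gP.
  apply: filterS => k; rewrite sub0r normrN ger0_norm ?exprn_ge0 ?invr_ge0 ?ltW//.
  apply: le_lt_trans; rewrite /g opprB addrC subrK.
  have /andP[h0 h1] := q01 k r0.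
  rewrite ger0_norm ?exprn_ge0 ?subr_ge0// exprVn -qE.
  rewrite -[leRHS]mul1r ler_pdivlMr ?bernoulli_ge ?h0//.
  by rewrite qE exprn_gt0.
have {h rs} h : s < sg * r by rewrite lt_neqAle eq_sym rs.
have rho1 : rho r < 1.
  rewrite rhoE -[ltRHS]expR0 ltr_expR pmulr_rlt0// subr_lt0.
  by rewrite ltr_pdivlMr// mul1r.
have gP : (fun k => (rho r) ^+ k) @ \oo --> (0 : R).
  by apply: cvg_expr; rewrite ger0_norm// ltW.
apply/cvgrPdist_lt => e e0; have /cvgrPdist_lt/(_ e e0) := gP.
apply: filterS => k; rewrite !sub0r !normrN ger0_norm ?exprn_ge0 ?ltW//.
apply: le_lt_trans; have /andP[h0] := g_le k r0.
by rewrite le_min ger0_norm// => /andP[].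
Qed.

Context (phi : R -> R) (l : R) (mphi : measurable_fun setT phi).
Context (phi_int : forall lam, l < lam ->
  mu.-integrable setT (EFin \o (fun r => phi r * expd lam r))).
Context (phi0 : forall lam, l < lam -> \int[mu]_r (phi r * expd lam r) = 0).

Let phi_q k : l < k%:R * c -> forall j n,
  mu.-integrable setT (EFin \o (fun r => phi r * q k r ^+ n.+1 * (1 - q k r) ^+ j)) /\
  \int[mu]_r (phi r * q k r ^+ n.+1 * (1 - q k r) ^+ j) = 0.
Proof.
move=> lk; elim=> [n|j IH n].
  have ln : l < n.+1%:R * (k%:R * c).
    apply: lt_le_trans lk _; rewrite ler_peMl ?ler1n//.
    by rewrite mulr_ge0// ltW.
  rewrite (_ : (fun r => _) = fun r => phi r * expd (n.+1%:R * (k%:R * c)) r).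
    by split; [exact: phi_int|exact: phi0].
  by apply/funext => r; rewrite expr0 mulr1 expdM.
have [i1 e1] := IH n; have [i2 e2] := IH n.+1.
rewrite (_ : (fun r => _) = fun r => phi r * q k r ^+ n.+1 * (1 - q k r) ^+ j -
    phi r * q k r ^+ n.+2 * (1 - q k r) ^+ j); last first.
  apply/funext => r; rewrite [(1 - _) ^+ j.+1]exprS [q k r ^+ n.+2]exprS.
  by move: (q k r ^+ n.+1) (_ ^+ j) => x y; ring.
split; last by rewrite RintegralB//= e1 e2 subrr.
exact: (integrableB measurableT i1 i2).
Qed.

Let phi_g k : l < k%:R * c -> forall M,
  mu.-integrable setT (EFin \o (fun r => phi r * (1 - (1 - q k r) ^+ M))) /\
  \int[mu]_r (phi r * (1 - (1 - q k r) ^+ M)) = 0.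
Proof.
move=> lk; elim=> [|M [i1 e1]].
  rewrite (_ : (fun r => _) = cst 0); last first.
    by apply/funext => r; rewrite expr0 subrr mulr0.
  by split; [exact: integrable0|rewrite Rintegral_cst// mul0r].
have [i2 e2] := phi_q lk M 0%N.
rewrite (_ : (fun r => _) = fun r => phi r * (1 - (1 - q k r) ^+ M) +
    phi r * q k r ^+ 1 * (1 - q k r) ^+ M); last first.
  apply/funext => r; rewrite [(1 - _) ^+ M.+1]exprS expr1.
  by move: (_ ^+ M) => x; ring.
split; last by rewrite RintegralD//= e1 e2 addr0.
exact: integrable_EFinD.
Qed.

(** Integrals of [phi] against polynomials in [q k] without constant term vanish,
    and by [step_cvg] the polynomials [1 - (1 - q k) ^+ (2 ^ k)] tend to the
    indicator of the layer. *)
Lemma laplace_layer : mu.-integrable (lay 0 s) (EFin \o phi) /\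
  \int[mu]_(r in lay 0 s) phi r = 0.
Proof.
have [N lN] : exists N : nat, forall k, (N <= k)%N -> l < k%:R * c.
  exists (Num.trunc (l / c)).+1 => k Nk; rewrite -ltr_pdivrMr//.
  by apply: lt_le_trans (Num.Theory.truncnS_gt _) _; rewrite ler_nat.
have ml : measurable (lay 0 s) by exact: measurable_layer hl _ _.
pose f k r := (phi r * g (N + k) r)%:E : \bar R.
pose f0 r := ((phi \_ (lay 0 s)) r)%:E : \bar R.
pose h r := (2 ^+ N * `|phi r * expd (N%:R * c) r|)%:E : \bar R.
have AF := ae_filter_ringOfSetsType mu.
have mq k : measurable_fun setT (q k) by exact: measurable_expd.
have mf k : measurable_fun setT (f k).
  apply/measurable_EFinP; apply: measurable_funM => //.
  apply: measurable_funB => //; apply: measurable_funX.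
  exact: measurable_funB.
have mf0 : measurable_fun setT f0.
  apply/measurable_EFinP; apply: (measurable_restrictT phi ml).1.
  exact: measurable_funTS.
have ff0 : {ae mu, forall r, setT r -> f ^~ r @ \oo --> f0 r}.
  apply: filterS2 (ae_half_line hl) (ae_neq hl s) => r r0 rs _.
  apply: cvg_EFin; first exact: nearW.
  rewrite patchE (_ : (r \in lay 0 s) = (sg * r < s)); last first.
    apply/idP/idP => [/set_mem/andP[]//|rs']; apply/mem_set.
    by rewrite /layer /= r0.
  have := step_cvg r0 rs; rewrite -(cvg_shiftn N).
  move=> /(@cvgM _ _ _ _ (cst (phi r)) _ _ _ (cvg_cst _)).
  set x := (X in _ --> X -> _); rewrite (_ : x = if sg * r < s then phi r else 0).
    by apply: cvg_trans; apply: near_eq_cvg; apply: nearW => k; rewrite /f /= addnC.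
  by rewrite /x; case: ifP => _; rewrite ?mulr1 ?mulr0.
have ih : mu.-integrable setT h.
  apply: integrable_EFinZ.
  by apply: (integrable_abse (f := EFin \o _)); apply: phi_int; exact: lN.
have dom : {ae mu, forall r n, setT r -> (`|f n r| <= h r)%E}.
  apply: filterS (ae_half_line hl) => r r0 n _; rewrite lee_fin !normrM.
  rewrite mulrCA ler_wpM2l//; apply: le_trans (step_dominated (leq_addr n N) r0) _.
  by rewrite /rho exprMn expdM [`|expd _ _|]ger0_norm// expR_ge0.
have [i1 _ i3] := dominated_convergence (mu := mu) measurableT mf mf0 ff0 ih dom.
split.
  by apply: (integrable_mkcond (mu := mu) (EFin \o phi) ml).2; rewrite restrict_EFin.
rewrite Rintegral_mkcond /Rintegral -/f0.
have /cvg_lim <- // := i3; rewrite (_ : (fun n => _) = cst 0%E) ?lim_cst//.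
apply/funext => k /=; have [j1 j2] := phi_g (lN _ (leq_addr k N)) (2 ^ (N + k)).
by rewrite -[LHS]fineK ?[fine _]j2//; exact: integrable_fin_num.
Qed.

End step_approximation.

(** By [laplace_layer] the integrals of [phi] over all layers vanish. *)
Lemma laplace_unique (phi : R -> R) (l : R) : measurable_fun setT phi ->
  (forall lam, l < lam ->
     mu.-integrable setT (EFin \o (fun r => phi r * expd lam r))) ->
  (forall lam, l < lam -> \int[mu]_r (phi r * expd lam r) = 0) ->
  {ae mu, forall r, phi r = 0}.
Proof.
move=> mphi phi_int phi0.
have i0 t : mu.-integrable (lay 0 t) (EFin \o phi).
  case: (leP t 0) => t0; first by rewrite layer0//; exact: integrable_set0.
  by have [] := laplace_layer t0 mphi phi_int phi0.
have ml s t : measurable (lay s t) by exact: measurable_layer hl _ _.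
have e0 t : \int[mu]_(r in lay 0 t) phi r = 0.
  case: (leP t 0) => t0; first by rewrite layer0 ?Rintegral_set0.
  by have [] := laplace_layer t0 mphi phi_int phi0.
apply: layer_integral_eq0 => // s t s0 st.
have dE (F : R -> R) D : \int[mu]_(r in D) F r = \int[mu]_r (F \_ D) r.
  exact: Rintegral_mkcond.
have iT u : mu.-integrable setT (EFin \o (phi \_ (lay 0 u))).
  by rewrite -restrict_EFin; exact: (integrable_mkcond (mu := mu) (EFin \o phi) (ml 0 u)).1.
suff -> : \int[mu]_(r in lay s t) phi r =
    \int[mu]_(r in lay 0 t) phi r - \int[mu]_(r in lay 0 s) phi r.
  by rewrite !e0 subrr.
rewrite (dE _ (lay s t)) (dE _ (lay 0 t)) (dE _ (lay 0 s)) -RintegralB//.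
rewrite /Rintegral; congr fine; apply: ae_eq_integral => //.
- apply/measurable_EFinP; apply: (measurable_restrictT phi (ml s t)).1.
  exact: measurable_funTS.
- apply/measurable_EFinP; apply: measurable_funB.
    by apply: (measurable_restrictT phi (ml 0 t)).1; exact: measurable_funTS.
  by apply: (measurable_restrictT phi (ml 0 s)).1; exact: measurable_funTS.
have AF := ae_filter_ringOfSetsType mu.
apply: filterS2 (ae_half_line hl) (ae_neq hl s) => r r0 rs _ /=.
have inl u v : (r \in lay u v) = (u < sg * r < v).
  by apply/idP/idP => [/set_mem|/mem_set].
congr EFin; rewrite !patchE !inl r0/=; move: rs; case: (ltgtP (sg * r) s) => //= h _.
  by rewrite (lt_le_trans h st) subrr; reflexivity.
by rewrite -[LHS]subr0; reflexivity.
Qed.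

End laplace.

Section half_line_L2.
Context (R : realType) (i : interval R) (sg : R) (hl : half_line i sg).
Context (E : hilbertType R).
Local Notation mu := (leb_on i).
Local Notation leb := (@lebesgue_measure R).
Local Notation L2i := (L2 mu E).
Local Notation lay := (layer sg).
Implicit Types (u v g : L2i) (f : L2fun mu E) (x y e : E) (s t r : R).

Definition in_layer s t r : bool := (s < sg * r < t).

Lemma mem_layer s t r : (r \in lay s t) = in_layer s t r.
Proof. by apply/idP/idP => [/set_mem|/mem_set]. Qed.

Lemma measurable_in_layer s t : measurable_fun setT (in_layer s t).
Proof.
apply: (measurable_fun_bool true); rewrite setTI preimage_true.
exact: measurable_layer hl s t.
Qed.

Lemma L2pi_ae (f f' : L2fun mu E) : {ae mu, forall r, f r = f' r} -> L2pi f = L2pi f'.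
Proof.
move=> ff'; apply/L2piE/asboolP; have AF := ae_filter_ringOfSetsType mu.
apply: filterS ff' => r fr.
by rewrite [LHS](_ : _ = f r - f' r)// fr subrr.
Qed.

Lemma L2pi_repr_ae (f : L2fun mu E) : {ae mu, forall r, L2repr (L2pi f) r = f r}.
Proof.
have AF := ae_filter_ringOfSetsType mu.
have /asboolP := L2pi_repr f; apply: filterS => r fr.
by apply/eqP; rewrite -subr_eq0; apply/eqP.
Qed.

Lemma cut_L2 s t (f : L2fun mu E) :
  (fun r => if in_layer s t r then f r else 0) \in L2fun_pred mu (E := E).
Proof.
have mg : strongly_measurable (fun r => if in_layer s t r then f r else 0).
  exact: strongly_measurable_if (measurable_in_layer s t) (L2fun_meas f).
apply/L2funP; split=> //.
apply: (le_integrable measurableT _ _ (L2fun_int f)).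
  apply/measurable_EFinP; apply: measurable_funX; exact: strongly_measurable_nrm.
move=> r _ /=; rewrite lee_fin; case: ifP => // _.
by rewrite nrm0 expr0n/= normr0.
Qed.
Definition cutf s t (f : L2fun mu E) := MkL2fun (cut_L2 s t f).

Lemma integral_layer_cst s t (c : R) :
  (\int[mu]_r ((cst c%:E) \_ (lay s t)) r = c%:E * mu (lay s t))%E.
Proof.
have ml : measurable (lay s t) by exact: measurable_layer hl s t.
by rewrite -(integral_mkcond (mu := mu) (lay s t) (cst c%:E)) integral_cst.
Qed.

Lemma step_L2 s t x :
  (fun r => if in_layer s t r then x else 0) \in L2fun_pred mu (E := E).
Proof.
have mg : strongly_measurable (fun r => if in_layer s t r then x else 0).
  apply: strongly_measurable_if (measurable_in_layer s t) _.
  exact/simple_strongly_measurable/simple_cst.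
apply/asboolP; split=> //.
have -> : (fun r : R => ((nrm (if in_layer s t r then x else 0)) ^+ 2)%:E) =
    (cst (nrm x ^+ 2)%:E) \_ (lay s t) :> (R -> \bar R).
  apply/funext => r; rewrite patchE mem_layer; case: ifP => // _.
  by rewrite nrm0 expr0n.
have ml : measurable (lay s t) by exact: measurable_layer hl s t.
rewrite integral_layer_cst lte_mul_pinfty//.
- by rewrite lee_fin sqr_ge0.
- apply: le_lt_trans (leb_on_le i ml) _.
  case: (leP s t) => st; first by rewrite (leb_layer hl)// ltry.
  by rewrite layer0 ?measure0// ltW.
Qed.
Definition stepf s t x := MkL2fun (step_L2 s t x).

(** [x] on the layer between the distances [s] and [t] from [0], and [0] elsewhere;
    [Cut] multiplies by the indicator of the layer. *)
Definition Step s t x : L2i := L2pi (stepf s t x).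
Definition Cut s t (u : L2i) : L2i := L2pi (cutf s t (L2repr u)).

Lemma Cut_pi s t (f : L2fun mu E) : Cut s t (L2pi f) = L2pi (cutf s t f).
Proof.
apply: L2pi_ae; have AF := ae_filter_ringOfSetsType mu.
by apply: filterS (L2pi_repr_ae f) => r /= ->.
Qed.

Lemma CutP s t (a : R[i]) u v : Cut s t (a *: u + v) = a *: Cut s t u + Cut s t v.
Proof.
rewrite -[u]L2reprK -[v]L2reprK -L2piZ -L2piD !Cut_pi -L2piZ -L2piD.
congr L2pi; apply/val_inj/funext => r /=.
rewrite [RHS](_ : _ = a *: (if in_layer s t r then L2repr u r else 0) +
  (if in_layer s t r then L2repr v r else 0))//.
by case: ifP => // _; rewrite scaler0 addr0.
Qed.

Lemma CutB s t u v : Cut s t (u - v) = Cut s t u - Cut s t v.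
Proof. by rewrite addrC -scaleN1r CutP scaleN1r addrC. Qed.

Lemma inner_pi (f f' : L2fun mu E) : '[L2pi f, L2pi f'] = L2form f f'.
Proof. exact: L2inner_pi. Qed.

Lemma eq_L2form (f1 f2 g1 g2 : L2fun mu E) :
  (forall r, '[f1 r, f2 r] = '[g1 r, g2 r]) -> L2form f1 f2 = L2form g1 g2.
Proof. by move=> h; rewrite /L2form; congr Cintegral; apply/funext. Qed.

Lemma Cut_inner s t u v : '[Cut s t u, v] = '[Cut s t u, Cut s t v].
Proof.
rewrite -[u]L2reprK -[v]L2reprK !Cut_pi !inner_pi; apply: eq_L2form => r /=.
by case: ifP => // _; rewrite !inner0l.
Qed.

Lemma Cut_innerC s t u v : '[Cut s t u, v] = '[u, Cut s t v].
Proof. by rewrite Cut_inner innerC -Cut_inner -innerC. Qed.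

Lemma inner_Step s t u x : '[u, Step s t x] = '[Cut s t u, Step s t x].
Proof.
rewrite -[u]L2reprK !Cut_pi !inner_pi; apply: eq_L2form => r /=.
by case: ifP => // _; rewrite inner0r inner0l.
Qed.

Lemma nrm_Cut s t u : nrm (Cut s t u) <= nrm u.
Proof.
have := Re_le_CS (Cut s t u) u; rewrite Cut_inner Re_inner_nrm expr2.
have [->|n0] := eqVneq (nrm (Cut s t u)) 0; first by rewrite nrm_ge0.
by rewrite ler_pM2l// lt_def n0 nrm_ge0.
Qed.

Lemma Cut_sub s t s' t' u : s' <= s -> t <= t' -> Cut s t (Cut s' t' u) = Cut s t u.
Proof.
move=> ss tt; rewrite -[u]L2reprK !Cut_pi; congr L2pi; apply/val_inj/funext => r /=.
rewrite /in_layer; case: ifP => // /andP[sr rt].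
by rewrite (le_lt_trans ss sr) (lt_le_trans rt tt).
Qed.

Lemma Cut_mono s t s' t' u : s' <= s -> t <= t' -> nrm (Cut s t u) <= nrm (Cut s' t' u).
Proof. by move=> ss tt; rewrite -(Cut_sub u ss tt) nrm_Cut. Qed.

Lemma Cut_split s r t u : s <= r -> r <= t -> Cut s t u = Cut s r u + Cut r t u.
Proof.
move=> sr rt; rewrite -[u]L2reprK !Cut_pi -L2piD; apply: L2pi_ae.
have AF := ae_filter_ringOfSetsType mu.
apply: filterS (ae_neq hl r) => q qr.
rewrite [RHS](_ : _ = (if in_layer s r q then L2repr u q else 0) +
  (if in_layer r t q then L2repr u q else 0))//= /in_layer.
move: qr; case: (ltgtP (sg * q) r) => //= h _.
  by rewrite (lt_le_trans h rt) /= ?andbF ?andbT ?addr0.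
by rewrite (le_lt_trans sr h) /= ?andbF ?andbT /= ?add0r.
Qed.

Lemma L2pi0 : L2pi (0 : L2fun mu E) = 0.
Proof. by rewrite -(subrr (L2pi (0 : L2fun mu E))) -L2piB subrr. Qed.

Lemma Cut_orth s r t u v : '[Cut s r u, Cut r t v] = 0.
Proof.
rewrite -[u]L2reprK -[v]L2reprK !Cut_pi inner_pi.
rewrite (eq_L2form (g1 := 0) (g2 := 0)) -?inner_pi ?L2pi0 ?inner0l// => q /=.
rewrite inner0l /in_layer; case: ifP => [/andP[_ qr]|_]; last by rewrite inner0l.
by rewrite ltNge (ltW qr)/= inner0r.
Qed.

Lemma Cut_disjoint s t s' t' u : t <= s' -> Cut s' t' (Cut s t u) = 0.
Proof.
move=> ts; rewrite -[u]L2reprK !Cut_pi -L2pi0; congr L2pi; apply/val_inj/funext => q /=.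
rewrite /in_layer; case: ifP => // /andP[sq _].
by rewrite [_ < t]ltNge (ltW (le_lt_trans ts sq)) andbF.
Qed.

Lemma nrm_Cut_split s r t u : s <= r -> r <= t ->
  nrm (Cut s t u) ^+ 2 = nrm (Cut s r u) ^+ 2 + nrm (Cut r t u) ^+ 2.
Proof. by move=> sr rt; rewrite (Cut_split _ sr rt) nrmD2 Cut_orth mulr0 addr0. Qed.

Lemma nrm_L2pi_le s t c (f : L2fun mu E) : 0 <= s -> s <= t -> 0 <= c ->
  (forall r, ~~ in_layer s t r -> f r = 0) ->
  {ae mu, forall r, in_layer s t r -> nrm (f r) ^+ 2 <= c} ->
  nrm (L2pi f) ^+ 2 <= c * (t - s).
Proof.
move=> s0 st c0 f0 fc; rewrite -lee_fin L2nrm_pi_ereal.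
have ml : measurable (lay s t) by exact: measurable_layer hl s t.
have AF := ae_filter_ringOfSetsType mu.
apply: le_trans (_ : \int[mu]_r ((cst c%:E) \_ (lay s t)) r <= _)%E; last first.
  by rewrite integral_layer_cst (mu_layer hl)// EFinM.
apply: ae_ge0_le_integral => //.
- by move=> r _; rewrite lee_fin sqr_ge0.
- apply/measurable_EFinP; apply: measurable_funX.
  exact: strongly_measurable_nrm (L2fun_meas f).
- by move=> r _; rewrite patchE; case: ifP => // _; rewrite lee_fin.
- exact: (measurable_restrictT (cst c%:E) ml).1.
- apply: filterS fc => r fr _; rewrite patchE mem_layer.
  case: ifPn => [/fr|/f0 ->]; first by rewrite lee_fin.
  by rewrite nrm0 expr0n.
Qed.

Lemma nrm_Step s t x : 0 <= s -> s <= t -> nrm (Step s t x) ^+ 2 = (t - s) * nrm x ^+ 2.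
Proof.
move=> s0 st; apply: EFin_inj; rewrite L2nrm_pi_ereal.
have -> : (fun r => ((nrm (stepf s t x r)) ^+ 2)%:E) =
    (cst (nrm x ^+ 2)%:E) \_ (lay s t) :> (R -> \bar R).
  apply/funext => r; rewrite patchE mem_layer /=; case: ifP => // _.
  by rewrite nrm0 expr0n.
by rewrite integral_layer_cst (mu_layer hl)// -EFinM mulrC.
Qed.

(** The truncations to distance at most [n] tend to the function: dominated
    convergence. *)
Lemma Cut_cvg u (d : R) : 0 < d -> exists N : nat, forall n : nat, (N <= n)%N ->
  nrm (u - Cut 0 n%:R u) < d.
Proof.
move=> d0; pose f := L2repr u.
pose F (n : nat) r : \bar R := (nrm ((f - cutf 0 n%:R f) r) ^+ 2)%:E.
have AF := ae_filter_ringOfSetsType mu.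
have mF n : measurable_fun setT (F n).
  apply/measurable_EFinP; apply: measurable_funX.
  exact: strongly_measurable_nrm (L2fun_meas (f - cutf 0 n%:R f)).
have FE n r : F n r = if in_layer 0 n%:R r then 0%E else (nrm (f r) ^+ 2)%:E.
  rewrite /F [(f - _) r](_ : _ = f r - if in_layer 0 n%:R r then f r else 0)//.
  by case: ifP; rewrite ?subr0// subrr nrm0 expr0n.
have F0 : {ae mu, forall r, setT r -> F ^~ r @ \oo --> (cst 0%E : R -> \bar R) r}.
  apply: filterS (ae_half_line hl) => r r0 _.
  apply: cvg_near_cst; exists (Num.trunc (sg * r)).+1 => // n /= rn.
  rewrite FE /in_layer r0/= (lt_le_trans (Num.Theory.truncnS_gt _)) ?eqxx//.
  by rewrite ler_nat.
have Fd : {ae mu, forall r n, setT r -> (`|F n r| <= (nrm (f r) ^+ 2)%:E)%E}.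
  apply: nearW => r n _; rewrite FE; case: ifP => _; first by rewrite abse0 lee_fin sqr_ge0.
  by rewrite gee0_abs ?lee_fin ?sqr_ge0.
have [_ _] := dominated_convergence (mu := mu) measurableT mF
  (measurable_cst _) F0 (L2fun_int f) Fd.
rewrite integral_cst// mul0e => /fine_cvgP[_ /cvgrPdist_lt/(_ (d ^+ 2))].
rewrite exprn_gt0// => /(_ isT)[N _ NP]; exists N => n Nn; have H := NP n Nn.
rewrite -ltr_sqr ?nnegrE ?nrm_ge0 ?ltW//.
have -> : nrm (u - Cut 0 n%:R u) ^+ 2 = \int[mu]_r (nrm ((f - cutf 0 n%:R f) r) ^+ 2).
  by rewrite -L2nrm_pi L2piB -[u in LHS]L2reprK Cut_pi.
move: H; rewrite sub0r normrN; apply: le_lt_trans; exact: ler_norm.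
Qed.

Lemma measurable_Re_inner (f : R -> E) e : strongly_measurable f ->
  measurable_fun setT (fun r => Re '[f r, e]).
Proof.
move=> mf; have -> : (fun r => Re '[f r, e]) = (fun r => 2^-1 *
    (nrm (f r - - e) ^+ 2 - nrm (f r) ^+ 2 - nrm e ^+ 2)).
  by apply/funext => r; rewrite Re_inner opprK.
apply: measurable_funM => //; apply: measurable_funB => //; apply: measurable_funB.
  by apply: measurable_funX; exact: strongly_measurable_nrmB.
by apply: measurable_funX; exact: strongly_measurable_nrm.
Qed.

Lemma measurable_Im_inner (f : R -> E) e : strongly_measurable f ->
  measurable_fun setT (fun r => Im '[f r, e]).
Proof.
move=> mf; have -> : (fun r => Im '[f r, e]) = (fun r => Re '[f r, 'i%C *: e]).
  by apply/funext => r; rewrite Im_inner.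
exact: measurable_Re_inner.
Qed.

(** Pairing with a step function integrates over an interval; the closed
    interval of a weak integral and the open layer differ by two points. *)
Lemma inner_step_integral s t (f : L2fun mu E) e : 0 <= s -> s <= t ->
  '[L2pi f, Step s t e] = Cintegral leb
    (if sg == 1 then `[s, t]%classic else `[-t, -s]%classic) (fun r => '[f r, e]).
Proof.
move=> s0 st; rewrite inner_pi /L2form /Cintegral.
have ml : measurable (lay s t) by exact: measurable_layer hl s t.
have key (p : R[i] -> R) : p 0 = 0 -> measurable_fun setT (fun r => p '[f r, e]) ->
    \int[mu]_r p '[f r, stepf s t e r] =
    \int[leb]_(r in if sg == 1 then `[s, t]%classic else `[-t, -s]%classic) p '[f r, e].
  move=> p0 mp; have -> : (fun r => p '[f r, stepf s t e r]) =
      (fun r => p '[f r, e]) \_ (lay s t).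
    apply/funext => r; rewrite patchE mem_layer /=; case: ifP => // _.
    by rewrite inner0r p0.
  have mI (D : set R) : measurable_fun D (fun r => (p '[f r, e])%:E).
    by apply/measurable_EFinP; exact: measurable_funTS.
  rewrite -Rintegral_mkcond /Rintegral leb_on_integral; last exact: layer_sub.
  congr fine; rewrite (layerE hl); case: (sg == 1).
    by rewrite integral_itv_bndo_bndc// integral_itv_obnd_cbnd.
  by rewrite integral_itv_bndo_bndc// integral_itv_obnd_cbnd.
rewrite (key Re) ?(key Im)//.
  exact: measurable_Im_inner (L2fun_meas f).
exact: measurable_Re_inner (L2fun_meas f).
Qed.

End half_line_L2.

(** * The first order Sobolev space of a half-line *)

Section sobolev_half_line.
Context (R : realType) (i : interval R) (sg : R) (hl : half_line i sg).
Context (E : hilbertType R).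
Local Notation mu := (leb_on i).
Local Notation leb := (@lebesgue_measure R).
Local Notation L2i := (L2 mu E).
Local Notation Step := (Step hl (E := E)).
Local Notation Cut := (Cut hl (E := E)).
Implicit Types (u v g : L2i) (f : L2fun mu E) (x y e : E) (s t r : R) (W Y : R -> E).

(** Absolutely continuous representatives, with both half-lines parametrized by
    the distance from [0]. The weak integral of [g] over a segment is written as a
    pairing with a step function, so that norm estimates in [L^2] apply to it. *)
Definition dist_rep v g W := {ae mu, forall r, W (sg * r) = L2repr v r} /\
  forall s t, 0 <= s -> s <= t -> forall e, '[W t - W s, e] = '[g, Step s t e].

(** The factor between the derivative in the distance and the derivative in the
    variable of the half-line. *)
Definition sgC : R[i] := sg%:C.

Lemma sgC_sqr : sgC * sgC = 1.
Proof. by rewrite /sgC -rmorphM (sg_sqr hl). Qed.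

Lemma sgC_conj : sgC^* = sgC.
Proof. by apply: complex_eq => //=; rewrite oppr0. Qed.

Lemma segment_integral s t g e : 0 <= s -> s <= t ->
  Cintegral leb (if sg == 1 then `[s, t]%classic else `[-t, -s]%classic)
    (fun r => '[L2repr g r, e]) = '[g, Step s t e].
Proof. by move=> s0 st; rewrite -[g in RHS]L2reprK (inner_step_integral hl). Qed.

Lemma ac_rep_dist v g (w : R -> E) : ac_rep v g w ->
  dist_rep v (sgC *: g) (fun t => w (sg * t)).
Proof.
move=> [vw wg]; split.
  have AF := ae_filter_ringOfSetsType mu; apply: filterS vw => r <-.
  by rewrite (sgK hl).
have cl r : 0 <= r -> closure [set` i] (sg * r).
  by move=> r0; rewrite (closure_half_lineE hl) /= (sgK hl).
move=> s t s0 st e; have t0 := le_trans s0 st.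
rewrite innerZl -segment_integral//; have [_ [sgE|sgE]] := hl.
  have -> : sgC = 1 by rewrite /sgC sgE.
  rewrite sgE eqxx !mul1r; apply: wg => //.
    by have := cl _ s0; rewrite sgE mul1r.
  by have := cl _ t0; rewrite sgE mul1r.
have sgCE : sgC = -1 by rewrite /sgC sgE rmorphN1.
have -> : (sg == 1) = false by rewrite sgE lt_eqF.
have -> : w (sg * t) - w (sg * s) = sgC *: (w (- s) - w (- t)).
  by rewrite sgCE sgE !mulN1r scaleN1r opprB.
rewrite innerZl; congr (_ * _); apply: wg; rewrite ?lerN2//.
  by rewrite -mulN1r -sgE; exact: cl.
by rewrite -mulN1r -sgE; exact: cl.
Qed.

Lemma dist_rep_ac v g W : dist_rep v g W ->
  ac_rep v (sgC *: g) (fun r => W (sg * r)).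
Proof.
move=> [vW Wg]; split=> // s t; rewrite (closure_half_lineE hl) /= => s0 t0 st e.
have [_ [sgE|sgE]] := hl; rewrite sgE ?mul1r ?mulN1r in s0 t0 *.
  have sg1 : sg == 1 by rewrite sgE.
  have sgCE : sgC = 1 by rewrite /sgC sgE.
  have := segment_integral (sgC *: g) e s0 st; rewrite sg1 => ->.
  by rewrite sgCE scale1r Wg.
have st' : - t <= - s by rewrite lerN2.
have sgCE : sgC = -1 by rewrite /sgC sgE rmorphN1.
have := segment_integral (sgC *: g) e t0 st'.
have -> : (sg == 1) = false by rewrite sgE lt_eqF.
rewrite !opprK => ->.
by rewrite innerZl -Wg// sgCE -innerZl scaleN1r opprB.
Qed.

Lemma dist_repP (a : R[i]) v g W v' g' W' : dist_rep v g W -> dist_rep v' g' W' ->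
  dist_rep (a *: v + v') (a *: g + g') (fun t => a *: W t + W' t).
Proof.
move=> [vW Wg] [vW' Wg']; split.
  have AF := ae_filter_ringOfSetsType mu.
  have h := L2pi_repr_ae (a *: L2repr v + L2repr v').
  have vE : L2pi (a *: L2repr v + L2repr v') = a *: v + v'.
    by rewrite L2piD L2piZ !L2reprK.
  near=> r; rewrite -vE (near h r)//=.
  rewrite [RHS](_ : _ = a *: L2repr v r + L2repr v' r)//.
  by congr (_ *: _ + _); [exact: (near vW r)|exact: (near vW' r)].
move=> s t s0 st e; rewrite innerP -(Wg s t)// -(Wg' s t)// -innerP.
by congr '[_, _]; rewrite scalerBr opprD addrACA.
Unshelve. all: by end_near. Qed.

Section one_function.
Context (v g : L2i) (W : R -> E) (vW : dist_rep v g W).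

(** Cauchy-Schwarz for the pairing of [g] with a step function. *)
Lemma dist_rep_increment s t : 0 <= s -> s <= t ->
  nrm (W t - W s) ^+ 2 <= (t - s) * nrm (Cut s t g) ^+ 2.
Proof.
move=> s0 st; set x := W t - W s.
have := Re_le_CS (Cut s t g) (Step s t x).
rewrite -inner_Step -(vW.2 s t s0 st) -/x Re_inner_nrm => h.
have [->|x0] := eqVneq (nrm x) 0.
  by rewrite expr0n/= mulr_ge0 ?subr_ge0 ?sqr_ge0.
have x1 : 0 < nrm x ^+ 2 by rewrite exprn_gt0// lt_def x0 nrm_ge0.
rewrite -(ler_pM2r x1) -expr2 -mulrA mulrCA -(nrm_Step hl x s0 st) -exprMn.
by rewrite ler_sqr ?nnegrE ?mulr_ge0 ?nrm_ge0 ?sqr_ge0.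
Qed.

(** On a short layer [v] is close to the constant [W p], with an error one order
    smaller than the length: this replaces pointwise differentiation. *)
Lemma dist_rep_step s t p : 0 <= s -> s <= p -> p <= t ->
  nrm (Cut s t v - Step s t (W p)) <= (t - s) * nrm (Cut s t g).
Proof.
move=> s0 sp pt; have st := le_trans sp pt.
rewrite -ler_sqr ?nnegrE ?mulr_ge0 ?nrm_ge0 ?subr_ge0//.
rewrite exprMn expr2 mulrAC -L2piB.
have c0 : 0 <= (t - s) * nrm (Cut s t g) ^+ 2 by rewrite mulr_ge0 ?subr_ge0 ?sqr_ge0.
apply: (nrm_L2pi_le hl s0 st c0).
  move=> r /negbTE rl; rewrite [LHS](_ : _ = (if in_layer sg s t r then L2repr v r else 0) -
    (if in_layer sg s t r then W p else 0))// rl subrr//.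
have AF := ae_filter_ringOfSetsType mu; apply: filterS vW.1 => r vr rl.
rewrite [X in nrm X](_ : _ = (if in_layer sg s t r then L2repr v r else 0) -
  (if in_layer sg s t r then W p else 0))// rl -vr.
move: rl; rewrite /in_layer => /andP[sr rt].
have mono a b : s <= a -> a <= b -> b <= t ->
    nrm (W b - W a) ^+ 2 <= (t - s) * nrm (Cut s t g) ^+ 2.
  move=> sa ab bt; apply: le_trans (dist_rep_increment (le_trans s0 sa) ab) _.
  rewrite ler_pM ?subr_ge0 ?sqr_ge0 ?lerB// ler_sqr ?nnegrE ?nrm_ge0//.
  exact: Cut_mono.
case: (leP p (sg * r)) => pr; first by apply: mono => //; exact: ltW.
by rewrite nrmB; apply: mono => //; exact: ltW.
Qed.

(** [v] and [g] are small in [L^2] of the [n]-th unit layer, and [W n] is close to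
    [v] there. *)
Lemma dist_rep_decay (d : R) : 0 < d -> exists N : nat, forall n : nat, (N <= n)%N ->
  nrm (W n%:R) < d.
Proof.
move=> d0; have d20 : 0 < d / 2 by rewrite divr_gt0.
have tail (u : L2i) : exists N : nat, forall n : nat, (N <= n)%N ->
    nrm (Cut n%:R n.+1%:R u) < d / 2.
  have [N NP] := Cut_cvg hl u d20; exists N => n Nn.
  have h1 : 0 <= N%:R :> R by [].
  have h2 : N%:R <= n%:R :> R by rewrite ler_nat.
  have h3 : n%:R <= n.+1%:R :> R by rewrite ler_nat.
  apply: le_lt_trans (NP N (leqnn N)).
  rewrite (_ : Cut _ _ u = Cut n%:R n.+1%:R (u - Cut 0 N%:R u)); first exact: nrm_Cut.
  by rewrite CutB Cut_disjoint ?subr0.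
have [N1 N1P] := tail v; have [N2 N2P] := tail g.
exists (maxn N1 N2) => n; rewrite geq_max => /andP[Nn1 Nn2].
have n0 : 0 <= n%:R :> R by [].
have n1 : n%:R <= n.+1%:R :> R by rewrite ler_nat.
have -> : nrm (W n%:R) = nrm (Step n%:R n.+1%:R (W n%:R)).
  apply/eqP; rewrite -(eqrXn2 (n := 2)) ?nrm_ge0// (nrm_Step hl)//.
  by rewrite -natr1 addrC addKr mul1r.
rewrite (_ : Step _ _ _ = Cut n%:R n.+1%:R v - (Cut n%:R n.+1%:R v - Step n%:R n.+1%:R (W n%:R))); last first.
  by rewrite opprB addrC subrK.
apply: le_lt_trans (nrmD _ _) _; rewrite nrmN (splitr d) ltr_leD ?N1P//.
apply: le_trans (dist_rep_step n0 (lexx _) n1) _.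
rewrite (_ : n.+1%:R - n%:R = 1 :> R); last by rewrite -natr1 addrC addKr.
by rewrite mul1r; exact/ltW/N2P.
Qed.

End one_function.

(** An increment bound with the factor [t - s] forces a function to be constant:
    cut the interval into [n] equal pieces. *)
Lemma flat_of_increments (F M : R -> R) (T : R) : 0 <= T ->
  (forall s t, 0 <= s -> s <= t -> `|F t - F s| <= (t - s) * (M t - M s)) ->
  F T = F 0.
Proof.
move=> T0 FM; apply/eqP; rewrite -subr_eq0 -normr_le0; apply/ler_addgt0Pr => e e0.
rewrite add0r; pose K := T * `|M T - M 0|.
have K0 : 0 <= K by rewrite mulr_ge0.
pose n := (Num.trunc (K / e)).+1; pose d := T / n%:R.
have n0 : 0 < n%:R :> R by rewrite ltr0n.
have d0 : 0 <= d by rewrite divr_ge0// ltW.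
have step (k : nat) : `|F (k%:R * d) - F 0| <= d * (M (k%:R * d) - M 0).
  elim: k => [|k IH]; first by rewrite mul0r !subrr normr0 mulr0.
  have kd : k%:R * d <= k.+1%:R * d by rewrite ler_wpM2r// ler_nat.
  have := FM (k%:R * d) (k.+1%:R * d) (mulr_ge0 (ler0n _ _) d0) kd.
  rewrite (_ : k.+1%:R * d - k%:R * d = d); last by rewrite -mulrBl -natr1 addrC addKr mul1r.
  move=> h; rewrite (_ : F _ - F 0 = (F (k.+1%:R * d) - F (k%:R * d)) + (F (k%:R * d) - F 0)).
    apply: le_trans (ler_normD _ _) _; apply: le_trans (lerD h IH) _.
    by rewrite -mulrDr addrA subrK.
  by rewrite addrA subrK.
have := step n; rewrite mulrC divfK ?gt_eqF// => /le_trans; apply.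
apply: le_trans (_ : K / n%:R <= _).
  rewrite (_ : K / n%:R = d * `|M T - M 0|); last by rewrite /K /d mulrAC.
  by rewrite ler_wpM2l// ler_norm.
rewrite ler_pdivrMr// mulrC -ler_pdivrMr// ltW//.
exact: Num.Theory.truncnS_gt.
Qed.

(** Integration by parts up to distance [T]. On a short layer the defect is
    bounded by its length times the [L^2] norms of the derivatives there
    ([dist_rep_step]), which [flat_of_increments] turns into [0]. *)
Lemma dist_rep_product v g W u h Y (T : R) : dist_rep v g W -> dist_rep u h Y -> 0 <= T ->
  Re '[W T, Y T] - Re '[W 0, Y 0] = Re '[Cut 0 T g, u] + Re '[v, Cut 0 T h].
Proof.
move=> vW uY T0.
pose F t := Re '[W t, Y t] - Re '[Cut 0 t g, u] - Re '[v, Cut 0 t h].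
pose M t := nrm (Cut 0 t g) ^+ 2 + nrm (Cut 0 t h) ^+ 2.
suff : F T = F 0.
  have C0 (f : L2i) : Cut 0 0 f = 0.
    rewrite -[f]L2reprK Cut_pi -L2pi0; congr L2pi; apply/val_inj/funext => q /=.
    by rewrite /in_layer; case: ltgtP.
  rewrite /F !C0 inner0l inner0r /= => /eqP; rewrite !subr0 -addrA -opprD subr_eq => /eqP ->.
  by rewrite addrAC subrr add0r.
apply: (flat_of_increments T0 (M := M)) => s t s0 st.
have -> : F t - F s = Re '[Cut s t g, Step s t (Y t) - Cut s t u] +
    Re '[Step s t (W s) - Cut s t v, Cut s t h].
  rewrite /F (Cut_split hl g s0 st) (Cut_split hl h s0 st).
  have e1 : '[W t, Y t] - '[W s, Y s] = '[Cut s t g, Step s t (Y t)] +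
      '[Step s t (W s), Cut s t h].
    have a1 : '[Cut s t g, Step s t (Y t)] = '[W t - W s, Y t].
      by rewrite -inner_Step (vW.2 s t).
    have a2 : '[Step s t (W s), Cut s t h] = '[W s, Y t - Y s].
      by rewrite innerC -inner_Step -(uY.2 s t)// -innerC.
    by rewrite a1 a2 innerBl innerBr addrA subrK.
  have e2 : '[Cut s t v, Cut s t h] = '[v, Cut s t h].
    by rewrite -Cut_inner Cut_innerC.
  have := congr1 Re e1; rewrite innerBr innerBl innerDl innerDr -Cut_inner e2.
  case: '[W t, Y t] => ? ?; case: '[W s, Y s] => ? ?; case: '[Cut s t g, Step _ _ _] => ? ?.
  case: '[Step _ _ _, Cut s t h] => ? ?; case: '[Cut 0 s g, u] => ? ?.
  case: '[Cut s t g, u] => ? ?; case: '[v, Cut 0 s h] => ? ?; case: '[v, Cut s t h] => ? ? /=.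
  lra.
have h1 := Re_CS (Cut s t g) (Step s t (Y t) - Cut s t u).
have h2 := Re_CS (Step s t (W s) - Cut s t v) (Cut s t h).
have h3 := dist_rep_step uY s0 st (lexx t).
have h4 := dist_rep_step vW s0 (lexx s) st.
rewrite nrmB in h3; rewrite nrmB in h4.
have -> : M t - M s = nrm (Cut s t g) ^+ 2 + nrm (Cut s t h) ^+ 2.
  rewrite /M (nrm_Cut_split hl g s0 st) (nrm_Cut_split hl h s0 st).
  by ring.
apply: le_trans (ler_normD _ _) _; apply: le_trans (lerD h1 h2) _.
have ts : 0 <= t - s by rewrite subr_ge0.
have g0 := nrm_ge0 (Cut s t g); have hh0 := nrm_ge0 (Cut s t h).
apply: le_trans (_ : nrm (Cut s t g) * ((t - s) * nrm (Cut s t h)) +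
  (t - s) * nrm (Cut s t g) * nrm (Cut s t h) <= _).
  by rewrite lerD ?ler_wpM2l ?ler_wpM2r.
have := sqr_ge0 (nrm (Cut s t g) - nrm (Cut s t h)).
move: (nrm (Cut s t g)) (nrm (Cut s t h)) (t - s) ts => a b c c0 ab.
rewrite mulrCA -mulrA -mulrDr ler_wpM2l//; lra.
Qed.

(** Let [T] tend to infinity along the integers. *)
Lemma dist_rep_green_Re v g W u h Y : dist_rep v g W -> dist_rep u h Y ->
  Re '[g, u] + Re '[v, h] = - Re '[W 0, Y 0].
Proof.
move=> vW uY; apply/eqP; rewrite -addr_eq0 -normr_le0; apply/ler_addgt0Pr => e e0.
rewrite add0r.
pose d := Num.min 1 (e / (nrm u + nrm v + 2)).
have k0 : 0 < nrm u + nrm v + 2 by rewrite ltr_wpDl ?addr_ge0 ?nrm_ge0.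
have d0 : 0 < d by rewrite lt_min ltr01 divr_gt0.
have [N1 N1P] := dist_rep_decay vW d0; have [N2 N2P] := dist_rep_decay uY ltr01.
have [N3 N3P] := Cut_cvg hl g d0; have [N4 N4P] := Cut_cvg hl h d0.
pose n := maxn (maxn N1 N2) (maxn N3 N4).
have := dist_rep_product vW uY (ler0n R n).
have gn := N3P n ltac:(by rewrite /n !leq_max leqnn ?orbT).
have hn := N4P n ltac:(by rewrite /n !leq_max leqnn ?orbT).
have Wn := N1P n ltac:(by rewrite /n !leq_max leqnn ?orbT).
have Yn := N2P n ltac:(by rewrite /n !leq_max leqnn ?orbT).
have e1 : '[Cut 0 n%:R g, u] = '[g, u] - '[g - Cut 0 n%:R g, u].
  by rewrite innerBl opprB addrC subrK.
have e2 : '[v, Cut 0 n%:R h] = '[v, h] - '[v, h - Cut 0 n%:R h].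
  by rewrite innerBr opprB addrC subrK.
have ReB (a b : R[i]) : Re (a - b) = Re a - Re b by case: a b => ? ? [].
rewrite e1 e2 !ReB.
have c1 := Re_CS (g - Cut 0 n%:R g) u; have c2 := Re_CS v (h - Cut 0 n%:R h).
have c3 := Re_CS (W n%:R) (Y n%:R).
have b1 : nrm (g - Cut 0 n%:R g) * nrm u <= d * nrm u.
  by rewrite ler_wpM2r ?nrm_ge0// ltW.
have b2 : nrm v * nrm (h - Cut 0 n%:R h) <= nrm v * d.
  by rewrite ler_wpM2l ?nrm_ge0// ltW.
have b3 : nrm (W n%:R) * nrm (Y n%:R) <= d * 1.
  by rewrite ler_pM ?nrm_ge0// ltW.
have de : d * (nrm u + nrm v + 2) <= e.
  by rewrite -ler_pdivlMr// /d ge_min lexx orbT.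
move: c1 c2 c3 b1 b2 b3 de; move: (nrm (g - _) * _) (_ * nrm (h - _)) (nrm (W _) * _).
move=> p q r; rewrite !ler_norml => /andP[c1 c1'] /andP[c2 c2'] /andP[c3 c3'] b1 b2 b3 de.
by move=> prod; apply/andP; split; lra.
Qed.

Lemma dist_repZ (a : R[i]) v g W : dist_rep v g W ->
  dist_rep (a *: v) (a *: g) (fun t => a *: W t).
Proof.
move=> vW; have z0 : dist_rep 0 0 (fun=> 0).
  split=> [|s t s0 st e]; last by rewrite subrr !inner0l.
  have AF := ae_filter_ringOfSetsType mu.
  by apply: filterS (L2pi_repr_ae (0 : L2fun mu E)) => r; rewrite L2pi0 => ->.
have := dist_repP a vW z0; rewrite !addr0.
by rewrite (_ : (fun t => a *: W t + 0) = (fun t => a *: W t))//; apply/funext => t; rewrite addr0.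
Qed.

Lemma dist_rep_green v g W u h Y : dist_rep v g W -> dist_rep u h Y ->
  '[g, u] + '[v, h] = - '[W 0, Y 0].
Proof.
move=> vW uY; have h1 := dist_rep_green_Re vW uY.
have := dist_rep_green_Re vW (dist_repZ 'i%C uY); rewrite -!Im_inner => h2.
apply: complex_eq.
  by rewrite raddfD raddfN.
by rewrite raddfD raddfN.
Qed.

End sobolev_half_line.

Section half_line_derivative.
Context (R : realType) (i : interval R) (sg : R) (hl : half_line i sg).
Context (E : hilbertType R).
Local Notation mu := (leb_on i).
Local Notation leb := (@lebesgue_measure R).
Local Notation L2i := (L2 mu E).
Local Notation Step := (Step hl (E := E)).
Local Notation Cut := (Cut hl (E := E)).
Local Notation dist_rep := (dist_rep hl).
Implicit Types (u v g : L2i) (f : L2fun mu E) (x y e : E) (s t r : R) (W Y : R -> E).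

Definition dist_deriv v g e := exists2 W, dist_rep v g W & W 0 = e.

Lemma dist_derivP (a : R[i]) v g e v' g' e' : dist_deriv v g e -> dist_deriv v' g' e' ->
  dist_deriv (a *: v + v') (a *: g + g') (a *: e + e').
Proof.
move=> [W vW We] [W' vW' We']; exists (fun t => a *: W t + W' t).
  exact: dist_repP.
by rewrite We We'.
Qed.

Lemma dist_derivB v g e v' g' e' : dist_deriv v g e -> dist_deriv v' g' e' ->
  dist_deriv (v - v') (g - g') (e - e').
Proof.
move=> h h'; have := dist_derivP (-1) h' h; rewrite !scaleN1r.
by rewrite addrC [- g' + g]addrC [- e' + e]addrC.
Qed.

Lemma dist_deriv0 : dist_deriv 0 0 0.
Proof.
exists (fun=> 0) => //; split=> [|s t s0 st e]; last by rewrite subrr !inner0l.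
have AF := ae_filter_ringOfSetsType mu.
by apply: filterS (L2pi_repr_ae (0 : L2fun mu E)) => r; rewrite L2pi0 => ->.
Qed.

Lemma dist_deriv_green v g e v' g' e' : dist_deriv v g e -> dist_deriv v' g' e' ->
  '[g, v'] + '[v, g'] = - '[e, e'].
Proof. by move=> [W vW <-] [W' vW' <-]; exact: (dist_rep_green vW vW'). Qed.

(** Approximate the scalar by rationals. *)
Lemma strongly_measurable_scale (a : R -> R) x : measurable_fun setT a ->
  strongly_measurable (fun r => (a r)%:C *: x).
Proof.
move=> ma; apply/strongly_measurableP.
have nrmE (c : R) : nrm (c%:C *: x) = `|c| * nrm x.
  by rewrite nrmZ normc_def/= expr0n addr0 sqrtr_sqr.
pose q n : R := if unpickle n is Some p then ratr (p : rat) else 0.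
exists (fun n => (q n)%:C *: x) => [r e e0|n]; last first.
  have -> : (fun r => nrm ((a r)%:C *: x - (q n)%:C *: x)) =
      (fun r => `|a r - q n| * nrm x).
    by apply/funext => r; rewrite -scalerBl -rmorphB nrmE.
  apply: measurable_funM => //; apply: measurableT_comp => //.
  exact: measurable_funB.
have n1 : 0 < nrm x + 1 by rewrite ltr_wpDl ?nrm_ge0.
have d0 : 0 < e / (nrm x + 1) by rewrite divr_gt0.
have ltd : a r - e / (nrm x + 1) < a r + e / (nrm x + 1).
  by move: (e / _) d0 => d d0; lra.
have [p] := rat_in_itvoo ltd.
rewrite in_itv/= => /andP[h1 h2]; exists (pickle p).
rewrite /q pickleK -scalerBl -rmorphB nrmE.
have ap : `|a r - ratr p| < e / (nrm x + 1).
  by rewrite ltr_norml; apply/andP; split; lra.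
apply: le_lt_trans (_ : `|a r - ratr p| * (nrm x + 1) < e).
  by rewrite ler_wpM2l// lerDl.
by rewrite -ltr_pdivlMr.
Qed.

Section exponentials.
Context (lam : R) (lam0 : 0 < lam).

Lemma exp_L2 x : (fun r => (expd sg lam r)%:C *: x) \in L2fun_pred mu (E := E).
Proof.
have mf := strongly_measurable_scale x (measurable_expd sg lam).
apply/L2funP; split=> //.
have -> : (fun r => (nrm ((expd sg lam r)%:C *: x) ^+ 2)%:E) =
    EFin \o (fun r => nrm x ^+ 2 * expd sg (2 * lam) r).
  apply/funext => r /=; congr EFin.
  rewrite nrmZ normc_def/= expr0n addr0 sqrtr_sqr ger0_norm ?expR_ge0//.
  by rewrite exprMn expdM mulrC.
by apply: integrable_EFinZ; apply: integrable_expd => //; rewrite mulr_gt0.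
Qed.
Definition expf x := MkL2fun (exp_L2 x).
Definition Exp x : L2i := L2pi (expf x).

Lemma dist_rep_Exp x : dist_rep (Exp x) (- (lam%:C *: Exp x))
  (fun t => (expR (- (lam * t)))%:C *: x).
Proof.
split.
  have AF := ae_filter_ringOfSetsType mu.
  by apply: filterS (L2pi_repr_ae (expf x)) => r ->.
move=> s t s0 st e; rewrite innerNl innerZl inner_step_integral// -scalerBl -rmorphB innerZl.
set c := '[x, e]; set D := (if _ then _ else _).
have ID : \int[leb]_(r in D) expd sg lam r = (expR (- (lam * s)) - expR (- (lam * t))) / lam.
  have ln0 : lam != 0 by rewrite gt_eqF.
  rewrite /D; have [_ [sgE|sgE]] := hl.
    have -> : sg == 1 by rewrite sgE.
    rewrite (@eq_Rintegral _ _ _ leb _ (fun r => expR (- lam * r))); last first.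
      by move=> r _; rewrite /expd sgE mul1r mulNr.
    by rewrite integral_expR ?oppr_eq0// !mulNr; field.
  have -> : (sg == 1) = false by rewrite sgE lt_eqF.
  rewrite (@eq_Rintegral _ _ _ leb _ (fun r => expR (lam * r))); last first.
    by move=> r _; rewrite /expd sgE mulN1r mulrN opprK.
  by rewrite integral_expR ?lerN2// !mulrN.
have iD : leb.-integrable D (EFin \o expd sg lam).
  have cD (a b : R) : leb.-integrable `[a, b]%classic (EFin \o expd sg lam).
    apply: continuous_compact_integrable; first exact: segment_compact.
    by apply: continuous_subspaceT; exact: continuous_expd.
  by rewrite /D; case: ifP.
have mD : measurable D by rewrite /D; case: ifP.
have key (p : R) : \int[leb]_(r in D) (p * expd sg lam r) =
    p * ((expR (- (lam * s)) - expR (- (lam * t))) / lam).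
  by rewrite RintegralZl// ID.
have -> : Cintegral leb D (fun r => '[expf x r, e]) =
    c * ((expR (- (lam * s)) - expR (- (lam * t))) / lam)%:C.
  have cE r : '[expf x r, e] = (expd sg lam r)%:C * c by rewrite -innerZl.
  apply: complex_eq => /=.
    rewrite (@eq_Rintegral _ _ _ leb _ (fun r => Re c * expd sg lam r)) ?key.
      by case: (c) => p q /=; rewrite mulr0 subr0.
    by move=> r _; rewrite cE; case: (c) => p q /=; rewrite mul0r subr0 mulrC.
  rewrite (@eq_Rintegral _ _ _ leb _ (fun r => Im c * expd sg lam r)) ?key.
    by case: (c) => p q /=; rewrite mulr0 add0r.
  by move=> r _; rewrite cE; case: (c) => p q /=; rewrite mul0r addr0 mulrC.
have l0 : lam != 0 by rewrite gt_eqF.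
rewrite [LHS](_ : _ = (expR (- (lam * t)) - expR (- (lam * s)))%:C * c)//.
have -> : (expR (- (lam * t)) - expR (- (lam * s)))%:C =
    - (lam%:C * ((expR (- (lam * s)) - expR (- (lam * t))) / lam)%:C).
  by rewrite -rmorphM -rmorphN; congr (_%:C); field.
by rewrite mulNr -mulrA [X in lam%:C * X]mulrC.
Qed.

Lemma dist_deriv_Exp x : dist_deriv (Exp x) (- (lam%:C *: Exp x)) x.
Proof.
exists (fun t => (expR (- (lam * t)))%:C *: x); first exact: dist_rep_Exp.
by rewrite mulr0 oppr0 expR0 scale1r.
Qed.

End exponentials.

(** The exponentials [exp (- lam * d) x] with large [lam] are total: apply the
    uniqueness of Laplace transforms to [Re <u r, x>], for [x] in a countable set
    dense in the range of [u]. *)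
Lemma Exp_total u (l : R) : 0 <= l ->
  (forall lam (lam0 : 0 < lam), l < lam -> forall x, '[u, Exp lam0 x] = 0) -> u = 0.
Proof.
move=> l0 uE; have AF := ae_filter_ringOfSetsType mu.
have ux x : {ae mu, forall r, Re '[L2repr u r, x] = 0}.
  have mx : measurable_fun setT (fun r => Re '[L2repr u r, x]).
    exact: (measurable_Re_inner x (L2fun_meas (L2repr u))).
  have RE lam : (fun r => Re '[L2repr u r, x] * expd sg lam r) =
      (fun r => Re '[L2repr u r, (expd sg lam r)%:C *: x]).
    apply/funext => r; rewrite innerZr; case: '[_, _] => p q /=.
    by rewrite oppr0 mul0r subr0 mulrC.
  apply: (laplace_unique hl (l := l) mx) => lam llam; have lam0 := le_lt_trans l0 llam.
    by rewrite RE; exact: (integrable_Re (L2repr u) (expf lam0 x)).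
  have := congr1 Re (uE lam lam0 llam x); rewrite -{1}[u]L2reprK inner_pi /= => h.
  by rewrite RE.
have /strongly_measurableP[x xd _] := L2fun_meas (L2repr u).
have aeu : {ae mu, forall r n, Re '[L2repr u r, x n] = 0}.
  by apply: ae_foralln => n; exact: ux.
rewrite -[u]L2reprK -(L2pi0 i E); apply: L2pi_ae; apply: filterS aeu => r ur.
apply/nrm0_eq0/eqP; rewrite eq_le nrm_ge0 andbT; apply/ler_addgt0Pr => e e0.
have [n xn] := xd r e e0; rewrite add0r.
have := Re_le_CS (L2repr u r) (L2repr u r - x n).
rewrite innerBr raddfB/= ur subr0 Re_inner_nrm expr2.
have [->|n0] := eqVneq (nrm (L2repr u r)) 0; first by rewrite (ltW e0).
rewrite ler_pM2l; last by rewrite lt_def n0 nrm_ge0.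
by move=> /le_trans; apply; exact: ltW.
Qed.

(** Green's formula with itself kills the trace, then Green's formula with the
    exponentials kills the derivative. *)
Lemma dist_deriv_eq0 g e : dist_deriv 0 g e -> g = 0 /\ e = 0.
Proof.
move=> h; have e0 : e = 0.
  have := dist_deriv_green h h; rewrite inner0r inner0l addr0 => /esym/eqP.
  by rewrite oppr_eq0 => /eqP/inner_eq0.
split=> //; apply: (Exp_total (lexx 0)) => lam lam0 _ x.
have := dist_deriv_green h (dist_deriv_Exp lam0 x).
by rewrite e0 !inner0l addr0 oppr0.
Qed.

Lemma dist_deriv_unique v g e g' e' : dist_deriv v g e -> dist_deriv v g' e' ->
  g = g' /\ e = e'.
Proof.
move=> h h'; have := dist_derivB h h'; rewrite subrr => /dist_deriv_eq0[/eqP + /eqP].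
by rewrite !subr_eq0 => /eqP -> /eqP ->.
Qed.

(** The integral of [2 Re <g, v>] over a segment is the increment of [|W|^2]. *)
Lemma dist_rep_sup v g W : dist_rep v g W -> forall t, 0 <= t ->
  nrm (W t) ^+ 2 <= 4 * (nrm g * nrm v).
Proof.
move=> vW t t0; have p := dist_rep_product vW vW t0; have gr := dist_rep_green_Re vW vW.
have c1 := Re_CS (Cut 0 t g) v; have c2 := Re_CS v (Cut 0 t g).
have c3 := Re_CS g v.
have k1 : nrm (Cut 0 t g) * nrm v <= nrm g * nrm v.
  by rewrite ler_wpM2r ?nrm_ge0 ?nrm_Cut.
move: p gr c1 c2 c3; rewrite !Re_inner_nrm (Re_innerC g v) [nrm v * _]mulrC.
rewrite !ler_norml => p gr /andP[_ c1] /andP[_ c2] /andP[c3 _].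
by move: (nrm g * nrm v) (nrm _ * nrm v) k1 c1 c2 c3 => G C; lra.
Qed.

End half_line_derivative.


Section solvability.
Context (R : realType) (i : interval R) (sg : R) (hl : half_line i sg).
Context (E : hilbertType R).
Local Notation mu := (leb_on i).
Local Notation L2i := (L2 mu E).
Local Notation Step := (Step hl (E := E)).
Local Notation dist_rep := (dist_rep hl).
Local Notation dist_deriv := (dist_deriv hl).
Implicit Types (u v g : L2i) (x y e : E) (s t r : R) (W Y : R -> E).

(** By Fatou's lemma [liminf |f n - v|^2] has integral zero. *)
Lemma L2_pointwise_limit (f : nat -> L2i) v :
  (fun n => nrm (f n - v)) @ \oo --> (0 : R) ->
  {ae mu, forall r l, (fun n => L2repr (f n) r) @ \oo --> l -> L2repr v r = l}.
Proof.
move=> fv; have AF := ae_filter_ringOfSetsType mu.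
pose F n r := (nrm (L2repr (f n) r - L2repr v r) ^+ 2)%:E : \bar R.
have mF n : measurable_fun setT (F n).
  apply/measurable_EFinP; apply: measurable_funX.
  exact: (strongly_measurable_nrm (L2fun_meas (L2repr (f n) - L2repr v))).
have F0 n r : (0 <= F n r)%E by rewrite lee_fin sqr_ge0.
pose h r := limn_einf (F^~ r).
have h0 r : (0 <= h r)%E.
  rewrite /h limn_einf_lim; apply: lime_ge; first exact: is_cvg_einfs.
  by apply: nearW => n; apply: le_ereal_inf_tmp => _ [m _ <-].
have mh : measurable_fun setT h.
  rewrite (_ : h = (fun r => - limn_esup (fun n => - F n r)))%E.
    apply: measurableT_comp => //; apply: measurable_fun_limn_esup => n.
    exact: measurableT_comp.
  by apply/funext => r; rewrite (_ : (fun n => - F n r)%E = -%E \o (F^~ r))// limn_esupN oppeK.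
have ih : (\int[mu]_r h r <= 0)%E.
  apply: le_trans (fatou mu measurableT mF _) _; first by move=> n r _; exact: F0.
  rewrite (_ : (fun n => \int[mu]_r F n r)%E = (fun n => (nrm (f n - v) ^+ 2)%:E)); last first.
    by apply/funext => n; rewrite -[f n in RHS]L2reprK -[v in RHS]L2reprK -L2piB L2nrm_pi_ereal.
  have c : (fun n => (nrm (f n - v) ^+ 2)%:E) @ \oo --> (0%:E : \bar R).
    apply: cvg_EFin; first exact: nearW.
    rewrite (_ : _ \o _ = fun n => nrm (f n - v) ^+ 2)//.
    under eq_fun do rewrite expr2.
    by have cM := cvgM fv fv; rewrite mulr0 in cM; exact: cM.
  by rewrite (cvg_limn_einf_sup c).1.
have h1 : (\int[mu]_r `|h r| = 0)%E.
  under eq_integral do rewrite gee0_abs//.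
  by apply/eqP; rewrite eq_le ih integral_ge0.
have := (ae_eq_integral_abs mu measurableT mh).1 h1.
apply: filterS => r /(_ I) hr l cl.
have c : F^~ r @ \oo --> ((nrm (l - L2repr v r) ^+ 2)%:E : \bar R).
  apply: cvg_EFin; first exact: nearW.
  rewrite expr2 (_ : _ \o _ = fun n => nrm (L2repr (f n) r - L2repr v r) * nrm (L2repr (f n) r - L2repr v r)).
    have cn : (fun n => nrm (L2repr (f n) r - L2repr v r)) @ \oo --> nrm (l - L2repr v r).
      by apply: cvg_nrm; apply: cvgB => //; exact: cvg_cst.
    exact: cvgM.
  by apply/funext => n /=; rewrite expr2.
have := (cvg_limn_einf_sup c).1; rewrite -/(h r) hr => /esym[/eqP].
by rewrite sqrf_eq0 => /eqP/nrm0_eq0/eqP; rewrite subr_eq0 => /eqP.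
Qed.

Lemma sqr_half_bound (p q d : R) : 0 <= p -> 0 <= q -> p < d / 2 -> q < d / 2 ->
  4 * (p * q) < d ^+ 2.
Proof.
move=> p0 q0 pd qd; have -> : d ^+ 2 = 4 * (d / 2 * (d / 2)) by field.
by rewrite ltr_pM2l// ltr_pM.
Qed.

Lemma nrm_tri (V : preHilbertType R) (x p q : V) (d : R) :
  nrm (x - p) < d / 4 -> nrm (x - q) < d / 4 -> nrm (p - q) < d / 2.
Proof.
move=> xp xq; have -> : p - q = (x - q) - (x - p).
  by rewrite opprB [RHS]addrC addrA subrK.
have h := nrmD (x - q) (- (x - p)); apply: le_lt_trans h _.
rewrite nrmN (_ : d / 2 = d / 4 + d / 4); last by field.
exact: ltrD.
Qed.

(** By [dist_rep_sup] approximating representatives converge uniformly; the limit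
    has the right increments, and it represents [v] by
    [L2_pointwise_limit]. *)
Lemma dist_rep_closed v g : (forall d : R, 0 < d -> exists v' g' W',
    [/\ dist_rep v' g' W', nrm (v - v') < d & nrm (g - g') < d]) ->
  exists W, dist_rep v g W.
Proof.
move=> vg; have AF := ae_filter_ringOfSetsType mu.
have ex (n : nat) : exists p : L2i * L2i * (R -> E),
    [/\ dist_rep p.1.1 p.1.2 p.2, nrm (v - p.1.1) < n.+1%:R^-1 & nrm (g - p.1.2) < n.+1%:R^-1].
  have [v' [g' [W' [h1 h2 h3]]]] := vg n.+1%:R^-1 ltac:(by rewrite invr_gt0).
  by exists (v', g', W').
have [f fP] := choice ex.
have exW (t : R) : exists l : E, 0 <= t -> (fun n => (f n).2 t) @ \oo --> l.
  case: (leP 0 t) => [t0|_]; last by exists 0.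
  have [|l lP] := hilbert_seq_complete (u := fun n => (f n).2 t).
    move=> d d0; have [N NP] := natSinv_small (d / 4) ltac:(by rewrite divr_gt0).
    exists N => m n Nm Nn; have [m1 m2 m3] := fP m; have [n1 n2 n3] := fP n.
    have md := NP _ Nm; have nd := NP _ Nn.
    have := dist_rep_sup (dist_repP (-1) n1 m1) t0.
    rewrite !scaleN1r ![- _ + _]addrC => h.
    have k1 := nrm_tri (lt_trans m2 md) (lt_trans n2 nd).
    have k2 := nrm_tri (lt_trans m3 md) (lt_trans n3 nd).
    rewrite -ltr_sqr ?nnegrE ?nrm_ge0 ?(ltW d0)//; apply: le_lt_trans h _.
    move: (nrm_ge0 ((f m).1.1 - (f n).1.1)) (nrm_ge0 ((f m).1.2 - (f n).1.2)) k1 k2.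
    by move=> p0 q0 k1 k2; exact: sqr_half_bound.
  by exists l => _; exact/cvg_nrmP.
have [W WP] := choice exW.
exists W; split.
  have fv : (fun n => nrm ((f n).1.1 - v)) @ \oo --> (0 : R).
    apply/cvgrPdist_lt => d /natSinv_small[N NP]; exists N => // n /= Nn.
    rewrite sub0r normrN ger0_norm ?nrm_ge0// nrmB.
    by have [_ h _] := fP n; exact: lt_trans h (NP _ Nn).
  have aeW : {ae mu, forall r n, (f n).2 (sg * r) = L2repr (f n).1.1 r}.
    by apply: ae_foralln => n; have [[]] := fP n.
  have ae0 : {ae mu, forall r, 0 < sg * r} := ae_half_line hl.
  apply: filterS3 (L2_pointwise_limit fv) aeW ae0 => r vl Wr r0.
  apply/esym/vl; rewrite (_ : (fun n => _) = (fun n => (f n).2 (sg * r))).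
    exact: WP (ltW r0).
  by apply/funext => n; rewrite Wr.
move=> s t s0 st e; have t0 := le_trans s0 st; apply/eqP; rewrite -subr_eq0; apply/eqP.
suff : '[((e, Step s t e) : E ⊕ L2i), ((W t - W s, - g) : E ⊕ L2i)] = 0.
  rewrite hsum_innerE/= innerNr => h.
  by rewrite innerC [X in _ - X]innerC -rmorphB h rmorph0.
apply: inner_small => d d0; have d30 : 0 < d / 3 by rewrite divr_gt0.
have /cvg_nrmP/(_ _ d30)[N1 N1P] := WP _ t0; have /cvg_nrmP/(_ _ d30)[N2 N2P] := WP _ s0.
have [N3 N3P] := natSinv_small _ d30; pose n := maxn N1 (maxn N2 N3).
have h1 := N1P n ltac:(by rewrite /n !leq_max leqnn ?orbT).
have h2 := N2P n ltac:(by rewrite /n !leq_max leqnn ?orbT).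
have h3 := N3P n ltac:(by rewrite /n !leq_max leqnn ?orbT).
have [[_ rep] _ h4] := fP n.
exists (((f n).2 t - (f n).2 s, - (f n).1.2) : E ⊕ L2i); split; last first.
  rewrite hsum_innerE/= innerNr innerC rep// -innerC subrr//.
rewrite -ltr_sqr ?nnegrE ?nrm_ge0 ?(ltW d0)// hsum_nrm2/=.
rewrite opprK [- g + _]addrC; rewrite nrmB in h4.
have h5 : nrm (W t - W s - ((f n).2 t - (f n).2 s)) < 2 * (d / 3).
  rewrite opprB (_ : _ + _ = (W t - (f n).2 t) - (W s - (f n).2 s)).
    apply: le_lt_trans (nrmD _ _) _; rewrite nrmN [nrm (W t - _)]nrmB [nrm (W s - _)]nrmB.
    by rewrite (_ : 2 * (d / 3) = d / 3 + d / 3) ?ltrD//; ring.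
  by rewrite opprB addrACA [- W s + _]addrC addrACA.
have h6 := lt_trans h4 h3.
apply: lt_le_trans (_ : (2 * (d / 3)) ^+ 2 + (d / 3) ^+ 2 <= _).
  have d1 : 0 <= 2 * (d / 3) by rewrite mulr_ge0 ?(ltW d30).
  by apply: ltrD; rewrite ltr_sqr ?nnegrE ?nrm_ge0 ?(ltW d30).
have -> : (2 * (d / 3)) ^+ 2 + (d / 3) ^+ 2 = 5 / 9 * d ^+ 2 by field.
rewrite ler_piMl ?sqr_ge0// ler_pdivrMr// mul1r ler_nat//.
Qed.

Lemma dist_deriv_closed (b : bool) v g : (forall d : R, 0 < d -> exists v' g' e',
    [/\ dist_deriv v' g' e', b -> e' = 0, nrm (v - v') < d & nrm (g - g') < d]) ->
  exists2 e, dist_deriv v g e & (b -> e = 0).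
Proof.
move=> vg; have [|W vW] := @dist_rep_closed v g.
  move=> d /vg[v' [g' [e' [[W' h _] _ h1 h2]]]].
  by exists v', g', W'.
exists (W 0); first by exists W.
move=> bT; apply/nrm0_eq0/eqP; rewrite eq_le nrm_ge0 andbT; apply/ler_addgt0Pr => d d0.
have [v' [g' [e' [[W' h We] /(_ bT) e0 h1 h2]]]] := vg (d / 2) ltac:(by rewrite divr_gt0).
have := dist_rep_sup (dist_repP (-1) h vW) (lexx 0).
rewrite We e0 scaler0 add0r !scaleN1r ![- _ + _]addrC => k; rewrite add0r.
rewrite -ler_sqr ?nnegrE ?nrm_ge0 ?(ltW d0)//; apply: le_trans k _.
by apply: ltW; apply: sqr_half_bound; rewrite ?nrm_ge0.
Qed.

Definition deriv v : L2i := xget 0 [set g | exists e, dist_deriv v g e].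

Lemma derivE v g e : dist_deriv v g e -> deriv v = g.
Proof.
move=> h; rewrite /deriv; case: xgetP => [_ -> [e' h']|/(_ g)[]]; last by exists e.
by have [] := dist_deriv_unique h' h.
Qed.

(** [i d/dx] in the distance coordinate, with zero trace if [b]. *)
Definition momentum (b : bool) : operator L2i L2i :=
  Operator [set v | exists g e, dist_deriv v g e /\ (b -> e = 0)] (fun v => 'i%C *: deriv v).

Lemma momentum_linear b : linear_op (momentum b).
Proof.
split=> [|a u v [g [e [h e0]]] [g' [e' [h' e0']]]|a u v [g [e [h e0]]] [g' [e' [h' e0']]]].
- by exists 0, 0; split=> //; exact: dist_deriv0.
- exists (a *: g + g'), (a *: e + e'); split; first exact: dist_derivP.
  by move=> bT; rewrite e0// e0'// scaler0 addr0.
rewrite /= (derivE (dist_derivP a h h')) (derivE h) (derivE h').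
by rewrite scalerDr !scalerA mulrC.
Qed.

(** The operator [v |-> 'i v'] loses imaginary part at the origin, so it is
    surjective after a shift into the upper half-plane; with zero trace it is
    symmetric and the other shift works as well. The exponentials show that the
    ranges are dense. *)
Lemma momentum_onto b : onto setT (momentum b) (if b then - 'i%C else 'i%C).
Proof.
set z := (if b then _ else _).
apply: (@onto_closed_range _ _ _ _ _ 1) => //.
- exact: momentum_linear.
- move=> v [g [e [h e0]]]; rewrite mul1r.
  rewrite -[leLHS]mul1r; apply: cancel_nrm; apply: le_trans (Im_CS _ _).
  have BE : momentum b v = 'i%C *: g by rewrite /= (derivE h).
  rewrite Im_shift mul1r BE innerZl.
  have [W vW We] := h; have := dist_rep_green_Re vW vW.
  rewrite Re_inner_nrm We (Re_innerC g v) => gr.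
  have -> : Im ('i%C * '[g, v]) = Re '[g, v] by case: '[g, v] => p q /=; rewrite mul0r add0r mul1r.
  have e1 := sqr_ge0 (nrm e); move: (Re '[g, v]) gr => p gr.
  rewrite /z; case: (b) e0 => [/(_ isT) e0|_].
    by rewrite e0 nrm0 expr0n/= in gr; apply: le_trans (ler_norm _); rewrite /=; lra.
  by rewrite -normrN; apply: le_trans (ler_norm _); rewrite /=; lra.
- move=> u y _ _ uy.
  have [d d0|e h e0] := @dist_deriv_closed b u (- 'i%C *: y).
    have [v [[g [e [h e0]]] h1 h2]] := uy d d0; exists v, g, e; split=> //.
    move: h2; rewrite /= (derivE h).
    rewrite (_ : - 'i%C *: y - g = - 'i%C *: (y - 'i%C *: g)).
      by rewrite nrmZ normrN normCi/= mul1r.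
    by rewrite scalerBr scalerA mulNr -expr2 sqr_i opprK scale1r.
  split; first by exists (- 'i%C *: y), e.
  by rewrite /= (derivE h) scalerA mulrN -expr2 sqr_i opprK scale1r.
move=> w _ wo; apply: (@Exp_total _ _ _ hl _ w 1 ler01) => lam lam0 lam1 x.
have i0 : 'i%C != 0 :> R[i] by rewrite neq0Ci.
move: wo; rewrite /z {z}; case: b => wo.
  (* [Exp 1 x] corrects the trace and is annihilated by the shifted operator *)
  have h := dist_derivB (dist_deriv_Exp hl lam0 x) (dist_deriv_Exp hl ltr01 x).
  have := wo _ (ex_intro _ _ (ex_intro _ _ (conj h (fun=> subrr x)))).
  have -> : momentum true (Exp hl lam0 x - Exp hl ltr01 x) -
      - 'i%C *: (Exp hl lam0 x - Exp hl ltr01 x) = ('i%C * (1 - lam)%:C) *: Exp hl lam0 x.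
    rewrite /= (derivE h) scaleNr !opprK -scalerDr -scalerA; congr (_ *: _).
    rewrite scale1r addrACA [Exp _ _ _ - Exp _ _ _]subrr addr0.
    by rewrite rmorphB scalerBl scale1r addrC.
  move=> /eqP; rewrite innerZr mulf_eq0 => /orP[|/eqP//].
  rewrite fmorph_eq0 mulf_eq0 (negbTE i0)/= fmorph_eq0 subr_eq0 => /eqP l1.
  by rewrite l1 ltxx in lam1.
have h := dist_deriv_Exp hl lam0 x.
have := wo _ (ex_intro _ _ (ex_intro _ _ (conj h (fun p : false => False_ind _ (notF p))))).
have -> : momentum false (Exp hl lam0 x) - 'i%C *: Exp hl lam0 x =
    - (('i%C * (1 + lam)%:C) *: Exp hl lam0 x).
  rewrite /= (derivE h) -scalerBr -scalerA -[RHS]scalerN; congr (_ *: _).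
  by rewrite rmorphD scalerDl scale1r opprD addrC.
rewrite innerNr innerZr => /eqP; rewrite oppr_eq0 mulf_eq0 => /orP[|/eqP//].
rewrite fmorph_eq0 mulf_eq0 (negbTE i0)/= => /eqP/(congr1 Re)/= l1.
by exfalso; move: (lam0) l1; lra.
Qed.

Lemma deriv_onto_upper k : exists v g e, dist_deriv v g e /\ 'i%C *: g - 'i%C *: v = k.
Proof.
have [v [g [e [h _]]] vk] := momentum_onto false (f := k) I.
by exists v, g, e; split=> //; move: vk; rewrite /= (derivE h).
Qed.

(** Solve with zero trace, then add the solution [Exp 1 x] of the homogeneous
    equation. *)
Lemma deriv_onto_lower k x : exists v g, dist_deriv v g x /\ 'i%C *: g + 'i%C *: v = k.
Proof.
have [v [g [e [h /(_ isT) e0]]] vk] := momentum_onto true (f := k) I.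
have h1 := dist_deriv_Exp hl ltr01 x.
have := dist_derivP 1 h h1; rewrite !scale1r e0 add0r => h2.
exists (v + Exp hl ltr01 x), (g - Exp hl ltr01 x); split=> //.
move: vk; rewrite /= (derivE h) scaleNr opprK => <-.
by rewrite scalerBr scalerDr addrACA [- _ + _]addrC subrr addr0.
Qed.

End solvability.

(** * The dilation *)

Section trace_calculus.
Context (R : realType) (i : interval R) (sg : R) (hl : half_line i sg).
Context (E : hilbertType R).
Local Notation L2i := (L2 (leb_on i) E).
Local Notation sgC := (sgC sg).
Implicit Types (u v d k : L2i) (x e : E).

(** The relation behind [H1], [H1_deriv] and [trace0]. *)
Definition ac_trace v d e := exists2 w, ac_rep v d w & w 0 = e.

Lemma ac_traceP v d e : ac_trace v d e <-> dist_deriv hl v (sgC *: d) e.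
Proof.
split=> [[w vw we]|[W vW We]].
  by exists (fun t => w (sg * t)); [exact: ac_rep_dist|rewrite mulr0].
exists (fun r => W (sg * r)); last by rewrite mulr0.
by have := dist_rep_ac vW; rewrite scalerA (sgC_sqr hl) scale1r.
Qed.

Lemma ac_trace_unique v d e d' e' : ac_trace v d e -> ac_trace v d' e' -> d = d' /\ e = e'.
Proof.
move=> /ac_traceP h /ac_traceP h'; have [dd ee] := dist_deriv_unique h h'; split=> //.
by rewrite -[d]scale1r -(sgC_sqr hl) -scalerA dd scalerA (sgC_sqr hl) scale1r.
Qed.

Lemma H1_ac_trace v : H1 v -> ac_trace v (H1_deriv v) (trace0 v).
Proof.
move=> [d [w vw]]; have h : ac_trace v d (w 0) by exists w.
have [w' vw'] : exists w, ac_rep v (H1_deriv v) w.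
  have ex : exists d, [set d | exists w, ac_rep v d w] d by exists d, w.
  exact: (xgetPex 0 ex).
have [d' [w'' [vw'' e'']]] : exists g w, ac_rep v g w /\ w 0 = trace0 v.
  have ex : exists e, [set e | exists g w, ac_rep v g w /\ w 0 = e] e by exists (w 0), d, w.
  exact: (xgetPex 0 ex).
have h' : ac_trace v (H1_deriv v) (w' 0) by exists w'.
have h'' : ac_trace v d' (trace0 v) by exists w''.
by have [<- _] := ac_trace_unique h'' h'.
Qed.

Lemma ac_trace_H1 v d e : ac_trace v d e -> [/\ H1 v, H1_deriv v = d & trace0 v = e].
Proof.
move=> h; have v1 : H1 v by have [w vw _] := h; exists d, w.
by have [] := ac_trace_unique (H1_ac_trace v1) h.
Qed.

Lemma ac_trace_lin (a : R[i]) v d e v' d' e' : ac_trace v d e -> ac_trace v' d' e' ->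
  ac_trace (a *: v + v') (a *: d + d') (a *: e + e').
Proof.
move=> /ac_traceP h /ac_traceP h'; apply/ac_traceP.
by rewrite scalerDr scalerA mulrC -scalerA; exact: dist_derivP.
Qed.

Lemma ac_trace0 : ac_trace 0 0 0.
Proof. by apply/ac_traceP; rewrite scaler0; exact: dist_deriv0. Qed.

Lemma ac_trace_green v d e v' d' e' : ac_trace v d e -> ac_trace v' d' e' ->
  '['i%C *: d, v'] - '[v, 'i%C *: d'] = - ('i%C * sgC * '[e, e']).
Proof.
move=> /ac_traceP h /ac_traceP h'; have := dist_deriv_green h h'.
rewrite !innerZl !innerZr (sgC_conj sg) => gr.
have -> : '[e, e'] = - (sgC * '[d, v'] + sgC * '[v, d']) by rewrite gr opprK.
rewrite (_ : ('i%C)^* = - 'i%C :> R[i]); last by apply: complex_eq; rewrite /= ?oppr0.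
rewrite mulrN opprK mulrDr !mulrA -['i%C * sgC * sgC]mulrA (sgC_sqr hl) mulr1.
by rewrite mulNr opprK.
Qed.

Lemma ac_trace_onto_free k : exists v d e,
  ac_trace v d e /\ 'i%C *: d - ('i%C * sgC) *: v = k.
Proof.
have [v [g [e [h gk]]]] := deriv_onto_upper hl (sgC *: k).
exists v, (sgC *: g), e; split.
  by apply/ac_traceP; rewrite scalerA (sgC_sqr hl) scale1r.
rewrite scalerA -scalerBr mulrC -scalerA scalerBr gk.
by rewrite scalerA (sgC_sqr hl) scale1r.
Qed.

Lemma ac_trace_onto k e : exists v d,
  ac_trace v d e /\ 'i%C *: d + ('i%C * sgC) *: v = k.
Proof.
have [v [g [h gk]]] := deriv_onto_lower hl (sgC *: k) e.
exists v, (sgC *: g); split.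
  by apply/ac_traceP; rewrite scalerA (sgC_sqr hl) scale1r.
rewrite scalerA -scalerDr mulrC -scalerA scalerDr gk.
by rewrite scalerA (sgC_sqr hl) scale1r.
Qed.

Lemma ac_trace_Exp (lam : R) (lam0 : 0 < lam) x :
  ac_trace (Exp hl lam0 x) (- ((sgC * lam%:C) *: Exp hl lam0 x)) x.
Proof.
apply/ac_traceP; rewrite scalerN scalerA mulrA (sgC_sqr hl) mul1r.
exact: dist_deriv_Exp.
Qed.

End trace_calculus.

Section dilation_operator.
Context (R : realType) (H E Es : hilbertType R) (A : operator H H).
Context (G : H -> E) (Gs : H -> Es).
Local Notation C := (adjoint setT A).
Context (BS : boundary_system A C G Gs).
Context (mu lam : R[i]) (mu0 : Im mu < 0) (lam0 : 0 < Im lam).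
Local Notation Lop := (dilop A G Gs mu lam).
Local Notation space := (dilspace H E Es).
Local Notation lk := (linked A C G Gs).
Implicit Types (U V W : space) (z : R[i]).

Lemma half_line_neg : half_line (`]-oo, (0 : R)[) (-1 : R).
Proof. by split; [rewrite (_ : (-1 == 1 :> R) = false)// lt_eqF|right]. Qed.

Lemma half_line_pos : half_line (`](0 : R), +oo[) (1 : R).
Proof. by split; [rewrite eqxx|left]. Qed.

(** The graph of the dilation, described without [mu] and [lam]. *)
Definition dil_graph U V := exists dm dp phi psi,
  [/\ ac_trace U.1.1 dm phi, ac_trace U.2 dp psi, lk U.1.2 phi psi V.1.2 &
      V = (('i%C *: dm, V.1.2), 'i%C *: dp)].

Let m0 : 0 < Im (- mu). Proof. by case: mu mu0 => a b /=; rewrite oppr_gt0. Qed.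
Let l0 : 0 < Im (- lam^*).
Proof. by case: lam lam0 => a b /=; rewrite opprK. Qed.
Let lE : (- lam^*)^* = - lam.
Proof. by apply: complex_eq; case: lam => a b /=; rewrite ?opprK. Qed.

Let charfun_at_charfun z : 0 < Im z -> charfun_at A C G Gs z (charfun A G Gs z).
Proof.
move=> z0; have ex := charfun_spec BS z0.
exact: (xgetPex (fun=> 0) ex).
Qed.

Let dilopE U : Lop U = (('i%C *: H1_deriv U.1.1,
  C (U.1.2 + gam A G (- lam) (trace0 U.2)) + lam^* *: gam A G (- lam) (trace0 U.2)),
  'i%C *: H1_deriv U.2).
Proof. by []. Qed.

Lemma dilop_graph U : dom Lop U -> dil_graph U (Lop U).
Proof.
move=> [/(H1_ac_trace half_line_neg) hm /(H1_ac_trace half_line_pos) hp Aa Cb [psiE phiE]].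
have lP := linkedP BS U.1.2 (trace0 U.1.1) (trace0 U.2) m0 l0 (charfun_at_charfun m0)
  (charfun_at_charfun l0).
have [_] := lP; rewrite lE => /(_ (And3 Aa Cb (conj psiE phiE)))[t ut].
have [_ bE _] := linked_upper BS l0 (charfun_at_charfun l0) ut; rewrite lE in bE.
rewrite dilopE bE scaleNr addrNK.
by exists (H1_deriv U.1.1), (H1_deriv U.2), (trace0 U.1.1), (trace0 U.2).
Qed.

Lemma graph_dilop U V : dil_graph U V -> dom Lop U /\ Lop U = V.
Proof.
move=> [dm [dp [phi [psi [hm hp ut VE]]]]].
have [um dmE phiE] := ac_trace_H1 half_line_neg hm.
have [up dpE psiE] := ac_trace_H1 half_line_pos hp.
have lP := linkedP BS U.1.2 phi psi m0 l0 (charfun_at_charfun m0) (charfun_at_charfun l0).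
have [Aa Cb eqs] := lP.1 (ex_intro _ _ ut); rewrite lE in Cb eqs.
have [_ bE _] := linked_upper BS l0 (charfun_at_charfun l0) ut; rewrite lE in bE.
split; first by split; rewrite /= ?phiE ?psiE//.
by rewrite VE dilopE dmE dpE psiE bE scaleNr addrNK.
Qed.

Lemma linked_lin (a : R[i]) u phi psi t u' phi' psi' t' : lk u phi psi t ->
  lk u' phi' psi' t' -> lk (a *: u + u') (a *: phi + phi') (a *: psi + psi') (a *: t + t').
Proof.
move=> [h1 h2] [h1' h2']; split=> x dx.
  by rewrite !innerP -h1// -h1'// mulrDr addrACA.
by rewrite !innerP -h2// -h2'// mulrDr addrACA.
Qed.

Lemma dil_graph_lin (a : R[i]) U V U' V' : dil_graph U V -> dil_graph U' V' ->
  dil_graph (a *: U + U') (a *: V + V').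
Proof.
move=> [dm [dp [phi [psi [hm hp ut VE]]]]] [dm' [dp' [phi' [psi' [hm' hp' ut' VE']]]]].
exists (a *: dm + dm'), (a *: dp + dp'), (a *: phi + phi'), (a *: psi + psi').
split.
- exact: (ac_trace_lin half_line_neg a hm hm').
- exact: (ac_trace_lin half_line_pos a hp hp').
- exact: linked_lin.
rewrite {1}VE {1}VE' /= !scalerDr !scalerA ![_ * a]mulrC -!scalerA.
by [].
Qed.

Lemma dilop_linear : linear_op Lop.
Proof.
have lin a U V : dom Lop U -> dom Lop V ->
    dom Lop (a *: U + V) /\ Lop (a *: U + V) = a *: Lop U + Lop V.
  by move=> /dilop_graph gU /dilop_graph gV; apply: graph_dilop; exact: dil_graph_lin.
split=> [|a U V dU dV|a U V dU dV]; [|exact: (lin a U V dU dV).1|exact: (lin a U V dU dV).2].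
suff : dil_graph 0 0 by move=> /graph_dilop[].
exists 0, 0, 0, 0; split.
- exact: (ac_trace0 half_line_neg).
- exact: (ac_trace0 half_line_pos).
- by split=> x _; rewrite !inner0l addr0.
by rewrite !scaler0.
Qed.

(** The boundary terms of the two half-lines are those of [linked_green], with
    the opposite sign. *)
Lemma dilop_symmetric : symmetric_op Lop.
Proof.
move=> U V /dilop_graph + /dilop_graph; move: (Lop U) (Lop V) => U' V'.
move=> [dm [dp [phi [psi [hm hp ut ->]]]]] [dm' [dp' [phi' [psi' [hm' hp' ut' ->]]]]].
have e1 := ac_trace_green half_line_neg hm hm'.
have e2 := ac_trace_green half_line_pos hp hp'.
have e3 := linked_green BS ut ut'.
rewrite !hsum_innerE.
have key (a b c a' b' c' : R[i]) : a - a' = 'i%C * '[phi, phi'] -> c - c' = - ('i%C * '[psi, psi']) ->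
    b - b' = 'i%C * '[psi, psi'] - 'i%C * '[phi, phi'] -> a + b + c = a' + b' + c'.
  move=> h1 h2 h3; apply/eqP; rewrite -subr_eq0; apply/eqP.
  rewrite (_ : _ - _ = (a - a') + (b - b') + (c - c')); last by ring.
  by rewrite h1 h2 h3; ring.
apply: key; [rewrite e1|rewrite e2|exact: e3].
  by rewrite /sgC rmorphN1 mulrN1 mulNr opprK.
by rewrite /sgC rmorph1 mulr1.
Qed.

(** At [i] the boundary value on the right half-line is free and gives [psi];
    [linked_onto_upper] then gives [u] and [phi], and the left half-line is solved
    with the boundary value [phi]. At [- i] the half-lines exchange their roles. *)
Lemma dilop_onto z : Im z != 0 -> onto setT Lop z.
Proof.
have sgm : (@sgC R (-1)) = -1 by rewrite /sgC rmorphN1.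
have sgp : (@sgC R 1) = 1 by rewrite /sgC rmorph1.
move: z; apply: (@symmetric_onto _ _ setT Lop 'i%C) => //.
- exact: dilop_linear.
- exact: dilop_symmetric.
- by rewrite /= oner_neq0.
- move=> [[fm f] fp] _.
  have [vp [dp [psi [hp pE]]]] := ac_trace_onto_free half_line_pos fp.
  have i1 : 0 < Im ('i%C : R[i]) by [].
  have [u [phi ut]] := linked_onto_upper BS psi f i1.
  have [vm [dm [hm mE]]] := ac_trace_onto half_line_neg fm phi.
  have [dU UE] : dom Lop (((vm, u), vp) : space) /\ Lop (((vm, u), vp) : space) =
      (('i%C *: dm, f + 'i%C *: u), 'i%C *: dp).
    by apply: graph_dilop; exists dm, dp, phi, psi.
  exists ((vm, u), vp) => //; rewrite UE; congr ((_, _), _).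
  + by move: mE; rewrite sgm mulrN1 scaleNr.
  + exact: addrK.
  + by move: pE; rewrite sgp mulr1.
move=> [[fm f] fp] _.
have ic : ('i%C)^* = - 'i%C :> R[i] by apply: complex_eq; rewrite /= ?oppr0.
have [vm [dm [phi [hm mE]]]] := ac_trace_onto_free half_line_neg fm.
have i1 : Im (- 'i%C : R[i]) < 0 by rewrite /= oppr_lt0.
have [u [psi ut]] := linked_onto_lower BS phi f i1.
have [vp [dp [hp pE]]] := ac_trace_onto half_line_pos fp psi.
have [dU UE] : dom Lop (((vm, u), vp) : space) /\ Lop (((vm, u), vp) : space) =
    (('i%C *: dm, f + - 'i%C *: u), 'i%C *: dp).
  by apply: graph_dilop; exists dm, dp, phi, psi.
exists ((vm, u), vp) => //; rewrite ic UE; congr ((_, _), _).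
- by move: mE; rewrite sgm mulrN1.
- exact: addrK.
- by rewrite -pE sgp mulr1 [LHS](_ : _ = 'i%C *: dp - (- 'i%C *: vp))// scaleNr opprK.
Qed.

End dilation_operator.

(** * Reduction of the dilation by the selfadjoint part *)

Section dilation_structure.
Context (R : realType) (H E Es : hilbertType R) (A : operator H H).
Context (G : H -> E) (Gs : H -> Es).
Local Notation C := (adjoint setT A).
Context (BS : boundary_system A C G Gs).
Context (mu lam : R[i]) (mu0 : Im mu < 0) (lam0 : 0 < Im lam).
Local Notation Lop := (dilop A G Gs mu lam).
Local Notation space := (dilspace H E Es).
Local Notation lk := (linked A C G Gs).
Local Notation inj := (dil_inj E Es).
Local Notation cyl := (dil_cyl E Es).
Local Notation Hc := (Hcns A G Gs).
Local Notation Hs := (orth_in setT Hc).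
Local Notation Hs0 := (inj @` Hs).
Local Notation Kc := (cyl Hc).
Local Notation graph := (dil_graph A G Gs).
Implicit Types (U V W F : space) (z : R[i]) (u v g : H) (K : set H).

Let toG := dilop_graph BS mu0 lam0.
Let ofG := graph_dilop BS mu0 lam0.
Let Ll := dilop_linear BS mu0 lam0.
Let Ls := dilop_symmetric BS mu0 lam0.
Let Lo := dilop_onto BS mu0 lam0.
Let Lt := closed_subspaceT (dilspace H E Es).
Let hm := half_line_neg R.
Let hp := half_line_pos R.

Lemma inner_dil_inj g U : '[inj g, U] = '[g, U.1.2].
Proof. by rewrite !hsum_innerE /= !inner0l add0r addr0. Qed.

Lemma dil_inj_lin (a : R[i]) u v : inj (a *: u + v) = a *: inj u + inj v.
Proof. by rewrite /dil_inj; congr ((_, _), _); rewrite /= scaler0 addr0. Qed.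

Lemma orth_dil_inj K : orth_in setT (inj @` K) = cyl (orth_in setT K).
Proof.
apply/seteqP; split=> [U [_ UK]|U [_ UK]]; split=> // k.
  by move=> Kk; rewrite innerC -inner_dil_inj -innerC UK//; exists k.
by move=> [g Kg <-]; rewrite innerC inner_dil_inj -innerC UK.
Qed.

Lemma orth_dil_cyl K : K 0 -> orth_in setT (cyl K) = inj @` (orth_in setT K).
Proof.
move=> K0; apply/seteqP; split=> [[[um u] up] [_ UK]|_ [g [_ gK] <-]]; last first.
  by split=> // U KU; rewrite inner_dil_inj gK.
have um0 : um = 0.
  apply: inner_eq0; have := UK ((um, 0), 0) K0.
  by rewrite !hsum_innerE /= !inner0r !addr0.
have up0 : up = 0.
  apply: inner_eq0; have := UK ((0, 0), up) K0.
  by rewrite !hsum_innerE /= !inner0r !add0r.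
exists u; last by rewrite um0 up0.
split=> // k Kk; have := UK ((0, k), 0) Kk.
by rewrite !hsum_innerE /= !inner0r add0r addr0.
Qed.

Lemma closed_dil_inj K : closed_subspace K -> closed_subspace (inj @` K).
Proof.
move=> Kc; rewrite -(orth_in_orth_in Kc (closed_subspaceW (closed_subspaceT H)))//.
rewrite -orth_dil_cyl; first exact: closed_subspace_orth.
by split=> // k _; rewrite inner0l.
Qed.

(** Without boundary values both identities of [linked] say that [u] lies in the
    domains of [A] and [C] with the same image. *)
Lemma linked_zero u t : lk u 0 0 t ->
  [/\ dom A u, A u = t & G u = 0] /\ [/\ dom C u, C u = t & Gs u = 0].
Proof.
move=> [uA uC]; have [|Au AE] := mem_dom_A BS (a := u) (t := t).
  by move=> y Cy; rewrite innerC [RHS]innerC -uC// inner0l addr0.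
have Gu : G u = 0.
  apply: (G_dense BS) => x Ax.
  have [_ _ _ [_ _ Gg] _] := BS; have := uA x Ax; rewrite inner0l addr0 -AE => h.
  have := Gg u x Au Ax; rewrite h subrr => /esym/eqP.
  by rewrite mulf_eq0 eq_complex/= oner_eq0 andbF => /eqP.
by have [Cu CE Gsu] := null_boundary BS Au Gu; rewrite CE.
Qed.

Lemma zero_linked u : dom A u -> G u = 0 -> lk u 0 0 (A u).
Proof.
move=> Au Gu; have [Cu CE _] := null_boundary BS Au Gu.
have [_ adjAC _ [_ _ Gg] _] := BS; split=> x dx; rewrite inner0l addr0; last by rewrite adjAC.
by apply/eqP; rewrite eq_sym -subr_eq0 Gg// Gu inner0l mulr0.
Qed.

Lemma dil_inj_dom u : dom Lop (inj u) <-> dom A u /\ G u = 0.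
Proof.
split=> [/toG [dm [dp [phi [psi [um up ut _]]]]]|[Au Gu]].
  have [_ e1] := ac_trace_unique hm um (ac_trace0 hm Es).
  have [_ e2] := ac_trace_unique hp up (ac_trace0 hp E).
  by rewrite e1 e2 in ut; have [[]] := linked_zero ut.
suff : graph (inj u) (inj (A u)) by move=> /ofG[].
exists 0, 0, 0, 0; split; [exact: (ac_trace0 hm Es)|exact: (ac_trace0 hp E)|exact: zero_linked|].
by rewrite !scaler0.
Qed.

Lemma dil_inj_image u : dom A u -> G u = 0 -> Lop (inj u) = inj (A u).
Proof.
move=> Au Gu; suff : graph (inj u) (inj (A u)) by move=> /ofG[].
exists 0, 0, 0, 0; split; [exact: (ac_trace0 hm Es)|exact: (ac_trace0 hp E)|exact: zero_linked|].
by rewrite !scaler0.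
Qed.

Let Linj z : Im z != 0 -> forall U, dom Lop U -> Lop U - z *: U = 0 -> U = 0 :=
  symmetric_inj Ls.

Lemma dil_inj_shift z u : dom A u -> G u = 0 -> Lop (inj u) - z *: inj u = inj (A u - z *: u).
Proof.
move=> Au Gu; rewrite dil_inj_image// -!scaleNr [RHS](_ : _ = inj (- z *: u + A u)) 1?addrC//.
by rewrite dil_inj_lin.
Qed.

Lemma orth_Hs0 : orth_in setT Hs0 = Kc.
Proof. by rewrite orth_dil_inj orth_Hs. Qed.

Lemma Kc_closed : closed_subspace Kc.
Proof. by rewrite -orth_Hs0; exact: closed_subspace_orth Lt. Qed.

Lemma Hs0_closed : closed_subspace Hs0.
Proof. exact: closed_dil_inj (Hs_closed A G Gs). Qed.

Lemma Hs0_solution z F : Im z != 0 -> Hs0 F ->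
  exists u, [/\ Hs u, dom Lop (inj u) & Lop (inj u) - z *: inj u = F].
Proof.
move=> z0 [f Hf <-]; have [u [Au Hu uf]] := Hs_solution BS z0 Hf.
have [Gu _] := Hs_dom BS Au Hu; exists u; split=> //; first exact/dil_inj_dom.
by rewrite dil_inj_shift// uf.
Qed.

Lemma Hs0_resolvent z U : Im z != 0 -> dom Lop U -> Hs0 (Lop U - z *: U) -> Hs0 U.
Proof.
move=> z0 dU /(Hs0_solution z0)[u [Hu du uE]].
exists u => //; exact: (injective_of_bound Ll (Linj z0) du dU).
Qed.

(** Dual to [Hs0_solution]. *)
Lemma Kc_resolvent z U : Im z != 0 -> dom Lop U -> Kc (Lop U - z *: U) -> Kc U.
Proof.
move=> z0 dU KU; have [_ UF] : orth_in setT Hs0 (Lop U - z *: U) by rewrite orth_Hs0.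
suff : orth_in setT Hs0 U by rewrite orth_Hs0.
split; first exact: I.
move=> F HF.
have zc : Im z^* != 0 by rewrite conj_Im oppr_eq0.
have [u [Hu du uE]] := Hs0_solution zc HF.
rewrite -uE innerBr innerZr [(z^*)^*](conjcK z) -Ls// -innerZl -innerBl.
by apply: UF; exists u.
Qed.

Lemma reducing_Hs0 : reducing setT Lop Hs0.
Proof.
have i0 : Im ('i%C : R[i]) != 0 by rewrite /= oner_neq0.
have Kr U : dom Lop U -> orth_in setT Hs0 (Lop U - 'i%C *: U) -> orth_in setT Hs0 U.
  by rewrite orth_Hs0; exact: Kc_resolvent.
have [h1 h2] := invariant_of_resolvent Lt Hs0_closed (fun _ _ => I) Ll (fun _ _ => I)
  (fun _ _ => I) (Lo i0) (Linj i0) (fun U => Hs0_resolvent (U := U) i0) Kr.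
by split=> //; exact: Hs0_closed.
Qed.

Lemma dilop_Hs0 : op_eq (restr Hs0 Lop) (dil_op E Es (restr Hs A)).
Proof.
split.
  apply/seteqP; split=> [U [dU [u Hu uE]]|_ [u [Au Hu] <-]].
    by move: dU; rewrite -uE => /dil_inj_dom[Au _]; exists u.
  by split; [apply/dil_inj_dom; split=> //; have [] := Hs_dom BS Au Hu|exists u].
move=> U [dU [u Hu uE]]; move: dU; rewrite -uE => /dil_inj_dom[Au Gu].
exact: dil_inj_image.
Qed.

(** A vector orthogonal to all [(L - z)^-1 F] has all its own resolvents in
    [0 ⊕ H ⊕ 0], hence no boundary values. *)
Lemma resolvent_span_orth W :
  (forall z U, Im z != 0 -> dom Lop U -> cyl [set 0] (Lop U - z *: U) -> '[W, U] = 0) ->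
  Hs0 W.
Proof.
move=> WU.
have key z : Im z != 0 -> exists u g, [/\ W = inj g,
    dom A u, A u - z *: u = g & G u = 0] /\ [/\ dom C u, C u - z *: u = g & Gs u = 0].
  move=> z0; have [V dV VW] := Lo z0 (f := W) I.
  have zc : Im z^* != 0 by rewrite conj_Im oppr_eq0.
  have : orth_in setT (cyl [set 0]) V.
    split=> // F F0; have [U dU UF] := Lo zc (f := F) I.
    rewrite -UF innerBr innerZr [(z^*)^*](conjcK z) -Ls// -innerZl -innerBl VW.
    by apply: (WU z^*) => //; rewrite UF.
  rewrite orth_dil_cyl// => -[v _ vE].
  move: dV VW; rewrite -vE => /dil_inj_dom[Av Gv]; rewrite dil_inj_shift// => vW.
  have [Cv CE Gsv] := null_boundary BS Av Gv.
  by exists v, (A v - z *: v); rewrite -vW CE.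
have i0 : Im ('i%C : R[i]) != 0 by rewrite /= oner_neq0.
have [_ [g [[Wg _ _ _] _]]] := key _ i0; exists g => //.
rewrite (orth_Hcns BS); split=> z u z0 du ug.
  have [v [g' [[Wg' Av vg Gv] _]]] := key z (ltr0_neq0 z0).
  have gg : g' = g by have := congr1 (fun U : space => U.1.2) Wg'; rewrite Wg.
  have [[Al _] _ _ _ _] := BS.
  rewrite (injective_of_bound Al (lower_inj BS z0) du Av)//.
  by rewrite ug vg gg.
have [v [g' [[Wg' _ _ _] [Cv vg Gv]]]] := key z (lt0r_neq0 z0).
have gg : g' = g by have := congr1 (fun U : space => U.1.2) Wg'; rewrite Wg.
have [[_ Cl] _ _ _ _] := BS.
rewrite (injective_of_bound Cl (upper_inj BS z0) du Cv)//.
by rewrite ug vg gg.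
Qed.

Lemma closure_resolvent_span :
  closure (lspan (\bigcup_(z in [set z : R[i] | Im z != 0])
     (resolvent Lop z @` cyl [set 0]))) = orth_in setT Hs0.
Proof.
set S := \bigcup_(z in _) _; have Sc := closed_subspace_closure (lspan_subspace S).
rewrite -(orth_in_orth_in Sc (closed_subspaceW Lt))//; congr (orth_in _ _).
rewrite orth_in_closure; apply/seteqP; split=> [W [_ WS]|W HW].
  apply: resolvent_span_orth => z U z0 dU F0; apply: WS; apply: sub_lspan.
  exists z => //; exists (Lop U - z *: U) => //.
  exact: (resolventE Ll (Linj z0) dU).
split=> //; apply: orth_lspan => _ [z z0 [F F0 <-]].
have [dU UF] := resolventP Ll (Lo z0) (Linj z0) F.
have [_ h] : orth_in setT Hs0 (resolvent Lop z F).
  rewrite orth_Hs0; apply: (Kc_resolvent z0 dU); rewrite UF.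
  by rewrite /dil_cyl /= F0; have [] := Hcns_closed A G Gs.
by rewrite innerC h// rmorph0.
Qed.

End dilation_structure.

(** * Minimality *)

Section exponential_pairing.
Context (R : realType) (i : interval R) (sg : R) (hl : half_line i sg).
Context (E : hilbertType R).
Local Notation L2i := (L2 (leb_on i) E).

(** With zero boundary value, [v |-> 'i v'] may be moved to the exponential, an
    eigenfunction. *)
Lemma zero_trace_pairing (v d : L2i) (lam : R) (lam0 : 0 < lam) x : ac_trace v d 0 ->
  '['i%C *: d - ('i%C * sgC sg * lam%:C) *: v, Exp hl lam0 x] = 0.
Proof.
move=> vd; have := ac_trace_green hl vd (ac_trace_Exp hl lam0 x).
rewrite inner0l mulr0 oppr0 innerBl innerZl => h.
rewrite -[RHS]h; congr (_ - _); rewrite scalerN scalerA innerNr innerZr innerZl.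
have -> : ('i%C * (sgC sg * lam%:C))^* = - ('i%C * sgC sg * lam%:C).
  by apply: complex_eq; rewrite /=; ring.
by rewrite mulNr opprK.
Qed.

End exponential_pairing.

Section dilation_minimality.
Context (R : realType) (H E Es : hilbertType R) (A : operator H H).
Context (G : H -> E) (Gs : H -> Es).
Local Notation C := (adjoint setT A).
Context (BS : boundary_system A C G Gs).
Context (mu lam : R[i]) (mu0 : Im mu < 0) (lam0 : 0 < Im lam).
Local Notation Lop := (dilop A G Gs mu lam).
Local Notation space := (dilspace H E Es).
Local Notation inj := (dil_inj E Es).
Local Notation cyl := (dil_cyl E Es).
Local Notation Hc := (Hcns A G Gs).
Local Notation Hc0 := (inj @` Hc).
Local Notation Kc := (cyl Hc).
Local Notation Acns := (dil_op E Es (restr Hc A)).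
Implicit Types (U V W F : space) (z : R[i]) (u v g : H).

Let toG := dilop_graph BS mu0 lam0.
Let Ll := dilop_linear BS mu0 lam0.
Let Ls := dilop_symmetric BS mu0 lam0.
Let Lo := dilop_onto BS mu0 lam0.
Let hm := half_line_neg R.
Let hp := half_line_pos R.
Let Kcc : closed_subspace Kc := Kc_closed A G Gs.
Let Hc0c : closed_subspace Hc0 := closed_dil_inj E Es (Hcns_closed A G Gs).
Let Al : linear_op A. Proof. by case: BS => -[]. Qed.

Lemma Hcns_dom u : dom A u -> Hc u -> Hc (A u).
Proof. by move=> Au Hu; have [[[_ _ _ h _] _] _] := Hcns_maximal BS; exact: h. Qed.

Lemma dil_op_linear : linear_op Acns.
Proof.
have [B0 BD BP] := restr_linear (closed_subspaceW (Hcns_closed A G Gs)) Al.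
split=> [|a _ _ [u du <-] [v dv <-]|a _ _ [u du <-] [v dv <-]].
- by exists 0.
- by exists (a *: u + v); [exact: BD|rewrite dil_inj_lin].
by rewrite -dil_inj_lin /= -[RHS]dil_inj_lin; congr (inj _); exact: BP.
Qed.

Lemma dil_op_maximal : maximal_dissipative Hc0 Acns.
Proof.
have Ni : Im (- 'i%C : R[i]) < 0 by rewrite /= oppr_lt0.
apply: (maxdiss_crit (z := - 'i%C)) => //.
- exact: dil_op_linear.
- by move=> _ [u [_ Hu] <-]; exists u.
- by move=> _ [u [Au Hu] <-]; exists (A u) => //; exact: Hcns_dom.
- move=> _ [u [Au Hu] <-]; rewrite [X in '[X, _]](_ : _ = inj (A u))// inner_dil_inj.
  exact: (boundary_dissipative BS Au).
move=> _ [h Hh <-]; have [_ _ [Ao _] _ _] := BS.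
have [u Au uh] := Ao _ Ni h I.
have Hu : Hc u by apply: (Hcns_resolvent BS Ni Au); rewrite uh.
exists (inj u); first by exists u.
rewrite [X in X - _](_ : _ = inj (A u))// -uh -scaleNr addrC -dil_inj_lin; congr (inj _).
by rewrite scaleNr addrC.
Qed.

Lemma Kc_dom U : dom Lop U -> Kc U -> Kc (Lop U).
Proof.
move=> dU KU; have := reducing_Hs0 BS mu0 lam0.
move=> [_ _ _]; rewrite orth_Hs0 => /(_ U dU)[_].
by rewrite (orth_proj_id (closed_subspaceW Kcc) KU).
Qed.

Let Li z : Im z != 0 -> forall U, dom Lop U -> Lop U - z *: U = 0 -> U = 0 :=
  symmetric_inj Ls.

Lemma dilop_Kc_onto z : Im z != 0 -> onto Kc (restr Kc Lop) z.
Proof.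
move=> z0 F KF; have [U dU UF] := Lo z0 (f := F) I.
by exists U => //; split=> //; apply: (Kc_resolvent BS mu0 lam0 z0 dU); rewrite UF.
Qed.

Lemma selfadjoint_Kc : selfadjoint Kc (restr Kc Lop).
Proof.
have i0 : Im ('i%C : R[i]) != 0 by rewrite /= oner_neq0.
apply: (selfadjoint_crit (z := 'i%C)) => //.
- exact: restr_linear (closed_subspaceW Kcc) Ll.
- by move=> U [].
- by move=> U [dU KU]; exact: Kc_dom.
- by move=> U V [dU _] [dV _]; exact: Ls.
- exact: dilop_Kc_onto.
by apply: dilop_Kc_onto; rewrite conj_Im oppr_eq0.
Qed.

(** In the lower half-plane an element [v] of [L^2(R^-)] with [i v' = z v] vanishes,
    so the incoming boundary value is zero and [u] solves [(A - z) u = h]. *)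
Lemma compression z U h : Im z < 0 -> dom Lop U -> Lop U - z *: U = inj h ->
  dom A U.1.2 /\ A U.1.2 - z *: U.1.2 = h.
Proof.
move=> z0 /toG [dm [dp [phi [psi [um up ut ->]]]]] eU.
have eM : 'i%C *: dm - z *: U.1.1 = 0 := congr1 (fun V : space => V.1.1) eU.
have eH : (Lop U).1.2 - z *: U.1.2 = h := congr1 (fun V : space => V.1.2) eU.
have phi0 : phi = 0.
  have := ac_trace_green hm um um; move/eqP: eM; rewrite subr_eq0 => /eqP ->.
  rewrite innerZl innerZr !inner_nrm /sgC rmorphN1 mulrN1 mulNr opprK => /(congr1 Im).
  have := sqr_ge0 (nrm U.1.1); have := nrm_ge0 phi => p0.
  move: (nrm U.1.1 ^+ 2) (nrm phi) (@nrm0_eq0 _ _ phi) p0 => q p pz p0 q0.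
  case: z z0 {eU eH} => a b /= b0.
  move=> e; apply: pz; apply/eqP; rewrite -sqrf_eq0 eq_le sqr_ge0 andbT.
  by have := mulr_le0_ge0 (ltW b0) q0; lra.
have [|Aa aE] := mem_dom_A BS (a := U.1.2) (t := (Lop U).1.2).
  move=> y Cy; have := ut.2 y Cy; rewrite phi0 inner0l addr0 => h'.
  by rewrite innerC h' -innerC.
by rewrite aE.
Qed.

Lemma dilation_Kc : selfadjoint_dilation Kc (restr Kc Lop) Hc0 Acns.
Proof.
split; [exact: dil_op_maximal|exact: selfadjoint_Kc|by move=> _ [u Hu <-]|].
move=> z z0 _ [h Hh <-].
have [U [dU KU] UE] := dilop_Kc_onto (ltr0_neq0 z0) (f := inj h) Hh.
have Bl := dil_op_linear; have [[_ Bd] _] := dil_op_maximal.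
have Rl := restr_linear (closed_subspaceW Kcc) Ll.
have Ri V : dom (restr Kc Lop) V -> restr Kc Lop V - z *: V = 0 -> V = 0.
  by move=> [dV _]; exact: (Li (ltr0_neq0 z0)).
rewrite (resolventE Rl Ri (conj dU KU) UE).
have [Au uE] := compression z0 dU UE.
have du : dom Acns (inj U.1.2) by exists U.1.2.
rewrite (resolventE Bl (dissipative_inj Bd z0) du (h := inj h)); last first.
  rewrite [X in X - _](_ : _ = inj (A U.1.2))// -uE -scaleNr addrC -dil_inj_lin.
  by congr (inj _); rewrite scaleNr addrC.
apply/esym/(orth_proj_unique (closed_subspaceW Hc0c)); first by exists U.1.2.
by move=> _ [k Hk <-]; rewrite innerC inner_dil_inj /= subrr inner0r conjC0.
Qed.

(** Let [X] be the complement in [Kc] of a reducing subspace that contains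
    [Hc0]. For [U] in [X], both [V = (L - z)^-1 U] and [L V] lie in [X], so their
    middle components vanish and the boundary values of [V] vanish by density of the
    ranges of [G] and [Gs]. Then [zero_trace_pairing], with [z] the eigenvalue of an
    exponential, makes the outer components of [U] orthogonal to it; as this
    happens for every exponential, [U = 0]. *)
Lemma dilation_minimal : minimal_selfadjoint_dilation Kc (restr Kc Lop) Hc0 Acns.
Proof.
split; first exact: dilation_Kc.
move=> [K1 [K1r HK K1n _]]; apply: K1n.
have [K1c K1K _ _] := K1r; have Rl := restr_linear (closed_subspaceW Kcc) Ll.
have DK : dom (restr Kc Lop) `<=` Kc by move=> U [].
have Xs := closed_subspaceW (closed_subspace_orth K1 Kcc).
have XH V : orth_in Kc K1 V -> V.1.2 = 0.
  move=> [KV VK]; apply: inner_eq0; rewrite -inner_dil_inj innerC VK ?conjC0//.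
  by apply: HK; exists V.1.2.
have shift U z : Im z != 0 -> orth_in Kc K1 U -> exists V dm dp,
    [/\ ac_trace V.1.1 dm 0, ac_trace V.2 dp 0,
        U.1.1 = 'i%C *: dm - z *: V.1.1 & U.2 = 'i%C *: dp - z *: V.2].
  move=> z0 XU; have [V [dV KV] VE] := dilop_Kc_onto z0 XU.1.
  have Ri W : dom (restr Kc Lop) W -> restr Kc Lop W - z *: W = 0 -> W = 0.
    by move=> [dW _]; exact: (Li z0).
  have [_ h] := reducing_resolvent Kcc Rl DK Ri K1r.
  have XV : orth_in Kc K1 V by apply: (h V (conj dV KV)); rewrite VE.
  have XLV : orth_in Kc K1 (Lop V).
    rewrite (_ : Lop V = U + z *: V); first exact: (subspaceD Xs XU (subspaceZ _ Xs XV)).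
    by rewrite -VE subrK.
  have [dm [dp [phi [psi [vm vp vt vE]]]]] := toG dV.
  rewrite (XH _ XV) (XH _ XLV) in vt.
  have psi0 : psi = 0.
    by apply: (G_dense BS) => x Ax; have := vt.1 x Ax; rewrite !inner0l add0r.
  have phi0 : phi = 0.
    by apply: (Gs_dense BS) => y Cy; have := vt.2 y Cy; rewrite !inner0l add0r.
  exists V, dm, dp; rewrite phi0 in vm; rewrite psi0 in vp; split=> //.
    by rewrite -VE [restr _ _ _]vE.
  by rewrite -VE [restr _ _ _]vE.
have X0 U : orth_in Kc K1 U -> U = 0.
  move=> XU; have nz (s l : R) : s * l != 0 -> Im ('i%C * s%:C * l%:C) != 0.
    by move=> sl; rewrite /= !(mulr0, mul0r, mul1r, add0r, subr0, addr0).
  have e1 : U.1.1 = 0.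
    apply: (@Exp_total _ _ _ hm Es U.1.1 0 (lexx _)) => l l0 _ x.
    have nl : -1 * l != 0 by rewrite mulN1r oppr_eq0 gt_eqF.
    have [V [dm [dp [vm _ -> _]]]] := shift U _ (nz _ _ nl) XU.
    exact: zero_trace_pairing.
  have e2 : U.2 = 0.
    apply: (@Exp_total _ _ _ hp E U.2 0 (lexx _)) => l l0 _ x.
    have nl : 1 * l != 0 by rewrite mul1r gt_eqF.
    have [V [dm [dp [_ vp _ ->]]]] := shift U _ (nz _ _ nl) XU.
    exact: zero_trace_pairing.
  by move: (XH _ XU) e1 e2; case: U {XU} => -[um u] up /= -> -> ->.
apply/seteqP; split=> // U KU.
have := orth_proj_rest K1c (closed_subspaceW Kcc) K1K KU => /X0/eqP.
by rewrite subr_eq0 => /eqP ->; exact: (orth_projP U K1c).1.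
Qed.

End dilation_minimality.

Theorem theorem7p6 (R : realType) (H E Es : hilbertType R)
    (A : operator H H) (G : H -> E) (Gs : H -> Es) (mu lam : R[i])
    (A_maximal_dissipative : maximal_dissipative setT A)
    (G_boundary : boundary_operator A G 'i%C)
    (Gs_boundary : boundary_operator (adjoint setT A) Gs (- 'i%C))
    (Im_mu : complex.Im mu < 0) (Im_lam : 0 < complex.Im lam) :
  let Hc := Hcns A G Gs in
  let Hs := orth_in setT Hc in
  let A_sa := restr Hs A in
  let A_cns := restr Hc A in
  let L := dilop A G Gs mu lam in
  let Hs0 := dil_inj E Es @` Hs in
  let Hc0 := dil_inj E Es @` Hc in
  let Kc := dil_cyl E Es Hc in
  reducing setT A Hc /\
  selfadjoint Hs A_sa /\
  completely_nonselfadjoint Hc A_cns /\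
  (reducing setT L Hs0 /\ op_eq (restr Hs0 L) (dil_op E Es A_sa)) /\
  (closure (lspan (\bigcup_(z in [set z : R[i] | complex.Im z != 0])
               (resolvent L z @` dil_cyl E Es [set 0]))) = orth_in setT Hs0 /\
             orth_in setT Hs0 = Kc) /\
  minimal_selfadjoint_dilation Kc (restr Kc L) Hc0 (dil_op E Es A_cns).
Proof.
move=> Hc Hs A_sa A_cns L Hs0 Hc0 Kc.
have BS := boundary_system_adjoint A_maximal_dissipative G_boundary Gs_boundary.
split; first exact: reducing_Hcns BS.
split; first exact: selfadjoint_Hs BS.
split; first exact: Hcns_completely_nonselfadjoint BS.
split; first by split; [exact: reducing_Hs0 BS _ _ Im_mu Im_lam|exact: dilop_Hs0 BS _ _ Im_mu Im_lam].
split; first by split; [exact: closure_resolvent_span BS _ _ Im_mu Im_lam|exact: orth_Hs0].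
exact: dilation_minimal BS _ _ Im_mu Im_lam.
Qed.
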